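(* Let $(\mathcal{T}_n,\beta_n)$ be the random $\mathcal{R}$-enriched plane tree obtained by drawing the simply generated tree $\mathcal{T}_n$ for $\mathbf{w}$ and then, conditionally independently for each vertex $v$, a structure $\beta_n(v)\in\mathcal{R}[[d^+_{\mathcal{T}_n}(v)]]$ with probability $\kappa(\beta_n(v))/|\mathcal{R}[d^+_{\mathcal{T}_n}(v)]|_\kappa$. Define $(\hat{\mathcal{T}},\hat\beta)$ by letting $\hat{\mathcal{T}}$ be the modified Galton--Watson tree associated with $(\pi_k)_k$ and, conditionally on $\hat{\mathcal{T}}$, choosing independently for each vertex $v$ with $d^+_{\hat{\mathcal{T}}}(v)<\infty$ a structure $\hat\beta(v)\in\mathcal{R}[[d^+_{\hat{\mathcal{T}}}(v)]]$ with probability $\kappa(\hat\beta(v))/|\mathcal{R}[d^+_{\hat{\mathcal{T}}}(v)]|_\kappa$, and setting $\hat\beta(v)=\infty$ if $d^+_{\hat{\mathcal{T}}}(v)=\infty$. Then $(\mathcal{T}_n,\beta_n)$ converges in distribution to $(\hat{\mathcal{T}},\hat\beta)$ in the space $\mathfrak{A}$, as $n\to\infty$ along the integers $n$ with $|\mathcal{A}_\mathcal{R}[n]|_\omega>0$.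
   Context: A weighted species $\mathcal{R}^\kappa$ assigns to each finite set $U$ a finite set $\mathcal{R}[U]$ of structures, to each bijection $\sigma:U\to V$ a bijection $\mathcal{R}[\sigma]:\mathcal{R}[U]\to\mathcal{R}[V]$ (functorially), and weights $\kappa(R)\ge0$ invariant under these bijections. Write $[k]=\{1,\dots,k\}$, $|\mathcal{R}[k]|_\kappa=\sum_{R\in\mathcal{R}[[k]]}\kappa(R)$, and $\mathbf{w}=(\omega_k)_{k\ge0}$ with $\omega_k=|\mathcal{R}[k]|_\kappa/k!$, assumed to satisfy $\omega_0>0$ and $\omega_k>0$ for some $k\ge2$. $|\mathcal{A}_\mathcal{R}[n]|_\omega$ is the total weight $\sum\prod_v\kappa(\alpha(v))$ over all $\mathcal{R}$-enriched trees $(A,\alpha)$ on $[n]$ (rooted unordered trees $A$ on $[n]$ with $\alpha(v)\in\mathcal{R}[\text{offspring set of }v]$); it is positive iff the total weight of $n$-vertex plane trees below is positive. The simply generated tree $\mathcal{T}_n$ is the random plane tree with $n$ vertices drawn with probability proportional to $\prod_v\omega_{d^+(v)}$ ($d^+$ = outdegree). Let $\phi(z)=\sum_k\omega_kz^k$ with radius of convergence $\rho_\phi$. If $\rho_\phi>0$ let $\psi(t)=t\phi'(t)/\phi(t)$ on $[0,\rho_\phi)$ and $\nu=\lim_{t\uparrow\rho_\phi}\psi(t)\in(0,\infty]$; if $\rho_\phi=0$ let $\nu=0$. If $\nu\ge1$ let $\tau\in(0,\rho_\phi]$ be the unique number with $\psi(\tau)=1$, otherwise $\tau=\rho_\phi$.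 Let $\pi_k=\tau^k\omega_k/\phi(\tau)$ (the point mass at $0$ if $\tau=0$); this is a probability distribution with mean $\mu=\min(\nu,1)\le 1$. Modified Galton--Watson tree $\hat{\mathcal{T}}$: let $\xi$ have law $(\pi_k)$ and let $\hat\xi\in\mathbb{N}_0\cup\{\infty\}$ have $\mathbb{P}(\hat\xi=k)=k\pi_k$, $\mathbb{P}(\hat\xi=\infty)=1-\mu$. Vertices are normal or special; the root is special. A normal vertex has an independent copy of $\xi$ children, all normal. A special vertex has an independent copy of $\hat\xi$ children; if this is infinite all children are normal, otherwise one uniformly chosen child is special and the others normal. Children are ordered $1,2,\dots$. Spaces: let $\mathcal{V}_\infty$ be the set of finite sequences of positive integers (Ulam--Harris tree; the children of $v$ are $v1,v2,\dots$). A plane tree, possibly with vertices of infinite outdegree, is identified with a subtree of $\mathcal{V}_\infty$. Let $X=\{*,\infty\}\sqcup\bigsqcup_{n\ge0}\mathcal{R}[[n]]$, where $X\setminus\{\infty\}$ is discrete and $X$ is its one-point compactification (if the sizes of $\mathcal{R}$-structures are bounded, instead $X=\{*\}\sqcup\bigsqcup_n\mathcal{R}[[n]]$ discrete). An $\mathcal{R}$-enriched plane tree $(T,\beta)$ (plane tree $T$ with $\beta(v)\in\mathcal{R}[[d^+_T(v)]]$, label $i$ corresponding to the $i$-th child) is encoded as the element of $X^{\mathcal{V}_\infty}$ with $\beta(v)=*$ for $v\notin T$ and $\beta(v)=\infty$ when $d^+_T(v)=\infty$. $\mathfrak{A}\subset X^{\mathcal{V}_\infty}$ is the set of all such encodings,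 with the product topology (a compact Polish space). *)

(* Defs.v *)
From HB Require Import structures.
From mathcomp Require Import all_boot all_order all_algebra all_fingroup.
From mathcomp Require Import all_classical all_reals all_analysis.
Set Implicit Arguments. Unset Strict Implicit. Unset Printing Implicit Defensive.
Import Order.TTheory GRing.Theory Num.Theory.
Import numFieldNormedType.Exports.
Local Open Scope classical_set_scope.
Local Open Scope ring_scope.

(* Weighted species, given through its restriction to the sets [k]    *)
(* (here 'I_k, label i+1 <-> ordinal i): S k = R[[k]] (finite), the   *)
(* S_k-action act k, and weights kappa k.                             *)

Definition wsum (R : realType) (S : nat -> finType)
  (kappa : forall k, S k -> R) (k : nat) : R :=
  \sum_(r : S k) kappa k r.

Definition omega (R : realType) (S : nat -> finType)
  (kappa : forall k, S k -> R) (k : nat) : R :=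
  wsum kappa k / (k`!)%:R.

Definition phi (R : realType) (S : nat -> finType)
  (kappa : forall k, S k -> R) (z : R) : R :=
  limn (series (fun k => omega kappa k * z ^+ k)).

(* radius of convergence (coefficients are nonnegative) *)
Definition rho_phi (R : realType) (S : nat -> finType)
  (kappa : forall k, S k -> R) : \bar R :=
  ereal_sup [set z%:E | z in
    [set z : R | 0 <= z /\ cvgn (series (fun k => omega kappa k * z ^+ k))]].

Definition psi (R : realType) (S : nat -> finType)
  (kappa : forall k, S k -> R) (t : R) : R :=
  t * derive1 (phi kappa) t / phi kappa t.

Definition nu (R : realType) (S : nat -> finType)
  (kappa : forall k, S k -> R) : \bar R :=
  match rho_phi kappa with
  | EFin r => if r == 0 then 0%E
              else lim ((psi kappa t)%:E @[t --> r^'-])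
  | EPInf => lim ((psi kappa t)%:E @[t --> +oo])
  | ENInf => 0%E
  end.

Definition psibar (R : realType) (S : nat -> finType)
  (kappa : forall k, S k -> R) (t : R) : \bar R :=
  if t%:E == rho_phi kappa then nu kappa else (psi kappa t)%:E.

(* tau: if nu >= 1 the (unique) t in (0, rho] with psi(t) = 1, else rho *)
Definition tau (R : realType) (S : nat -> finType)
  (kappa : forall k, S k -> R) : R :=
  if (1 <= nu kappa)%E then
    match pselect (exists t : R, 0 < t /\ (t%:E <= rho_phi kappa)%E
                                 /\ psibar kappa t = 1%E) with
    | left h => projT1 (cid h)
    | right _ => fine (rho_phi kappa)
    end
  else fine (rho_phi kappa).

Definition pi_ (R : realType) (S : nat -> finType)
  (kappa : forall k, S k -> R) (k : nat) : R :=
  tau kappa ^+ k * omega kappa k / phi kappa (tau kappa).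

Definition mu (R : realType) (S : nat -> finType)
  (kappa : forall k, S k -> R) : R :=
  fine (Order.min (nu kappa) 1%E).

(* The space X = {*, oo} + disjoint union of the R[[k]], and X^V.     *)
(* Vertices of the Ulam--Harris tree are words v : seq nat; the i-th   *)
(* child (i >= 1) of v is rcons v i.                                   *)
Inductive Xval (S : nat -> Type) : Type :=
| XStar : Xval S
| XInfty : Xval S
| XStr (k : nat) (r : S k) : Xval S.
Arguments XStar {S}.
Arguments XInfty {S}.
Arguments XStr {S k} r.

(* basic neighbourhoods in X: {a} for a <> oo, and
   {oo} u (disjoint union of R[[k]], k >= N) for a = oo
   (one-point compactification of the discrete space X \ {oo}) *)
Definition xnear (S : nat -> Type) (N : nat) (a b : Xval S) : Prop :=
  match a with
  | XInfty => b = XInfty \/ exists k (r : S k), (N <= k)%N /\ b = XStr r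
  | _ => b = a
  end.

Definition prod_continuous (R : realType) (S : nat -> Type)
  (f : (seq nat -> Xval S) -> R) : Prop :=
  forall (x : seq nat -> Xval S) (eps : R), 0 < eps ->
    exists (L : seq (seq nat)) (N : nat),
      forall y : seq nat -> Xval S,
        (forall v, v \in L -> xnear N (x v) (y v)) -> `|f y - f x| < eps.

(* Finite plane trees (possibly enriched) with n vertices, as          *)
(* functions on the finite box of words of length < n with letters    *)
(* < n (every n-vertex plane tree fits in this box).                   *)
Definition Box (n : nat) := {k : 'I_n & k.-tuple 'I_n}.
Definition boxval (n : nat) (b : Box n) : seq nat :=
  map (@nat_of_ord n) (tagged b).

(* outdegree data: None = not a vertex, Some None = infinite outdegree,
   Some (Some k) = outdegree k *)
Definition allows (d : option (option nat)) (i : nat) : bool :=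
  match d with None => false | Some None => true | Some (Some k) => (i <= k)%N end.

Definition is_plane_tree (d : seq nat -> option (option nat)) : Prop :=
  d [::] <> None /\
  forall v i, d (rcons v i) <> None <-> ((0 < i)%N && allows (d v) i).

(* a shape: outdegree of each box vertex (None = not in the tree) *)
Definition shape_ext (n : nat) (s : {ffun Box n -> option 'I_n})
  (v : seq nat) : option (option nat) :=
  match [pick b | boxval b == v] with
  | Some b => omap (fun k => Some (nat_of_ord k)) (s b)
  | None => None
  end.

Definition plane_tree_n (n : nat) (s : {ffun Box n -> option 'I_n}) : bool :=
  `[< is_plane_tree (shape_ext s) >] && (#|[set b | s b != None]| == n).

Definition omegaW (R : realType) (S : nat -> finType)
  (kappa : forall k, S k -> R) (n : nat) (s : {ffun Box n -> option 'I_n}) : R :=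
  \prod_(b : Box n) (if s b is Some k then omega kappa k else 1).

Definition Zn (R : realType) (S : nat -> finType)
  (kappa : forall k, S k -> R) (n : nat) : R :=
  \sum_(s : {ffun Box n -> option 'I_n} | plane_tree_n s) omegaW kappa s.

Definition EBox (S : nat -> finType) (n : nat) :=
  {ffun Box n -> option {k : 'I_n & S k}}.

Definition eshape (S : nat -> finType) (n : nat) (e : EBox S n)
  : {ffun Box n -> option 'I_n} :=
  [ffun b => omap (fun p => tag p) (e b)].

Definition ext (S : nat -> finType) (n : nat) (e : EBox S n)
  (v : seq nat) : Xval S :=
  match [pick b | boxval b == v] with
  | Some b => match e b with
              | Some p => XStr (tagged p)
              | None => XStar
              end
  | None => XStar
  end.

Definition condW (R : realType) (S : nat -> finType)
  (kappa : forall k, S k -> R) (n : nat) (e : EBox S n) : R :=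
  \prod_(b : Box n)
     (if e b is Some p then kappa _ (tagged p) / wsum kappa (tag p) else 1).

Definition En (R : realType) (S : nat -> finType)
  (kappa : forall k, S k -> R) (f : (seq nat -> Xval S) -> R) (n : nat) : R :=
  \sum_(e : EBox S n | plane_tree_n (eshape e))
     (omegaW kappa (eshape e) / Zn kappa n) * condW kappa e * f (ext e).

(* The limit (hat T, hat beta), built from an independent family of    *)
(* vertex data Z (v, special?) : Omega -> X * nat.  For a normal       *)
(* vertex the datum is (beta(v), 0); for a special vertex it is        *)
(* (beta(v), j) with j the index of the special child (j = 0 when      *)
(* beta(v) = oo, i.e. infinite outdegree).                             *)
Definition allowsX (S : nat -> Type) (x : Xval S) (i : nat) : bool :=
  match x with XStar => false | XInfty => true | XStr k _ => (i <= k)%N end.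

(* status of the vertex pre ++ w, given that pre is in the tree with
   status b (true = special): None = not in the tree *)
Fixpoint status_aux (S : nat -> Type) (z : seq nat * bool -> Xval S * nat)
  (pre : seq nat) (b : bool) (w : seq nat) : option bool :=
  match w with
  | [::] => Some b
  | i :: w' =>
      let p := z (pre, b) in
      if (0 < i)%N && allowsX p.1 i
      then status_aux z (rcons pre i) (b && (i == p.2)) w'
      else None
  end.

Definition hat_beta (S : nat -> Type) (z : seq nat * bool -> Xval S * nat)
  (v : seq nat) : Xval S :=
  match status_aux z [::] true v with
  | None => XStar
  | Some b => (z (v, b)).1
  end.

Definition mutually_independent (R : realType) (d : measure_display)
  (T : measurableType d) (P : probability T R) (I : eqType) (V : Type)
  (Y : I -> T -> V) : Prop :=
  forall (l : seq I), uniq l -> forall x : I -> V,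
    P (\bigcap_(i in [set i | i \in l]) (Y i @^-1` [set x i])) =
    (\prod_(i <- l) P (Y i @^-1` [set x i]))%E.

(* Main.v *)
Require Import Defs.
From HB Require Import structures.
From mathcomp Require Import all_boot all_order all_algebra all_fingroup.
From mathcomp Require Import all_classical all_reals all_analysis.
From mathcomp Require Import measurable_realfun zify ring lra.
Set Implicit Arguments. Unset Strict Implicit. Unset Printing Implicit Defensive.
Import Order.TTheory GRing.Theory Num.Theory.
Import numFieldNormedType.Exports.
Local Open Scope classical_set_scope.
Local Open Scope ring_scope.

(* Dividing the weight of a structure of size k by k! turns the enriched tree into a tree
   whose vertices carry independent weights. By the cycle lemma the total weight of the
   ordered forests of k trees with n vertices is k / n times the coefficient of
   z ^ (n - k) in phi ^ n, so the probability that T_n extends a given finite partial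
   tree is a ratio of two such coefficients.

   Ratio limit. Let s > 0 or s < 0 be small and multiply omega_d by e ^ s. By
   exchangeability and Jensen's inequality the coefficient of phi ^ n grows at least by
   the factor exp (s n x), where x is the ratio to be determined, whereas the bound
   phi(tau) ^ n for the tilted series allows a growth of at most
   (1 + (e ^ s - 1) pi_d) ^ n. The untilted coefficient is not exponentially smaller than
   phi(tau) ^ n / tau ^ n, since otherwise the generating function of trees would
   converge beyond tau / phi(tau), against the optimality of tau. Hence x tends to pi_d.
   If tau = 0, the coefficients of phi grow so fast that any copies of omega_d z ^ d can
   be traded for others at an arbitrarily small price, and x tends to 0 for d > 0.

   Hence the probability that T_n starts with a pattern with finite degrees converges, and
   the limit is its probability in the limit tree, whose spine is equally likely to leave
   the pattern through each of its unexplored children. A vertex of infinite degree is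
   replaced by one of degree at least M: subtracting the contributions of the degrees
   below M leaves the mass 1 - mu missing from the size-biased law as M grows.
   These patterns carry full mass in the limit, so lower bounds on limits suffice: f is
   bounded below by its infimum over the neighbourhood of a pattern in a large box, which
   gives liminf E f(T_n) >= E f(T) for f >= 0, and this is applied to C + f and C - f. *)

(** * Convolution powers and the cycle lemma *)

(** The weights may have infinite variance and periodic support, and tau may lie on the boundary of
    the disc of convergence or be 0, so no single local limit theorem covers all cases. Comparing
    exponential rates does: a tilt acts on each of about n factors, so an error in x that does not
    vanish would change the coefficient by a factor exponential in n, which no subexponential
    uncertainty about its size can hide. For tau > 0 the argument uses of tau only that phi(tau)
    bounds the partial sums at tau and that tau minimises phi(t) / t over the points of convergence.
    Periodicity is met by taking each limit along those n at which the denominator is positive. On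
    the side of the limit tree, the size bias k pi_k and the uniform choice among k children cancel,
    so a pattern has the same probability for each exit of the spine, and a union bound over the
    exits integrates the spine out. *)

Section ConvolutionPowers.
Variables (R : realFieldType).
Implicit Types (a : nat -> R) (n m d k : nat).

Lemma eqr_le (x y : R) : x = y -> x <= y.
Proof. by move->. Qed.

(* The coefficient of z ^ m in (sum_k a_k z ^ k) ^ n. *)
Fixpoint cpow a n m : R :=
  if n is n'.+1 then \sum_(0 <= k < m.+1) a k * cpow a n' (m - k)
  else (m == 0)%:R.

Lemma cpowS a n m :
  cpow a n.+1 m = \sum_(0 <= k < m.+1) a k * cpow a n (m - k).
Proof. by []. Qed.

Lemma cpow_ge0 a n m : (forall k, 0 <= a k) -> 0 <= cpow a n m.
Proof.
move=> a0; elim: n m => [|n IH] m; first by rewrite ler0n.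
by rewrite cpowS; apply: sumr_ge0 => k _; rewrite mulr_ge0.
Qed.

Lemma sum_triangle_swap (E : nat -> nat -> R) m :
  \sum_(0 <= k < m.+1) \sum_(0 <= j < (m - k).+1) E k j =
  \sum_(0 <= j < m.+1) \sum_(0 <= k < (m - j).+1) E k j.
Proof.
have trunc (G : nat -> R) i : (i < m.+1)%N ->
    \sum_(0 <= j < (m - i).+1) G j = \sum_(0 <= j < m.+1 | (i + j <= m)%N) G j.
  move=> im; rewrite (big_nat_widen _ _ m.+1) ?ltnS ?leq_subr //.
  by apply: eq_bigl => j; rewrite /= ltnS leq_subRL // -ltnS.
under eq_big_nat => k /andP[_ km] do rewrite trunc //.
rewrite (exchange_big_dep_nat xpredT) //=.
apply: eq_big_nat => j /andP[_ jm]; rewrite trunc //.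
by apply: eq_bigl => k; rewrite addnC.
Qed.

Lemma ler_term_sum (E : nat -> R) k n : (forall i, 0 <= E i) -> (k < n)%N ->
  E k <= \sum_(0 <= i < n) E i.
Proof.
move=> E0 kn; rewrite (big_cat_nat (n := k)) //=; last exact: ltnW.
by rewrite [X in _ + X]big_ltn // addrCA lerDl addr_ge0 // sumr_ge0.
Qed.

Lemma ler_sum_widen (E : nat -> R) n n' : (forall i, 0 <= E i) -> (n <= n')%N ->
  \sum_(0 <= i < n) E i <= \sum_(0 <= i < n') E i.
Proof.
move=> E0 nn'; rewrite (big_cat_nat (n := n) (p := n')) //=.
by rewrite lerDl; apply: sumr_ge0.
Qed.

(** Giving two groups of factors prescribed total degrees keeps only some of the terms. Repeating a
    block of factors through this inequality produces exponential lower bounds. *)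
Lemma cpow_supermul a n1 n2 m1 m2 : (forall k, 0 <= a k) ->
  cpow a n1 m1 * cpow a n2 m2 <= cpow a (n1 + n2) (m1 + m2).
Proof.
move=> a0; elim: n1 m1 => [|n1 IH] m1.
  by case: m1 => [|m1] /=; rewrite ?mul1r ?mul0r ?cpow_ge0.
rewrite addSn !cpowS mulr_suml.
apply: (@le_trans _ _ (\sum_(0 <= k < m1.+1) a k * cpow a (n1 + n2) (m1 - k + m2))).
  by apply: ler_sum => k _; rewrite -mulrA ler_wpM2l.
rewrite [leLHS](_ : _ =
    \sum_(0 <= k < m1.+1) a k * cpow a (n1 + n2) (m1 + m2 - k)); last first.
  by apply: eq_big_nat => k /andP[_ km]; rewrite -addnBAC.
apply: ler_sum_widen; last by rewrite ltnS leq_addr.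
by move=> i; rewrite mulr_ge0 ?cpow_ge0.
Qed.

Lemma cpow_term a n m k : (forall k, 0 <= a k) -> (k <= m)%N ->
  a k * cpow a n (m - k) <= cpow a n.+1 m.
Proof.
move=> a0 km; rewrite cpowS.
by apply: (@ler_term_sum (fun k => a k * cpow a n (m - k))) => // i;
  rewrite mulr_ge0 ?cpow_ge0.
Qed.

(* Exchangeability: each of the n + 1 factors carries on average the same
   share of the total degree m. *)
Lemma cpow_size_bias a n m :
  n.+1%:R * (\sum_(0 <= k < m.+1) k%:R * a k * cpow a n (m - k)) =
  m%:R * cpow a n.+1 m.
Proof.
elim: n m => [|n IH] m.
  rewrite cpowS mul1r !(big_nat_recr m) //= !big1_seq; last 2 first.
  - by move=> i /=; rewrite mem_index_iota => /andP[_ im]; rewrite subn_eq0 leqNgt im mulr0.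
  - by move=> i /=; rewrite mem_index_iota => /andP[_ im]; rewrite subn_eq0 leqNgt im mulr0.
  by rewrite !add0r mulrA.
set A := \sum_(0 <= k < _) _.
have AE : n.+1%:R * A = m%:R * cpow a n.+2 m - A.
  have HA : A = \sum_(0 <= k < m.+1) \sum_(0 <= j < (m - k).+1)
      k%:R * a k * (a j * cpow a n (m - k - j)).
    by apply: eq_bigr => k _; rewrite cpowS mulr_sumr.
  rewrite [in LHS]HA sum_triangle_swap [cpow a n.+2 m]cpowS /A !mulr_sumr -sumrB.
  apply: eq_big_nat => j /andP[_ jm].
  have -> : \sum_(0 <= k < (m - j).+1) k%:R * a k * (a j * cpow a n (m - k - j)) =
            a j * \sum_(0 <= k < (m - j).+1) k%:R * a k * cpow a n (m - j - k).
    rewrite mulr_sumr; apply: eq_bigr => k _.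
    by rewrite -!subnDA (addnC k); ring.
  rewrite mulrCA IH natrB //; ring.
by rewrite -[in LHS]natr1 mulrDl AE mul1r subrK.
Qed.

(* The total weight of the ordered forests of k plane trees with n vertices, explored
   depth first: k counts the vertices still to be visited. *)
Fixpoint forest a k n : R :=
  match n, k with
  | 0, _ => (k == 0)%:R
  | n'.+1, 0 => 0
  | n'.+1, k'.+1 => \sum_(0 <= d < n'.+1) a d * forest a (k' + d) n'
  end.

Lemma forest_ge0 a k n : (forall k, 0 <= a k) -> 0 <= forest a k n.
Proof.
move=> a0; elim: n k => [|n IH] [|k] /=; rewrite ?ler0n //.
by apply: sumr_ge0 => d _; rewrite mulr_ge0.
Qed.

Lemma forest_gt a k n : (n < k)%N -> forest a k n = 0.
Proof.
elim: n k => [|n IH] [|k] //= nk.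
by rewrite big1 // => d _; rewrite IH ?mulr0 //; lia.
Qed.

(** With more pending vertices than vertices left the weight is 0, so the range of degrees in the
    recursion may be any sufficiently large one. *)
Lemma forestS a k n M : (n - k < M)%N ->
  forest a k.+1 n.+1 = \sum_(0 <= d < M) a d * forest a (k + d) n.
Proof.
have key M' : (n - k < M')%N -> \sum_(0 <= d < M') a d * forest a (k + d) n =
    \sum_(0 <= d < (n - k).+1) a d * forest a (k + d) n.
  move=> nk; rewrite (big_cat_nat (n := (n - k).+1)) //=.
  rewrite [X in _ + X]big_nat_cond [X in _ + X]big1 ?addr0 // => d /andP[/andP[dn _] _].
  by rewrite forest_gt ?mulr0 //; lia.
by move=> nk; rewrite (key M) //= -(key n.+1) // ltnS leq_subr.
Qed.

(* The cycle lemma. *)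
Lemma forest_cpow a k n : (0 < n)%N -> (k <= n)%N ->
  n%:R * forest a k n = k%:R * cpow a n (n - k).
Proof.
case: n => // n _; elim: n k => [|n IH] [|k] kn; rewrite ?mulr0 ?mul0r //.
  case: k kn => // _; rewrite cpowS /= !big_nat1 /=; ring.
rewrite (@forestS a k n.+1 (n.+1 - k).+1) // cpowS.
rewrite subSS; set m := (n.+1 - k)%N.
have nz p : p.+1%:R != 0 :> R by rewrite pnatr_eq0.
apply: (mulfI (nz n)).
have H : n.+1%:R * (\sum_(0 <= d < m.+1) a d * forest a (k + d) n.+1) =
   \sum_(0 <= d < m.+1) (k + d)%:R * (a d * cpow a n.+1 (m - d)).
  rewrite mulr_sumr; apply: eq_big_nat => d /andP[_ dm].
  rewrite mulrCA IH; last by lia.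
  by rewrite /m subnDA mulrCA.
rewrite mulrCA H.
(* The factor k + d from the induction hypothesis splits into a constant part, which resums to the
   next power, and a size-biased part, which exchangeability evaluates. *)
have -> : \sum_(0 <= d < m.+1) (k + d)%:R * (a d * cpow a n.+1 (m - d)) =
  k%:R * cpow a n.+2 m + \sum_(0 <= d < m.+1) d%:R * a d * cpow a n.+1 (m - d).
  rewrite cpowS mulr_sumr -big_split /=; apply: eq_bigr => d _.
  by rewrite natrD; ring.
rewrite mulrDr cpow_size_bias -cpowS /m natrB; last by lia.
by rewrite -!natr1; ring.
Qed.

(** Depth-first exploration finishes the first j trees before it enters the other k; i counts the
    vertices of the former. *)
Lemma forest_add a j k n :
  forest a (j + k) n = \sum_(0 <= i < n.+1) forest a j i * forest a k (n - i).
Proof.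
elim: n j => [|n IH] [|j].
- by rewrite big_nat1 /= mul1r.
- by rewrite big_nat1 /= mul0r.
- rewrite big_nat_recl //= mul1r [X in _ + X]big1 ?addr0 // => i _.
  by rewrite mul0r.
rewrite big_nat_recl //= mul0r add0r.
transitivity (\sum_(0 <= i < n.+1) \sum_(0 <= d < n.+1)
   a d * (forest a (j + d) i * forest a k (n - i))).
  rewrite exchange_big /=; apply: eq_bigr => d _.
  by rewrite -mulr_sumr -IH; congr (_ * forest a _ _); lia.
apply: eq_big_nat => i /andP[_ ni]; rewrite subSS.
rewrite -/(forest a j.+1 i.+1) (@forestS a j i n.+1); last by lia.
by rewrite mulr_suml; apply: eq_bigr => d _; rewrite mulrA.
Qed.

End ConvolutionPowers.

(** * Exponential tilting of convolution powers *)

Section PowerEstimates.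
Variables (R : realType).
Implicit Types (a : nat -> R) (n m d k : nat).

(** The Cauchy or Chernoff bound: with nonnegative terms, a single coefficient of the n-th power is
    at most the whole sum at t. *)
Lemma cpow_le a (t V : R) n m : (forall k, 0 <= a k) -> 0 <= t ->
  (forall N, \sum_(0 <= k < N) a k * t ^+ k <= V) -> t ^+ m * cpow a n m <= V ^+ n.
Proof.
move=> a0 t0 HV; elim: n m => [|n IH] m.
  by case: m => [|m] /=; rewrite ?mulr1 ?expr0 ?mulr0 ?ler01.
have V0 : 0 <= V by have := HV 0%N; rewrite big_nil.
rewrite cpowS mulr_sumr.
apply: (@le_trans _ _ (\sum_(0 <= k < m.+1) a k * t ^+ k * V ^+ n)).
  rewrite big_nat_cond [leRHS]big_nat_cond.
  apply: ler_sum => k /andP[/andP[_ km] _].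
  rewrite -{1}(subnKC (n := m) (m := k)) // exprD mulrCA -mulrA -mulrA.
  rewrite ler_wpM2l // ler_wpM2l ?exprn_ge0 //.
by rewrite -mulr_suml exprS ler_wpM2r ?exprn_ge0.
Qed.

(** Marks the degree d: the coefficients of powers of the tilted series are generating functions in
    u of the number of factors that contribute degree d. *)
Definition tilt a d (u : R) k := if k == d then u * a k else a k.

(** The weighted number of factors of degree d, that is, the derivative at u = 1 of the tilted
    coefficient. At n = 0 the prefactor hides the truncated predecessor. *)
Let cnt a d n m :=
  n%:R * (a d * (if (d <= m)%N then cpow a n.-1 (m - d) else 0)).

Let cnt_rec a d n m : \sum_(0 <= k < m.+1) a k * cnt a d n (m - k) =
  n%:R * (a d * (if (d <= m)%N then cpow a n (m - d) else 0)).
Proof.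
case: n => [|n]; first by rewrite mul0r big1 // => k _; rewrite /cnt mul0r mulr0.
rewrite /cnt -pred_Sn.
transitivity (n.+1%:R * (a d * \sum_(0 <= k < m.+1)
   a k * (if (d <= m - k)%N then cpow a n (m - k - d) else 0))).
  by rewrite !mulr_sumr; apply: eq_bigr => k _; ring.
congr (_ * (_ * _)).
case: ifP => dm; last first.
  rewrite big_nat_cond big1 // => k /andP[/andP[_ km] _].
  by rewrite ifF ?mulr0 //; apply: contraFF dm => dm; lia.
rewrite cpowS (big_cat_nat (n := (m - d).+1)) //=; last by lia.
rewrite [X in _ + X]big_nat_cond [X in _ + X]big1 ?addr0; last first.
  move=> k /andP[/andP[mk km] _].
  by rewrite ifF ?mulr0 //; apply/negP; lia.
apply: eq_big_nat => k /andP[_ km]; rewrite ifT; last by lia.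
by rewrite -!subnDA (addnC d).
Qed.

(* The tangent-line bound [exp (s j) >= exp w * (1 + s j - w)], summed over the
   number j of factors contributing the monomial of degree d. *)
Lemma cpow_tilt_ge a d (s w : R) n m : (forall k, 0 <= a k) ->
  expR w * ((1 - w) * cpow a n m +
     s * (n%:R * (a d * (if (d <= m)%N then cpow a n.-1 (m - d) else 0))))
  <= cpow (tilt a d (expR s)) n m.
Proof.
move=> a0; rewrite -/(cnt a d n m).
elim: n m w => [|n IH] m w.
  rewrite /cnt !mul0r mulr0 addr0 /=.
  case: (m == 0)%N; rewrite ?mulr0 ?mulr1 //.
  have := expR_ge1Dx (- w); rewrite expRN => h.
  have e0 := expR_gt0 w.
  by rewrite mulrC -ler_pdivlMr // div1r.
rewrite [leRHS]cpowS.
pose T k := expR w * ((1 - w) * (a k * cpow a n (m - k)) + s * (a k * cnt a d n (m - k))).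
pose E k := if k == d then expR w * (s * (a d * cpow a n (m - d))) else 0.
apply: (@le_trans _ _ (\sum_(0 <= k < m.+1) (T k + E k))); last first.
  apply: ler_sum => k _; rewrite /T /E /tilt; case: eqP => [->|_]; last first.
    rewrite addr0.
    have := ler_wpM2l (a0 k) (IH (m - k)%N w); apply: le_trans.
    by apply: eqr_le; ring.
  (* A first factor of degree d already contributes e^s, so the remaining factors are compared with
     the tangent at w - s. *)
  have := IH (m - d)%N (w - s).
  move/(ler_wpM2l (mulr_ge0 (expR_ge0 s) (a0 d))); apply: le_trans.
  rewrite expRB; have e0 : expR s != 0 by rewrite gt_eqF ?expR_gt0.
  by apply: eqr_le; field.
rewrite big_split /= -mulr_sumr big_split /= -!mulr_sumr -cpowS cnt_rec.
have -> : \sum_(0 <= k < m.+1) E k =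
   expR w * (s * (a d * (if (d <= m)%N then cpow a n (m - d) else 0))).
  case: ifP => dm.
    rewrite (bigD1_seq d) ?iota_uniq ?mem_index_iota //= /E eqxx.
    by rewrite big1 ?addr0 // => k /negbTE ->.
  rewrite big_nat_cond big1 ?mulr0 // => k /andP[/andP[_ km] _].
  by rewrite /E ifF //; apply/negP => /eqP kd; move: dm km; rewrite kd; lia.
apply: eqr_le; rewrite /cnt -pred_Sn -[n.+1%:R]natr1; ring.
Qed.

End PowerEstimates.

(** * Exponential lower bound for diagonal coefficients *)

Section LowerBound.
Variables (R : realType).
Implicit Types (a : nat -> R) (n m d k : nat).

(** Jensen's inequality: the tangent is taken at s times the mean number of factors of degree d,
    where the linear factor of the tangent bound equals 1. *)
Lemma cpow_tilt_mean a d (s : R) n m : (forall k, 0 <= a k) -> (d <= m)%N ->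
  0 < cpow a n.+1 m ->
  expR (s * (n.+1%:R * (a d * cpow a n (m - d) / cpow a n.+1 m))) * cpow a n.+1 m
  <= cpow (tilt a d (expR s)) n.+1 m.
Proof.
move=> a0 dm g0; set x := n.+1%:R * _.
have := cpow_tilt_ge d s (s * x) n.+1 m a0; rewrite dm; apply: le_trans.
rewrite ler_pM2l ?expR_gt0 //; apply: eqr_le.
by rewrite /x -pred_Sn; field; rewrite gt_eqF.
Qed.

Lemma cpow0r a n : cpow a n 0 = a 0%N ^+ n.
Proof. by elim: n => [|n IH]; rewrite ?expr0 // cpowS big_nat1 IH exprS. Qed.

Lemma sum_convolution (G : nat -> nat -> R) M :
  \sum_(0 <= n < M) \sum_(0 <= i < n.+1) G i (n - i)%N =
  \sum_(0 <= i < M) \sum_(0 <= j < M - i) G i j.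
Proof.
elim: M => [|M IH]; first by rewrite !big_nil.
rewrite big_nat_recr //= IH [RHS]big_nat_recr //= subSn // subnn big_nat1.
rewrite [X in _ + X = _]big_nat_recr //= subnn addrA -big_split /=.
congr (_ + _); apply: eq_big_nat => i /andP[_ iM].
by rewrite subSn 1?ltnW // big_nat_recr.
Qed.

Lemma sum_mul_le_convolution (A B : nat -> R) N M K :
  (forall i, 0 <= A i) -> (forall i, 0 <= B i) -> (N + M <= K.+1)%N ->
  (\sum_(0 <= i < N) A i) * (\sum_(0 <= j < M) B j) <=
  \sum_(0 <= n < K) \sum_(0 <= i < n.+1) A i * B (n - i)%N.
Proof.
move=> A0 B0 NMK; case: N NMK => [|N] NMK.
  rewrite big_nil mul0r; apply: sumr_ge0 => i _; apply: sumr_ge0 => j _.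
  by rewrite mulr_ge0.
case: M NMK => [|M] NMK.
  rewrite [X in _ * X]big_nil mulr0; apply: sumr_ge0 => i _; apply: sumr_ge0 => j _.
  by rewrite mulr_ge0.
rewrite (sum_convolution (fun i j => A i * B j)).
apply: (@le_trans _ _ (\sum_(0 <= i < N.+1) \sum_(0 <= j < K - i) A i * B j)).
  rewrite mulr_suml big_nat_cond [leRHS]big_nat_cond.
  apply: ler_sum => i /andP[/andP[_ iN] _]; rewrite -mulr_sumr ler_wpM2l //.
  by apply: ler_sum_widen => //; lia.
apply: ler_sum_widen; last by lia.
by move=> i; apply: sumr_ge0 => j _; rewrite mulr_ge0.
Qed.

(** Truncated sums stand in for the generating function of trees, whose convergence is not yet
    known; d trees with fewer than N vertices each have fewer than K together. *)
Lemma forest_gf_pow a (y : R) N d K : (forall k, 0 <= a k) -> 0 <= y ->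
  (d * N < K)%N ->
  (\sum_(0 <= n < N) forest a 1 n * y ^+ n) ^+ d <=
  \sum_(0 <= n < K) forest a d n * y ^+ n.
Proof.
move=> a0 y0; have f0 k n : 0 <= forest a k n * y ^+ n.
  by rewrite mulr_ge0 ?forest_ge0 ?exprn_ge0.
elim: d K => [|d IH] K dK.
  rewrite expr0; apply: le_trans (ler_term_sum (k := 0) (f0 0%N) dK).
  by rewrite /= mulr1.
rewrite exprS.
have S0 : 0 <= \sum_(0 <= n < N) forest a 1 n * y ^+ n by apply: sumr_ge0.
apply: le_trans (ler_wpM2l S0 (IH (d * N).+1 (ltnSn _))) _.
apply: (le_trans (sum_mul_le_convolution (K := K) (f0 1%N) (f0 d) _)).
  by move: dK; rewrite mulSn; lia.
apply: ler_sum => n _; rewrite -[d.+1]add1n forest_add mulr_suml big_nat_cond [leRHS]big_nat_cond.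
apply: ler_sum => i /andP[/andP[_ iN] _]; apply: eqr_le.
have -> : y ^+ n = y ^+ i * y ^+ (n - i) by rewrite -exprD subnKC.
ring.
Qed.

(** The functional equation T = y phi(T) of the generating function of trees, weakened to an
    inequality between truncations: a root of degree d carries d trees. *)
Lemma forest_gf_fixpoint a (y t : R) N D : (forall k, 0 <= a k) -> 0 <= y ->
  (forall M, \sum_(0 <= n < M) forest a 1 n * y ^+ n <= t) ->
  y * \sum_(0 <= d < D) a d * (\sum_(0 <= n < N) forest a 1 n * y ^+ n) ^+ d <= t.
Proof.
move=> a0 y0 Ht; have f0 k n : 0 <= forest a k n * y ^+ n.
  by rewrite mulr_ge0 ?forest_ge0 ?exprn_ge0.
set K := (D * N).+1; apply: le_trans (Ht K.+1).
apply: (@le_trans _ _ (y * \sum_(0 <= d < D) a d * \sum_(0 <= n < K) forest a d n * y ^+ n)).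
  rewrite ler_wpM2l // big_nat_cond [leRHS]big_nat_cond.
  apply: ler_sum => d /andP[/andP[_ dD] _].
  by rewrite ler_wpM2l // forest_gf_pow // ltnS leq_mul2r ltnW ?orbT.
rewrite [leRHS]big_nat_recl // [_ * y ^+ 0]mul0r add0r.
under [X in y * X]eq_bigr => d _ do rewrite mulr_sumr.
rewrite exchange_big /= mulr_sumr; apply: ler_sum => n _.
rewrite -/(forest a 1 n.+1) (@forestS _ a 0 n (maxn n.+1 D)); last by rewrite subn0 leq_maxl.
apply: (@le_trans _ _ (\sum_(0 <= d < D) a d * forest a d n * y ^+ n.+1)).
  rewrite mulr_sumr; apply: eqr_le; apply: eq_bigr => d _; rewrite exprS; ring.
rewrite -mulr_suml ler_wpM2r ?exprn_ge0 // ler_sum_widen ?leq_maxr //.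
by move=> i; rewrite mulr_ge0 ?forest_ge0.
Qed.

Lemma sum_geometric_le (q : R) N : 0 <= q < 1 -> \sum_(0 <= n < N) q ^+ n <= (1 - q)^-1.
Proof.
move=> /andP[q0 q1]; rewrite -[leRHS]div1r ler_pdivlMr ?subr_gt0 //.
have -> : (\sum_(0 <= n < N) q ^+ n) * (1 - q) = 1 - q ^+ N.
  elim: N => [|N IH]; first by rewrite big_nil mul0r expr0 subrr.
  by rewrite big_nat_recr //= mulrDl IH exprS; ring.
by rewrite lerBlDr lerDl exprn_ge0.
Qed.

(** A coefficient on the diagonal is sought because such a block can be repeated without changing
    the difference between exponent and degree. *)
Lemma cpow_diag_lower_bound a (tau V y : R) :
  (forall k, 0 <= a k) -> 0 < a 0%N -> (exists k, (2 <= k)%N /\ 0 < a k) ->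
  0 < tau -> 0 < V ->
  (forall t W : R, 0 < t -> (forall N, \sum_(0 <= k < N) a k * t ^+ k <= W) ->
     t * V <= tau * W) ->
  tau / V < y -> exists N, (0 < N)%N /\ 1 <= cpow a N N * y ^+ N.
Proof.
move=> a0 a00 [k0 [k02 ak0]] tau0 V0 Hopt Hy.
apply: contrapT => Hno.
have Hlt N : (0 < N)%N -> cpow a N N * y ^+ N < 1.
  by move=> N0; rewrite ltNge; apply/negP => h; apply: Hno; exists N.
(* Appending j factors of total degree j + 1, one of degree [k0] and the others of degree 0, moves
   the coefficient of z^n in phi^(n+1), which bounds the weight of trees, onto the diagonal. *)
set j := k0.-1; have k0E : k0 = j.+1 by rewrite /j; lia.
have j0 : (0 < j)%N by rewrite /j; lia.
have C0 : 0 < cpow a j k0.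
  have := @cpow_supermul _ a 1 j.-1 k0 0 a0; rewrite addn0 (_ : 1 + j.-1 = j)%N; last by lia.
  apply: lt_le_trans; rewrite cpow0r mulr_gt0 ?exprn_gt0 //.
  by apply: lt_le_trans (cpow_term 0 a0 (leqnn k0)); rewrite subnn /= mulr1.
set C := cpow a j k0 in C0.
(* Strictly below y, so that the generating function of trees is dominated by a geometric series of
   ratio [q], yet still beyond tau / V. *)
pose y' := (tau / V + y) / 2.
have tV0 : 0 < tau / V by rewrite divr_gt0.
have y0 : 0 < y by exact: lt_trans Hy.
have y'0 : 0 < y' by rewrite /y'; lra.
have y'y : y' < y by rewrite /y'; lra.
have y't : tau / V < y' by rewrite /y'; lra.
pose q := y' / y.
have q01 : 0 <= q < 1.
  by rewrite /q divr_ge0 ?ltW // ltr_pdivrMr // mul1r.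
pose B := (C * y ^+ j)^-1.
have B0 : 0 < B by rewrite invr_gt0 mulr_gt0 ?exprn_gt0.
have Fle n : forest a 1 n * y' ^+ n <= B * q ^+ n.
  case: n => [|n]; first by rewrite /= mul0r mulr_ge0 ?(ltW B0) //; case/andP: q01 => q0 _; rewrite exprn_ge0.
  have Fg : forest a 1 n.+1 <= cpow a n.+1 n.
    have := @forest_cpow _ a 1 n.+1 erefl erefl; rewrite mul1r subSS subn0 => <-.
    by rewrite ler_peMl ?forest_ge0 // ler1n.
  have h1 := @cpow_supermul _ a n.+1 j n k0 a0.
  have h2 := Hlt (n.+1 + j)%N isT.
  have h3 : cpow a n.+1 n * C * (y ^+ n.+1 * y ^+ j) < 1.
    apply: le_lt_trans h2; rewrite -exprD ler_wpM2r ?exprn_ge0 ?(ltW y0) //.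
    by apply: le_trans h1 _; have -> : (n + k0 = n.+1 + j)%N by rewrite k0E addSnnS.
  have -> : B * q ^+ n.+1 = (B / y ^+ n.+1) * y' ^+ n.+1.
    by rewrite /q expr_div_n mulrCA mulrC.
  rewrite ler_wpM2r ?exprn_ge0 ?(ltW y'0) //.
  apply: (le_trans Fg).
  rewrite /B -invfM -div1r ler_pdivlMr ?mulr_gt0 ?exprn_gt0 //.
  by apply/ltW; apply: le_lt_trans h3; apply: eqr_le; ring.
pose s N := \sum_(0 <= n < N) forest a 1 n * y' ^+ n.
have sB N : s N <= B * (1 - q)^-1.
  apply: (@le_trans _ _ (\sum_(0 <= n < N) B * q ^+ n)); first exact: ler_sum.
  by rewrite -mulr_sumr ler_wpM2l ?(ltW B0) // sum_geometric_le.
have hs : has_sup (range s).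
  split; first by exists (s 0%N), 0%N.
  by exists (B * (1 - q)^-1) => _ [N _ <-].
set t := sup (range s).
have st N : s N <= t by apply: ub_le_sup; [case: hs | exists N].
have s20 : 0 < s 2.
  rewrite /s big_nat_recl //= big_nat1 /= big_nat1 mul0r add0r mulr1.
  by rewrite mulr_gt0.
have fix_ N D := @forest_gf_fixpoint a y' t N D a0 (ltW y'0) st.
have t0 : 0 < t by apply: lt_le_trans (st 2%N).
(* The functional equation bounds phi at the point [s N] by t / y', and the optimality of tau
   applies there since [s N] is positive from N = 2 on. The supremum over N gives t <= t (tau / V) /
   y', which is impossible. *)
have h1 N : (2 <= N)%N -> s N * V <= tau * (t / y').
  move=> N2; apply: Hopt.
    by apply: lt_le_trans s20 _; apply: ler_sum_widen => // i; rewrite mulr_ge0 ?forest_ge0 ?exprn_ge0 ?ltW.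
  by move=> D; rewrite ler_pdivlMr // mulrC fix_.
have : t <= tau * (t / y') / V.
  apply: ge_sup; first by exists (s 0%N), 0%N.
  move=> _ [N _ <-]; rewrite ler_pdivlMr //.
  apply: le_trans (h1 (maxn N 2) (leq_maxr _ _)).
  rewrite ler_wpM2r ?(ltW V0) //.
  by apply: ler_sum_widen => [i|]; rewrite ?leq_maxl // mulr_ge0 ?forest_ge0 ?exprn_ge0 ?ltW.
have -> : tau * (t / y') / V = t * ((tau / V) / y') by field; rewrite !gt_eqF.
rewrite ler_pMr // ler_pdivlMr // mul1r => h.
by have := lt_le_trans y't h; rewrite ltxx.
Qed.

End LowerBound.

(** * Coefficientwise domination and trading of monomials *)

Section PolynomialDomination.
Variable (R : realFieldType).
Implicit Types (p q r : {poly R}) (a : nat -> R).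

Definition coef_le p q := forall i, p`_i <= q`_i.

Lemma coef_le_mul2r r p q : coef_le 0 r -> coef_le p q -> coef_le (p * r) (q * r).
Proof.
move=> r0 pq i; rewrite !coefM; apply: ler_sum => j _.
by rewrite ler_wpM2r //; have := r0 (i - j)%N; rewrite coef0.
Qed.

Lemma coef_le_mul2l r p q : coef_le 0 r -> coef_le p q -> coef_le (r * p) (r * q).
Proof. by rewrite !(mulrC r); exact: coef_le_mul2r. Qed.

Lemma coef_le_trans q p r : coef_le p q -> coef_le q r -> coef_le p r.
Proof. by move=> pq qr i; exact: le_trans (pq i) (qr i). Qed.

Lemma coef_ge0_mul p q : coef_le 0 p -> coef_le 0 q -> coef_le 0 (p * q).
Proof.
by move=> p0 q0; have := coef_le_mul2r q0 p0; rewrite mul0r.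
Qed.

Lemma coef_ge0_exp p n : coef_le 0 p -> coef_le 0 (p ^+ n).
Proof.
move=> p0; elim: n => [|n IH].
  by move=> i; rewrite expr0 coef0 coef1 ler0n.
by rewrite exprS; exact: coef_ge0_mul.
Qed.

Lemma coef_le_exp p q n : coef_le 0 p -> coef_le p q -> coef_le (p ^+ n) (q ^+ n).
Proof.
move=> p0 pq; elim: n => [|n IH]; first by rewrite !expr0.
rewrite !exprS; apply: coef_le_trans (coef_le_mul2r (coef_ge0_exp n p0) pq) _.
by apply: coef_le_mul2l => //; exact: coef_le_trans pq.
Qed.

Lemma cpow_poly a n m M : (m < M)%N ->
  cpow a n m = ((\poly_(i < M) a i) ^+ n)`_m.
Proof.
elim: n m => [|n IH] m mM; first by rewrite expr0 coef1.
rewrite cpowS exprS coefM big_mkord; apply: eq_bigr => -[i im] _ /=.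
by rewrite coef_poly IH ?ifT //; lia.
Qed.

(* If [K] copies of the monomial [Q] can be traded for [K] factors [P] at the
   price of a factor [eta] each, then so can almost all copies of [Q] produced by
   expanding [(P + v Q) ^ n]. *)
Lemma tilt_domination P Q (v eta : R) K n :
  coef_le 0 Q -> coef_le Q P -> 0 <= v -> 0 < eta <= 1 -> (0 < K)%N ->
  coef_le (Q ^+ K) (eta ^+ K *: P ^+ K) ->
  coef_le ((P + v *: Q) ^+ n) (((eta ^+ K)^-1 * (1 + v * eta) ^+ n) *: P ^+ n).
Proof.
move=> Q0 QP v0 /andP[e0 e1] K0 QK.
have P0 : coef_le 0 P by exact: coef_le_trans QP.
have base j i : coef_le (Q ^+ j * P ^+ i) ((eta ^+ j / eta ^+ K) *: P ^+ (j + i)).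
  elim/ltn_ind: j => j IH; have [jK|Kj] := ltnP j K.
    apply: (@coef_le_trans (P ^+ (j + i))).
      by rewrite exprD; apply/coef_le_mul2r/coef_le_exp => //; exact: coef_ge0_exp.
    move=> l; rewrite coefZ ler_peMl //.
      by have := coef_ge0_exp (j + i) P0 l; rewrite coef0.
    by rewrite ler_pdivlMr ?exprn_gt0 // mul1r ler_wiXn2l ?(ltW e0) ?(ltnW jK).
  have {}IH := IH (j - K)%N; rewrite -(subnKC Kj); set l := (j - K)%N in IH *.
  rewrite exprD -mulrA; apply: coef_le_trans.
    by apply: coef_le_mul2l (IH _); [exact: coef_ge0_exp | rewrite /l; lia].
  rewrite -scalerAr -addnA.
  have -> : (eta ^+ (K + l) / eta ^+ K) *: P ^+ (K + (l + i)) =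
      (eta ^+ l / eta ^+ K) *: (eta ^+ K *: (P ^+ K * P ^+ (l + i))).
    by rewrite scalerA -exprD exprD; congr (_ *: _); ring.
  move=> k; rewrite coefZ [leRHS]coefZ ler_wpM2l ?divr_ge0 ?exprn_ge0 ?(ltW e0) //.
  by rewrite scalerAl; apply: coef_le_mul2r => //; exact: coef_ge0_exp.
(* Carrying along the j factors Q and i factors P already chosen lets the induction expand one
   factor of the power at a time and trade only at the end. *)
suff H j i : coef_le ((P + v *: Q) ^+ n * (Q ^+ j * P ^+ i))
    (((1 + v * eta) ^+ n * (eta ^+ j / eta ^+ K)) *: P ^+ (n + (j + i))).
  have := H 0%N 0%N; rewrite !expr0 !mulr1 !addn0 mul1r => h.
  by rewrite mulrC.
elim: n j i => [|n IH] j i; first by rewrite !expr0 !mul1r add0n; exact: base.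
have -> : (P + v *: Q) ^+ n.+1 * (Q ^+ j * P ^+ i) =
  (P + v *: Q) ^+ n * (Q ^+ j * P ^+ i.+1) +
  v *: ((P + v *: Q) ^+ n * (Q ^+ j.+1 * P ^+ i)).
  by rewrite !exprS -!mul_polyC; ring.
move=> l; rewrite coefD coefZ.
have h1 := IH j i.+1 l; have h2 := ler_wpM2l v0 (IH j.+1 i l).
apply: le_trans (lerD h1 h2) _; rewrite !coefZ addnS addSn !addnS.
by apply: eqr_le; rewrite !exprS; ring.
Qed.

End PolynomialDomination.

(** * Ratio limits of convolution powers *)

Section RatioLimit.
Variables (R : realType) (a : nat -> R) (tau V : R).
Hypotheses (a_ge0 : forall k, 0 <= a k) (a0_gt0 : 0 < a 0%N).
Hypothesis a2_gt0 : exists k, (2 <= k)%N /\ 0 < a k.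
Hypotheses (tau_ge0 : 0 <= tau) (V_gt0 : 0 < V).
Hypothesis V_bound : forall N, \sum_(0 <= k < N) a k * tau ^+ k <= V.
(** With V = phi(tau), this says that tau minimises phi(t) / t. Any upper bound W of the partial
    sums stands for phi(t), so points of divergence impose nothing. *)
Hypothesis V_opt : forall t W : R, 0 < t ->
  (forall N, \sum_(0 <= k < N) a k * t ^+ k <= W) -> t * V <= tau * W.

Hypothesis V_tau0 : tau = 0 -> V = a 0%N.

Let p k : R := tau ^+ k * a k / V.

(** What is left of the coefficient of z^(n-1) in phi^n after b factors of total degree A have been
    fixed; without shifts it is n times the weight of the trees with n vertices. *)
Definition cpow_shift A b n := cpow a (n - b) (n.-1 - A).
Let h := cpow_shift.
Let Fl A b : set_system nat := within [set n | 0 < h A b n] \oo.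

(** If the coefficient is eventually 0 this filter is improper and convergence along it is vacuous,
    hence only [Filter] is claimed. *)
Instance pos_cpow_filter A b : Filter (Fl A b).
Proof. exact: within_filter. Qed.

(** The probability that a given factor has degree d, under the law on tuples of degrees that
    [h A b n] normalises. *)
Let x A b d n := a d * h (A + d) b.+1 n / h A b n.

Lemma expR_le_quad (s : R) : `|s| <= 1 / 2 -> expR s <= 1 + s + 2 * s ^+ 2.
Proof.
move=> hs; have [s1 s2] : - (1 / 2) <= s /\ s <= 1 / 2 by apply/andP; rewrite -ler_norml.
have := expR_ge1Dx (- s); rewrite expRN => h1.
have e0 := expR_gt0 s.
have h2 : expR s * (1 - s) <= 1 by rewrite mulrC -ler_pdivlMr // div1r.
have h3 : 1 <= (1 + s + 2 * s ^+ 2) * (1 - s) by nra.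
by rewrite -(@ler_pM2r _ (1 - s)) ?(le_trans h2) //; lra.
Qed.

Lemma cpow_diag_exp N q : cpow a N N ^+ q <= cpow a (q * N) (q * N).
Proof.
elim: q => [|q IH]; first by rewrite expr0 mul0n.
rewrite exprS mulSn; apply: le_trans (cpow_supermul _ _ _ _ a_ge0).
by rewrite ler_wpM2l // cpow_ge0.
Qed.

(** From the first n with a positive coefficient in its residue class modulo N, all later n of that
    class are reached by appending diagonal blocks of length N. Classes without such an n are
    excluded by the positivity hypothesis. *)
Lemma cpow_shift_lower_bound A b (y : R) : 0 < tau -> tau / V < y ->
  exists c : R, 0 < c /\ forall n, (A + b < n)%N -> 0 < h A b n -> c <= h A b n * y ^+ n.
Proof.
move=> tau0 Hy.
have y0 : 0 < y by apply: lt_trans Hy; rewrite divr_gt0.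
have [N [N0 HN]] := cpow_diag_lower_bound a_ge0 a0_gt0 a2_gt0 tau0 V_gt0 V_opt Hy.
have Hr r : exists c : R, 0 < c /\
    forall n, (A + b < n)%N -> n = r %[mod N] -> 0 < h A b n -> c <= h A b n * y ^+ n.
  pose Q n := [&& (A + b < n)%N, n == r %[mod N] & 0 < h A b n].
  have [exQ|noQ] := pselect (exists n, Q n); last first.
    by exists 1; split => // n An nr hn; exfalso; apply: noQ; exists n; rewrite /Q An hn nr eqxx.
  case: (ex_minnP exQ) => n0 /and3P[An0 /eqP n0r hn0] n0min.
  exists (h A b n0 * y ^+ n0); split; first by rewrite mulr_gt0 ?exprn_gt0.
  move=> n An nr hn.
  have n0n : (n0 <= n)%N by apply: n0min; rewrite /Q An hn nr eqxx.
  have /dvdnP[q nE] : (N %| n - n0)%N by rewrite -eqn_mod_dvd // nr n0r.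
  have {nE} nE : n = (q * N + n0)%N by rewrite -nE subnK.
  have h1 : cpow a N N ^+ q * h A b n0 <= h A b n.
    apply: (@le_trans _ _ (cpow a (q * N) (q * N) * h A b n0)).
      by rewrite ler_wpM2r ?cpow_diag_exp // ltW.
    have := cpow_supermul (q * N) (n0 - b) (q * N) (n0.-1 - A) a_ge0.
    have e1 : (q * N + (n0 - b) = q * N + n0 - b)%N by clear -An0; lia.
    have e2 : (q * N + (n0.-1 - A) = (q * N + n0).-1 - A)%N by clear -An0; lia.
    by rewrite /h /cpow_shift nE e1 e2.
  apply: (@le_trans _ _ (cpow a N N ^+ q * h A b n0 * y ^+ n)); last first.
    by rewrite ler_wpM2r ?exprn_ge0 // ltW.
  rewrite nE exprD mulnC exprM.
  rewrite (_ : _ * (_ * _) = (cpow a N N * y ^+ N) ^+ q * (h A b n0 * y ^+ n0)); last first.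
    by rewrite exprMn; ring.
  by rewrite ler_peMl ?exprn_ege1 // mulr_ge0 ?exprn_ge0 ?(ltW y0) // ltW.
(* The constants of the N residue classes are combined by taking minima, one class at a time. *)
have HM M : exists c : R, 0 < c /\ forall n, (A + b < n)%N -> (n %% N < M)%N ->
    0 < h A b n -> c <= h A b n * y ^+ n.
  elim: M => [|M [c [c0 Hc]]]; first by exists 1.
  have [c' [c'0 Hc']] := Hr M; exists (Num.min c c'); split; first by rewrite lt_min c0.
  move=> n An; rewrite ltnS leq_eqVlt => /orP[/eqP nM|nM] hn; rewrite ge_min.
    by rewrite (Hc' n) ?orbT // -nM modn_mod.
  by rewrite (Hc n).
have [c [c0 Hc]] := HM N; exists c; split => // n An hn.
by apply: Hc => //; rewrite ltn_mod.
Qed.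

Lemma step_prob_ge0 k : 0 <= p k.
Proof. by rewrite divr_ge0 ?mulr_ge0 ?exprn_ge0 // ltW. Qed.

Lemma term_le_V k : tau ^+ k * a k <= V.
Proof.
rewrite mulrC; apply: le_trans (V_bound k.+1).
apply: (@ler_term_sum _ (fun k => a k * tau ^+ k)) => // i.
by rewrite mulr_ge0 ?exprn_ge0.
Qed.

Lemma step_prob_le1 k : p k <= 1.
Proof. by rewrite ler_pdivrMr // mul1r term_le_V. Qed.

Lemma sum_tilt_le d (u : R) N : 0 <= u ->
  \sum_(0 <= k < N) tilt a d u k * tau ^+ k <= V * (1 + (u - 1) * p d).
Proof.
move=> u0.
have t0 k : 0 <= tilt a d u k * tau ^+ k.
  by rewrite mulr_ge0 ?exprn_ge0 // /tilt; case: ifP => _ //; rewrite mulr_ge0.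
(* The term of degree d has to lie in the range of summation, since for u < 1 its correction is
   negative. *)
apply: (le_trans (ler_sum_widen t0 (leq_maxl N d.+1))).
set M := maxn N d.+1.
have dM : (d < M)%N by rewrite /M leq_maxr.
have -> : \sum_(0 <= k < M) tilt a d u k * tau ^+ k =
    \sum_(0 <= k < M) a k * tau ^+ k + (u - 1) * (tau ^+ d * a d).
  rewrite (bigD1_seq d) ?iota_uniq ?mem_index_iota //=.
  rewrite [in RHS](bigD1_seq d) ?iota_uniq ?mem_index_iota //=.
  rewrite /tilt eqxx (eq_bigr (fun k => a k * tau ^+ k)); first by ring.
  by move=> k /negbTE ->.
have -> : V * (1 + (u - 1) * p d) = V + (u - 1) * (tau ^+ d * a d).
  by rewrite /p; field; rewrite gt_eqF.
by rewrite lerD2r.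
Qed.

Lemma near_pos_cpow A b (Q : nat -> Prop) N :
  (forall n, (N <= n)%N -> 0 < h A b n -> Q n) -> \forall n \near Fl A b, Q n.
Proof. by move=> HQ; exists N => // n /= Nn hn; exact: HQ. Qed.

(** The lower bound by Jensen and the upper bound by Cauchy concern the same tilted coefficient.
    Dividing by the untilted one costs a subexponential factor, and taking logarithms per factor
    leaves this inequality. *)
Lemma step_tilt_bound A b d (s delta : R) : 0 < tau -> 0 < delta ->
  \forall n \near Fl A b, s * x A b d n <= delta + (expR s - 1) * p d.
Proof.
move=> tau0 delta0.
(* Since n <= 2 (n - b) for large n, the loss e^(del n) takes half of delta per factor; the constant
   C, which collects the shifts A and b, takes the other half. *)
pose del := delta / 4; pose y := tau / V * expR del.
have tV0 : 0 < tau / V by rewrite divr_gt0.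
have Hy : tau / V < y by rewrite /y ltr_pMr // expR_gt1 /del; lra.
have [c [c0 Hc]] := cpow_shift_lower_bound A b tau0 Hy.
pose C := tau ^+ A.+1 / V ^+ b / c.
have C0 : 0 < C by rewrite !divr_gt0 ?exprn_gt0.
pose K := Num.bound (2 * `|ln C| / delta).
apply: (@near_pos_cpow _ _ _ (A + b + d + b + K).+2) => n nN hn.
pose nb := (n - b)%N; pose m := (n.-1 - A)%N.
have An : (A + b < n)%N by clear -nN; lia.
have nbE : n = (nb + b)%N by clear -nN; rewrite /nb; lia.
have mE : n = (m + A.+1)%N by clear -nN; rewrite /m; lia.
have dm : (d <= m)%N by clear -nN; rewrite /m; lia.
have nb2 : (n <= 2 * nb)%N by clear -nN; rewrite /nb; lia.
have Kn : (K <= nb)%N by clear -nN; rewrite /nb; lia.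
have nbS : nb = nb.-1.+1 by clear -nN; rewrite /nb; lia.
have nb0 : 0 < nb%:R :> R by rewrite ltr0n nbS.
set z := (expR s - 1) * p d.
have hE : h A b n = cpow a nb.-1.+1 m by rewrite -nbS.
have J : expR (s * (nb%:R * x A b d n)) * h A b n <= cpow (tilt a d (expR s)) nb m.
  have := @cpow_tilt_mean _ a d s nb.-1 m a_ge0 dm; rewrite -hE -nbS => /(_ hn).
  by rewrite /x {1 3}/h /cpow_shift subnS subnDA -/nb -/m.
have U : tau ^+ m * cpow (tilt a d (expR s)) nb m <= V ^+ nb * expR (nb%:R * z).
  have t0 k : 0 <= tilt a d (expR s) k.
    by rewrite /tilt; case: ifP => // _; rewrite mulr_ge0 ?expR_ge0.
  have := cpow_le nb m t0 tau_ge0 (fun N => sum_tilt_le d N (expR_ge0 s)).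
  move/le_trans; apply; rewrite mulrC exprMn mulrC ler_wpM2l ?exprn_ge0 ?(ltW V_gt0) //.
  rewrite expRM_natl lerXn2r ?nnegrE ?expR_ge0 ?expR_ge1Dx //.
  have := step_prob_le1 d; have := step_prob_ge0 d; have := expR_gt0 s => e0 p0 p1.
  nra.
have L := Hc n An hn.
have key : expR (s * (nb%:R * x A b d n)) <= C * expR (del * n%:R + nb%:R * z).
  rewrite /C mulrAC ler_pdivlMr // mulrAC ler_pdivlMr ?exprn_gt0 //.
  rewrite -(ler_pM2r (exprn_gt0 m tau0)) -(ler_pM2r (exprn_gt0 nb V_gt0)).
  set e := expR (s * _) in J *.
  have e0 : 0 <= e by rewrite expR_ge0.
  apply: (@le_trans _ _ (e * (h A b n * y ^+ n) * V ^+ b * tau ^+ m * V ^+ nb)).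
    rewrite !ler_wpM2r ?exprn_ge0 ?(ltW V_gt0) //.
    by rewrite ler_wpM2l.
  have -> : e * (h A b n * y ^+ n) * V ^+ b * tau ^+ m * V ^+ nb =
      (tau ^+ m * (e * h A b n)) * (y ^+ n * V ^+ n).
    by rewrite [in V ^+ n]nbE exprD; ring.
  have -> : y ^+ n * V ^+ n = tau ^+ n * expR (del * n%:R).
    have yV : y * V = tau * expR del by rewrite /y; field; rewrite gt_eqF.
    by rewrite -exprMn yV exprMn expRM_natr.
  have -> : tau ^+ A.+1 * expR (del * n%:R + nb%:R * z) * tau ^+ m * V ^+ nb =
     (V ^+ nb * expR (nb%:R * z)) * (tau ^+ n * expR (del * n%:R)).
    by rewrite expRD mE exprD; ring.
  rewrite ler_wpM2r ?mulr_ge0 ?exprn_ge0 ?expR_ge0 //.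
  apply: le_trans U; rewrite ler_wpM2l ?exprn_ge0 //.
move: key; rewrite -[C]lnK ?posrE // -expRD ler_expR => key.
rewrite -(ler_pM2l nb0).
have lnC : ln C <= delta / 2 * nb%:R.
  apply: le_trans (ler_norm _) _.
  have := @archi_boundP R (2 * `|ln C| / delta) _.
  rewrite -/K divr_ge0 ?mulr_ge0 ?(ltW delta0) // => /(_ isT).
  rewrite ltr_pdivrMr // => hK.
  have : K%:R <= nb%:R :> R by rewrite ler_nat.
  by move=> /(ler_wpM2r (ltW delta0)); lra.
have n2 : del * n%:R <= delta / 2 * nb%:R.
  have : n%:R <= 2 * nb%:R :> R by rewrite -natrM ler_nat.
  by rewrite /del; move=> /(ler_wpM2l (ltW delta0)); lra.
by lra.
Qed.

Lemma step_cvg_pos A b d : 0 < tau -> x A b d n @[n --> Fl A b] --> p d.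
Proof.
move=> tau0; apply/cvgrPdist_le => e e0.
(* After division by s, the bounds for s and - s leave an error of at most s + 2 s p_d, hence 3 s; s
   <= 1 / 2 permits the quadratic bound on the exponential. *)
pose s := Num.min (1 / 2) (e / 3).
have s0 : 0 < s by rewrite lt_min; apply/andP; split; lra.
have [s1 s2] : s <= 1 / 2 /\ s <= e / 3 by rewrite /s; split; rewrite ge_min lexx ?orbT.
have ss0 : 0 < s ^+ 2 by rewrite exprn_gt0.
have p0 := step_prob_ge0 d; have p1 := step_prob_le1 d.
have q1 : expR s <= 1 + s + 2 * s ^+ 2 by apply: expR_le_quad; rewrite ger0_norm ?(ltW s0).
have q2 : expR (- s) <= 1 - s + 2 * s ^+ 2.
  by have := @expR_le_quad (- s); rewrite sqrrN normrN; apply; rewrite ger0_norm ?(ltW s0).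
have H1 := step_tilt_bound A b d s tau0 ss0.
have H2 := step_tilt_bound A b d (- s) tau0 ss0.
near=> n.
have h1 : s * x A b d n <= s ^+ 2 + (expR s - 1) * p d by near: n.
have h2 : - s * x A b d n <= s ^+ 2 + (expR (- s) - 1) * p d by near: n.
set X := x A b d n in h1 h2 *; set P := p d in p0 p1 h1 h2 *.
have k1 : (expR s - 1) * P <= (s + 2 * s ^+ 2) * P by rewrite ler_wpM2r //; lra.
have k2 : (expR (- s) - 1) * P <= (- s + 2 * s ^+ 2) * P by rewrite ler_wpM2r //; lra.
have k3 : 2 * s ^+ 2 * P <= 2 * s ^+ 2 by rewrite ler_piMr //; lra.
have l1 : s * (X - P) <= s * e by nra.
have l2 : s * (P - X) <= s * e by nra.
rewrite ler_pM2l // in l1; rewrite ler_pM2l // in l2.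
by rewrite ler_norml; apply/andP; split; lra.
Unshelve. all: by end_near. Qed.

(** K factors of degree d have the same total degree as K - d constants and d factors of degree K. A
    suitable K exists because coefficients of at most exponential growth would give phi a positive
    radius, and optimality at a positive point is impossible when tau = 0. *)
Lemma coef_trade d (eta : R) : tau = 0 -> 0 < eta -> (0 < d)%N ->
  exists K, [/\ (0 < K)%N, (d <= K)%N &
    a d ^+ K <= eta ^+ K * (a 0%N ^+ (K - d) * a K ^+ d)].
Proof.
move=> tau0 eta0 d0; pose B := a d / (eta * a 0%N).
have B0 : 0 <= B by rewrite divr_ge0 // mulr_ge0 // ltW.
(* As T >= 1 and d > 0, T^d >= T >= B. Hence a_K >= a_0 T^K makes the right-hand side at least (eta
   a_0 B)^K, which is a_d^K. *)
pose T := 1 + B; have T1 : 1 <= T by rewrite /T lerDl.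
have T0 : 0 < T by apply: lt_le_trans T1.
have [K [dK HK]] : exists K, (d < K)%N /\ a 0%N <= a K * T^-1 ^+ K.
  apply: contrapT => Hno.
  have t0 k : 0 <= a k * T^-1 ^+ k by rewrite mulr_ge0 ?exprn_ge0 // invr_ge0 ltW.
  pose M := \sum_(0 <= k < d.+1) a k * T^-1 ^+ k + a 0%N.
  have aM k : a k * T^-1 ^+ k <= M.
    rewrite /M; have [kd|dk] := leqP k d.
      apply: ler_wpDr; first exact: ltW.
      exact: (@ler_term_sum _ (fun k => a k * T^-1 ^+ k)).
    apply: ler_wpDl; first exact: sumr_ge0.
    by rewrite leNgt; apply/negP => h'; apply: Hno; exists k; rewrite dk ltW.
  have : T^-1 / 2 * V <= tau * (M * (1 - 1 / 2)^-1).
    apply: V_opt; first by rewrite divr_gt0 ?invr_gt0.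
    move=> N; apply: (@le_trans _ _ (\sum_(0 <= k < N) M * (1 / 2) ^+ k)).
      apply: ler_sum => k _.
      have -> : a k * (T^-1 / 2) ^+ k = a k * T^-1 ^+ k * (1 / 2) ^+ k.
        by rewrite -mulrA -exprMn div1r.
      by rewrite ler_wpM2r ?exprn_ge0 //; lra.
    rewrite -mulr_sumr ler_wpM2l ?sum_geometric_le //; last lra.
    by apply: le_trans (aM 0%N).
  by rewrite tau0 mul0r leNgt mulr_gt0 // divr_gt0 ?invr_gt0.
exists K; split; [by clear -dK; lia | exact: ltnW |].
have aK : a 0%N * T ^+ K <= a K.
  by move: HK; rewrite exprVn -ler_pdivrMr ?invr_gt0 ?exprn_gt0 // invrK.
have adE : a d = eta * (a 0%N * B).
  by rewrite /B; field; rewrite !gt_eqF.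
clearbody B; rewrite adE !exprMn ler_wpM2l ?exprn_ge0 ?(ltW eta0) //.
apply: (@le_trans _ _ (a 0%N ^+ (K - d) * (a 0%N * T ^+ K) ^+ d)); last first.
  rewrite ler_wpM2l ?exprn_ge0 // lerXn2r ?nnegrE // mulr_ge0 ?exprn_ge0 //; exact: ltW.
rewrite exprMn mulrA -exprD subnK; last by lia.
rewrite ler_wpM2l ?exprn_ge0 // -exprM mulnC exprM lerXn2r ?nnegrE ?exprn_ge0 ?(ltW T0) //.
apply: (@le_trans _ _ T); first by rewrite /T lerDr.
by rewrite -{1}[T]expr1 ler_weXn2l.
Qed.

Lemma cpow_tilt_dominated d (eta u : R) K n m : 0 < eta <= 1 -> 1 <= u ->
  (0 < K)%N -> (d <= K)%N ->
  a d ^+ K <= eta ^+ K * (a 0%N ^+ (K - d) * a K ^+ d) ->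
  cpow (tilt a d u) n m <= (eta ^+ K)^-1 * (1 + (u - 1) * eta) ^+ n * cpow a n m.
Proof.
move=> eta01 u1 K0 dK Htrade.
(* The truncation keeps both the coefficient that is extracted and the monomial of degree K used in
   the trade. *)
set M := (m + K).+1.
have mM : (m < M)%N by rewrite /M; lia.
have KM : (K < M)%N by rewrite /M; lia.
rewrite !(cpow_poly _ _ mM).
set P := \poly_(i < M) a i; pose Q := a d *: 'X^d : {poly R}.
have -> : \poly_(i < M) tilt a d u i = P + (u - 1) *: Q.
  apply/polyP => i; rewrite coefD !coefZ coefXn !coef_poly /tilt.
  case: eqP => [->|_]; last by rewrite mulr0 mulr0 addr0.
  have -> : (d < M)%N by lia.
  by rewrite mulr1; ring.
rewrite -coefZ; apply: tilt_domination => //.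
- by move=> i; rewrite coef0 coefZ coefXn mulr_ge0.
- move=> i; rewrite coefZ coefXn coef_poly; case: eqP => [->|_].
    by rewrite ifT ?mulr1 //; lia.
  by rewrite mulr0; case: ifP.
- by rewrite subr_ge0.
have P0 : coef_le 0 P by move=> i; rewrite coef0 coef_poly; case: ifP.
have c0 : coef_le 0 (a 0%N)%:P by move=> i; rewrite coef0 coefC; case: ifP.
have cP : coef_le (a 0%N)%:P P.
  by move=> i; rewrite coefC coef_poly; case: eqP => [->//|_]; case: ifP.
have k0 : coef_le 0 (a K *: 'X^K) by move=> i; rewrite coef0 coefZ coefXn mulr_ge0.
have kP : coef_le (a K *: 'X^K) P.
  move=> i; rewrite coefZ coefXn coef_poly; case: eqP => [->|_].
    by rewrite KM mulr1.
  by rewrite mulr0; case: ifP.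
have PK : coef_le ((a 0%N)%:P ^+ (K - d) * (a K *: 'X^K) ^+ d) (P ^+ K).
  have -> : P ^+ K = P ^+ (K - d) * P ^+ d by rewrite -exprD subnK.
  apply: (@coef_le_trans _ (P ^+ (K - d) * (a K *: 'X^K) ^+ d)).
    by apply: coef_le_mul2r; [exact: coef_ge0_exp | exact: coef_le_exp].
  by apply: coef_le_mul2l; [exact: coef_ge0_exp | exact: coef_le_exp].
move=> i; rewrite coefZ; have := PK i.
move/(ler_wpM2l (exprn_ge0 K (ltW (proj1 (andP eta01))))); apply: le_trans.
rewrite /Q !exprZn -!exprM -rmorphXn /= mul_polyC (mulnC d) !coefZ !coefXn.
by case: (i == _); rewrite ?mulr0 ?mulr1.
Qed.

Lemma step_le_tau0 A b d (eta : R) : tau = 0 -> (0 < d)%N -> 0 < eta <= 1 ->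
  \forall n \near Fl A b, x A b d n <= 4 * eta.
Proof.
move=> tau0 d0 eta01; have [eta0 eta1] := andP eta01.
have [K [K0 dK Htrade]] := coef_trade tau0 eta0 d0.
pose C := (eta ^+ K)^-1.
have C0 : 0 < C by rewrite invr_gt0 exprn_gt0.
pose N := Num.bound (`|ln C| / eta).
apply: (@near_pos_cpow _ _ _ (A + b + d + b + N).+2) => n nN hn.
pose nb := (n - b)%N; pose m := (n.-1 - A)%N.
have dm : (d <= m)%N by clear -nN; rewrite /m; lia.
have Nn : (N <= nb)%N by clear -nN; rewrite /nb; lia.
have nbS : nb = nb.-1.+1 by clear -nN; rewrite /nb; lia.
have nb0 : 0 < nb%:R :> R by rewrite ltr0n nbS.
have hE : h A b n = cpow a nb.-1.+1 m by rewrite -nbS.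
(* The limit is 0, so one fixed tilt is enough: with e^s <= 2 the bounds give s x <= 2 eta. *)
set s : R := 1 / 2.
have J : expR (s * (nb%:R * x A b d n)) * h A b n <= cpow (tilt a d (expR s)) nb m.
  have := @cpow_tilt_mean _ a d s nb.-1 m a_ge0 dm; rewrite -hE -nbS => /(_ hn).
  by rewrite /x {1 3}/h /cpow_shift subnS subnDA -/nb -/m.
have es1 : 1 <= expR s by rewrite -expR0 ler_expR /s; lra.
have es2 : expR s <= 2.
  apply: le_trans (@expR_le_quad s _) _; first by rewrite ger0_norm /s; lra.
  by rewrite /s; lra.
have D := cpow_tilt_dominated nb m eta01 es1 K0 dK Htrade.
have := le_trans J D; rewrite -/(h A b n) ler_pM2r // -/C => key.
have : expR (s * (nb%:R * x A b d n)) <= C * expR (nb%:R * eta).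
  apply: le_trans key _; rewrite ler_pM2l // expRM_natl.
  rewrite lerXn2r ?nnegrE ?expR_ge0 //; first by rewrite addr_ge0 // mulr_ge0 ?subr_ge0 // ltW.
  by apply: le_trans (expR_ge1Dx _); rewrite lerD2l ler_piMl ?(ltW eta0) //; lra.
rewrite -[C]lnK ?posrE // -expRD ler_expR => {}key.
have lnC : ln C <= eta * nb%:R.
  apply: le_trans (ler_norm _) _.
  have := @archi_boundP R (`|ln C| / eta) _.
  rewrite -/N divr_ge0 ?(ltW eta0) // => /(_ isT).
  rewrite ltr_pdivrMr // => hK.
  have : N%:R <= nb%:R :> R by rewrite ler_nat.
  by move=> /(ler_wpM2r (ltW eta0)); lra.
rewrite -(ler_pM2l nb0); move: key; rewrite /s; lra.
Qed.

End RatioLimit.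

Section RatioLimitAlongTrees.
Variables (R : realType) (a : nat -> R) (tau V : R).
Hypotheses (a_ge0 : forall k, 0 <= a k) (a0_gt0 : 0 < a 0%N).
Hypothesis a2_gt0 : exists k, (2 <= k)%N /\ 0 < a k.
Hypotheses (tau_ge0 : 0 <= tau) (V_gt0 : 0 < V).
Hypothesis V_bound : forall N, \sum_(0 <= k < N) a k * tau ^+ k <= V.
Hypothesis V_opt : forall t W : R, 0 < t ->
  (forall N, \sum_(0 <= k < N) a k * t ^+ k <= W) -> t * V <= tau * W.

Hypothesis V_tau0 : tau = 0 -> V = a 0%N.

Let p k : R := tau ^+ k * a k / V.

Let h := cpow_shift a.
Let Fl A b : set_system nat := within [set n | 0 < h A b n] \oo.

Instance pos_cpow_filter' A b : Filter (Fl A b).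
Proof. exact: within_filter. Qed.

Let x A b d n := a d * h (A + d) b.+1 n / h A b n.

Let near_F A b (Q : nat -> Prop) N :
  (forall n, (N <= n)%N -> 0 < h A b n -> Q n) -> \forall n \near Fl A b, Q n.
Proof. exact: near_pos_cpow. Qed.

Lemma cpow_shift_ge0 A b n : 0 <= h A b n.
Proof. exact: cpow_ge0. Qed.

Lemma step_ratio_ge0 A b d n : 0 <= x A b d n.
Proof. by rewrite /x divr_ge0 ?mulr_ge0 ?cpow_shift_ge0. Qed.

Lemma cpow_shift_term A b d n : (A + b + d < n)%N -> a d * h (A + d) b.+1 n <= h A b n.
Proof.
move=> nN; rewrite /h /cpow_shift subnS subnDA.
rewrite [in leRHS](_ : n - b = (n - b).-1.+1)%N; last by lia.
by apply: cpow_term => //; lia.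
Qed.

Lemma step_cvg_tau0_pos A b d : tau = 0 -> (0 < d)%N -> x A b d n @[n --> Fl A b] --> p d.
Proof.
move=> tau0 d0; have -> : p d = 0 by rewrite /p tau0 expr0n gtn_eqF // !mul0r.
apply/cvgrPdist_le => e e0.
pose eta := Num.min 1 (e / 4).
have eta01 : 0 < eta <= 1.
  by rewrite lt_min ge_min lexx ltr01 divr_gt0.
have etae : 4 * eta <= e.
  have : eta <= e / 4 by rewrite ge_min lexx orbT.
  lra.
have H := step_le_tau0 a_ge0 a0_gt0 tau_ge0 V_gt0 V_opt A b tau0 d0 eta01.
near=> n; rewrite sub0r normrN ger0_norm ?step_ratio_ge0 //.
by apply: le_trans etae; near: n.
Unshelve. all: by end_near. Qed.

(** Complementation needs tightness, which Markov's inequality supplies: by exchangeability the mean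
    degree of a factor is m / (n - b) <= 2, so degrees from K on have probability at most 2 / K, and
    the degrees from 1 to K - 1 vanish in the limit. *)
Lemma step_cvg_tau0_0 A b : tau = 0 -> x A b 0 n @[n --> Fl A b] --> p 0.
Proof.
move=> tau0; have -> : p 0 = 1 by rewrite /p expr0 mul1r V_tau0 ?divff // gt_eqF.
apply/cvgrPdist_le => e e0.
pose K := (Num.bound (4 / e)).+1.
have K0 : 0 < K%:R :> R by rewrite ltr0n.
have Ke : 2 / K%:R <= e / 2.
  have := @archi_boundP R (4 / e) (ltW (divr_gt0 _ e0)) => /(_ (ltr0n R 4)).
  rewrite ltr_pdivrMr // ler_pdivrMr // /K -natr1 => ?; nra.
have S0 : \sum_(1 <= k < K) x A b k n @[n --> Fl A b] --> (0 : R).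
  elim: K {K0 Ke} => [|[|K] IH].
  - by under eq_fun do rewrite big_geq //; exact: cvg_cst.
  - by under eq_fun do rewrite big_geq //; exact: cvg_cst.
  under eq_fun do rewrite big_nat_recr //=.
  have p0 : p K.+1 = 0 by rewrite /p tau0 expr0n !mul0r.
  have := step_cvg_tau0_pos A b tau0 (ltn0Sn K); rewrite p0 => H.
  by have := cvgD IH H; rewrite addr0; apply.
have S1 : \forall n \near Fl A b, \sum_(1 <= k < K) x A b k n <= e / 2.
  move/cvgrPdist_le : S0 => /(_ _ (divr_gt0 e0 (ltr0n R 2))); apply: filterS => n.
  by rewrite sub0r normrN; apply: le_trans; rewrite ler_norm.
have S2 : \forall n \near Fl A b, 1 - x A b 0 n <= \sum_(1 <= k < K) x A b k n + 2 / K%:R.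
  apply: (@near_F _ _ _ (A + b + b + K).+2) => n nN hn.
  pose nb := (n - b)%N; pose m := (n.-1 - A)%N.
  have nbS : nb = nb.-1.+1 by clear -nN; rewrite /nb; lia.
  have nb0 : 0 < nb%:R :> R by rewrite ltr0n nbS.
  have hE : h A b n = cpow a nb.-1.+1 m by rewrite -nbS.
  have mnb : m%:R <= 2 * nb%:R :> R.
    by rewrite -natrM ler_nat; clear -nN; rewrite /nb /m; lia.
  have xE k : x A b k n = a k * cpow a nb.-1 (m - k) / h A b n.
    by rewrite /x {1}/h /cpow_shift subnS subnDA.
  have sum1 : \sum_(0 <= k < m.+1) x A b k n = 1.
    under eq_bigr do rewrite xE.
    by rewrite -mulr_suml -cpowS -hE divff ?gt_eqF.
  have sumk : \sum_(0 <= k < m.+1) k%:R * x A b k n <= 2.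
    have -> : \sum_(0 <= k < m.+1) k%:R * x A b k n = m%:R / nb%:R.
      under eq_bigr do rewrite xE mulrA mulrA.
      rewrite -mulr_suml; have := cpow_size_bias a nb.-1 m; rewrite -hE -nbS => Hs.
      rewrite -[m%:R](mulfK (lt0r_neq0 hn)) -Hs; field.
      by rewrite !gt_eqF.
    by rewrite ler_pdivrMr.
  have : \sum_(0 <= k < m.+1) x A b k n <=
     \sum_(0 <= k < K) x A b k n + (\sum_(0 <= k < m.+1) k%:R * x A b k n) / K%:R.
    have Km : (K <= m.+1)%N by clear -nN; rewrite /m; lia.
    rewrite (big_cat_nat (n := K)) //= lerD2l mulr_suml.
    rewrite [leRHS](big_cat_nat (n := K)) //=; apply: ler_wpDl.
      apply: sumr_ge0 => k _; apply: divr_ge0 => //.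
      by apply: mulr_ge0 => //; exact: step_ratio_ge0.
    rewrite big_nat_cond [leRHS]big_nat_cond; apply: ler_sum => k /andP[/andP[Kk _] _].
    by rewrite mulrAC ler_peMl ?step_ratio_ge0 // ler_pdivlMr // mul1r ler_nat.
  rewrite sum1 [X in _ <= X + _ -> _]big_nat_recl // => H.
  have : (\sum_(0 <= k < m.+1) k%:R * x A b k n) / K%:R <= 2 / K%:R.
    by rewrite ler_pM2r ?invr_gt0.
  rewrite [X in _ -> _ <= X + _]big_add1; lra.
have S3 : \forall n \near Fl A b, x A b 0 n <= 1.
  apply: (@near_F _ _ _ (A + b).+1) => n nN hn.
  by rewrite /x ler_pdivrMr // mul1r cpow_shift_term ?addn0.
near=> n.
have hx : x A b 0 n <= 1 by near: n.
rewrite ger0_norm ?subr_ge0 //.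
have h1 : 1 - x A b 0 n <= \sum_(1 <= k < K) x A b k n + 2 / K%:R by near: n.
have h2 : \sum_(1 <= k < K) x A b k n <= e / 2 by near: n.
lra.
Unshelve. all: by end_near. Qed.

Lemma step_cvg A b d : x A b d n @[n --> Fl A b] --> p d.
Proof.
have [tau0|] := eqVneq tau 0; last first.
  by move=> tn0; apply: step_cvg_pos => //; rewrite lt_neqAle eq_sym tn0.
by case: d => [|d]; [exact: step_cvg_tau0_0 | exact: step_cvg_tau0_pos].
Qed.

(** The ratio telescopes into one-step ratios. Each of them converges only along a positive
    denominator, so positivity has to be carried from one step to the next. *)
Lemma cpow_ratio_cvg (ds : seq nat) :
  (\prod_(d <- ds) a d) * h (sumn ds) (size ds) n / h 0 0 n @[n --> Fl 0 0]
  --> \prod_(d <- ds) p d.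
Proof.
pose r ds n := (\prod_(d <- ds) a d) * h (sumn ds) (size ds) n / h 0 0 n.
rewrite -/(r ds); elim: ds => [|d ds IH].
  rewrite big_nil; apply/cvgrPdist_le => e e0.
  apply: (@near_F _ _ _ 0) => n _ hn.
  by rewrite /r big_nil mul1r divff ?gt_eqF // subrr normr0 ltW.
have a0s es : 0 <= \prod_(d <- es) a d by apply: prodr_ge0.
have r0 es n : 0 <= r es n by rewrite divr_ge0 ?mulr_ge0 ?cpow_shift_ge0.
have rle : \forall n \near Fl 0 0, 0 <= r (d :: ds) n <= r ds n.
  apply: (@near_F _ _ _ (sumn ds + size ds + d).+1) => n nN hn.
  rewrite r0 /= /r ler_pM2r ?invr_gt0 // big_cons.
  by rewrite (mulrC (a d)) -mulrA ler_wpM2l //= addnC cpow_shift_term.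
rewrite big_cons; have [p0|pn0] := eqVneq (\prod_(d <- ds) p d) 0.
  rewrite p0 mulr0 in IH *.
  by apply: (squeeze_cvgr rle) => //; exact: cvg_cst.
have rpos : \forall n \near Fl 0 0, 0 < h (sumn ds) (size ds) n.
  have pp0 : 0 < \prod_(d <- ds) p d.
    rewrite lt_neqAle eq_sym pn0 /= prodr_ge0 // => i _.
    by rewrite /p divr_ge0 ?mulr_ge0 ?exprn_ge0 // ltW.
  have H : \forall n \near Fl 0 0, 0 < r ds n by apply: cvgr_gt IH _ pp0.
  apply: filterS H => n; rewrite lt_neqAle eq_sym => /andP[rn _].
  rewrite lt_neqAle cpow_shift_ge0 andbT eq_sym; apply: contraNneq rn => h0.
  by rewrite /r h0 mulr0 mul0r.
have xc : x (sumn ds) (size ds) d n @[n --> Fl 0 0] --> p d.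
  apply: (cvg_trans _ (step_cvg (sumn ds) (size ds) (d := d))).
  move=> Q HQ.
  have HQ' : \forall n \near \oo, 0 < h (sumn ds) (size ds) n ->
    Q (x (sumn ds) (size ds) d n) := HQ.
  have Hpos : \forall n \near \oo, 0 < h 0 0 n -> 0 < h (sumn ds) (size ds) n := rpos.
  have H : \forall n \near \oo, 0 < h 0 0 n -> Q (x (sumn ds) (size ds) d n).
    by apply: filterS2 HQ' Hpos => n h1 h2 h3; exact: h1 (h2 h3).
  exact: H.
apply: (cvg_trans _ (cvgM xc IH)); apply: near_eq_cvg.
apply: filterS rpos => n hn; rewrite /x /r big_cons /= addnC.
by move: (h 0 0 n)^-1 => u; field; rewrite gt_eqF.
Qed.

(** The sequence [ds] is a witness that D is a sum of l degrees of positive weight, which permits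
    division by the product of these weights. *)
Lemma cpow_ratio_cvg_sub (D l : nat) (ds : seq nat) :
  (forall d, d \in ds -> 0 < a d) -> D = sumn ds -> l = size ds ->
  h D l n / h 0 0 n @[n --> Fl 0 0] --> tau ^+ D / V ^+ l.
Proof.
move=> ads -> ->.
have Pa : 0 < \prod_(d <- ds) a d.
  by rewrite big_seq_cond; apply: prodr_gt0 => d /andP[/ads].
have PE : \prod_(d <- ds) p d = (\prod_(d <- ds) a d) * (tau ^+ sumn ds / V ^+ size ds).
  elim: ds {ads Pa} => [|d ds IH]; first by rewrite !big_nil /= !expr0 divr1 mulr1.
  by rewrite !big_cons IH /= exprD exprS invfM /p; ring.
set c := \prod_(d <- ds) a d in Pa PE.
have Hc : (fun=> c^-1) n @[n --> Fl 0 0] --> c^-1 by exact: cvg_cst.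
have H := cvgM Hc (@cpow_ratio_cvg ds).
rewrite PE mulKf ?gt_eqF // in H; refine (cvg_trans _ (H _)).
apply: near_eq_cvg; apply: nearW => n /=.
by rewrite -mulrA mulKf ?gt_eqF.
Qed.

End RatioLimitAlongTrees.

(** * The critical parameter tau *)

Section NonnegPowerSeries.
Variable (R : realType).
Implicit Types (c u : nat -> R).

Lemma nneg_series_nondecreasing u : (forall k, 0 <= u k) ->
  nondecreasing_seq (series u).
Proof. by move=> u0 n m nm; rewrite !seriesEnat /=; exact: ler_sum_widen. Qed.

Lemma nneg_series_cvg u (M : R) : (forall k, 0 <= u k) ->
  (forall N, \sum_(0 <= k < N) u k <= M) -> cvgn (series u).
Proof.
move=> u0 uM; apply: nondecreasing_is_cvgn; first exact: nneg_series_nondecreasing.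
by exists M => _ [N _ <-]; rewrite seriesEnat /=.
Qed.

Lemma nneg_series_le_lim u N : (forall k, 0 <= u k) -> cvgn (series u) ->
  \sum_(0 <= k < N) u k <= limn (series u).
Proof.
move=> u0 cu; have := nondecreasing_cvgn_le (nneg_series_nondecreasing u0) cu N.
by rewrite seriesEnat.
Qed.

Lemma series_lim_le u (M : R) : cvgn (series u) ->
  (forall N, \sum_(0 <= k < N) u k <= M) -> limn (series u) <= M.
Proof.
by move=> cu uM; apply: limr_le => //; apply: nearW => N; rewrite seriesEnat /=; exact: uM.
Qed.

Lemma series_lim_ge u (M : R) K : cvgn (series u) ->
  (forall N, (K <= N)%N -> M <= \sum_(0 <= k < N) u k) -> M <= limn (series u).
Proof.
move=> cu uM; apply: limr_ge => //; exists K => // N KN.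
Qed.

Section Coefficients.
Variable c : nat -> R.
Hypothesis c0 : forall k, 0 <= c k.

Let C t := cvgn (series (fun k => c k * t ^+ k)).

Lemma power_term_ge0 (t : R) k : 0 <= t -> 0 <= c k * t ^+ k.
Proof. by move=> t0; rewrite mulr_ge0 ?exprn_ge0. Qed.

Lemma power_sum_mono (s t : R) N : 0 <= s <= t ->
  \sum_(0 <= k < N) c k * s ^+ k <= \sum_(0 <= k < N) c k * t ^+ k.
Proof.
move=> /andP[s0 st]; apply: ler_sum => k _.
by rewrite ler_wpM2l // lerXn2r ?nnegrE // (le_trans s0).
Qed.

Lemma power_series_cvg_le (s t : R) : 0 <= s <= t -> C t -> C s.
Proof.
move=> st Ct; have [s0 st'] := andP st.
apply: (nneg_series_cvg (M := limn (series (fun k => c k * t ^+ k)))).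
  by move=> k; exact: power_term_ge0.
move=> N; apply: le_trans (power_sum_mono N st) _.
by apply: nneg_series_le_lim => // k; rewrite power_term_ge0 // (le_trans s0).
Qed.

(* Bernoulli: (r - s) (k + 1) s ^ k <= r ^ (k + 1). *)
Lemma pseries_diffs_cvg (s r : R) : 0 <= s < r -> C r ->
  cvgn (pseries (pseries_diffs c) s).
Proof.
move=> /andP[s0 sr] Cr; have r0 : 0 <= r by lra.
have d0 k : 0 <= pseries_diffs c k * s ^+ k.
  by rewrite /pseries_diffs !mulr_ge0 ?exprn_ge0.
apply: (nneg_series_cvg (M := limn (series (fun k => c k * r ^+ k)) / (r - s))) => //.
have bern k : (r - s) * (k.+1%:R * s ^+ k) <= r ^+ k.+1.
  suff H : (r - s) * (k.+1%:R * s ^+ k) <= r ^+ k.+1 - s ^+ k.+1.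
    by apply: le_trans H _; rewrite lerBlDr lerDl exprn_ge0.
  elim: k => [|k IH]; first by rewrite !expr1 expr0 !mulr1.
  have IH0 : 0 <= (r - s) * (k.+1%:R * s ^+ k).
    by rewrite !mulr_ge0 ?exprn_ge0 // subr_ge0 ltW.
  have := ler_pM s0 IH0 (ltW sr) IH.
  by rewrite !exprS -[k.+2%:R]natr1; lra.
move=> N; rewrite ler_pdivlMr ?subr_gt0 // mulr_suml.
apply: (@le_trans _ _ (\sum_(0 <= k < N.+1) c k * r ^+ k)); last first.
  by apply: nneg_series_le_lim => // k; rewrite power_term_ge0.
rewrite [leRHS]big_nat_recl //; apply: ler_wpDl; first exact: power_term_ge0.
apply: ler_sum => k _; rewrite /pseries_diffs /=.
rewrite (_ : _ * (r - s) = c k.+1 * ((r - s) * (k.+1%:R * s ^+ k))); last by ring.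
by rewrite ler_wpM2l.
Qed.
Lemma pseries_diffs_ge0 k : 0 <= pseries_diffs c k.
Proof. by rewrite /pseries_diffs mulr_ge0. Qed.

Lemma size_biased_term_ge0 (t : R) k : 0 <= t -> 0 <= k%:R * c k * t ^+ k.
Proof. by move=> t0; rewrite !mulr_ge0 ?exprn_ge0. Qed.

Lemma size_biased_sum (t : R) N :
  \sum_(0 <= k < N.+1) k%:R * c k * t ^+ k =
  t * \sum_(0 <= k < N) pseries_diffs c k * t ^+ k.
Proof.
rewrite big_nat_recl // !mul0r add0r mulr_sumr; apply: eq_bigr => k _.
by rewrite /pseries_diffs exprS; ring.
Qed.

Lemma size_biased_lim (t : R) : 0 <= t -> cvgn (pseries (pseries_diffs c) t) ->
  cvgn (series (fun k => k%:R * c k * t ^+ k)) /\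
  limn (series (fun k => k%:R * c k * t ^+ k)) = t * limn (pseries (pseries_diffs c) t).
Proof.
move=> t0 cd.
suff H : series (fun k => k%:R * c k * t ^+ k) @ \oo --> t * limn (pseries (pseries_diffs c) t).
  by split; [apply: cvgP H | apply: cvg_lim].
rewrite -(cvg_shiftS (series _)).
have -> : [sequence series (fun k => k%:R * c k * t ^+ k) n.+1]_n =
    (fun N => t * pseries (pseries_diffs c) t N).
  by apply/funext => N; rewrite /pseries !seriesEnat /= size_biased_sum.
by apply: cvgMr.
Qed.

End Coefficients.

Lemma nneg_pseries_is_derive c (t r : R) : (forall k, 0 <= c k) -> 0 <= t < r ->
  cvgn (series (fun k => c k * r ^+ k)) ->
  is_derive t (1 : R) (fun x => limn (pseries c x)) (limn (pseries (pseries_diffs c) t)).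
Proof.
move=> c0 /andP[t0 tr] Cr.
pose r1 := (t + 2 * r) / 3; pose r2 := (2 * t + r) / 3.
have r12 : t < r2 /\ r2 < r1 /\ r1 < r by rewrite /r1 /r2; split; [|split]; lra.
case: r12 => tr2 [r21 r1r].
have r20 : 0 <= r2 by lra.
have C1 : cvgn (pseries (pseries_diffs c) r1).
  by apply: pseries_diffs_cvg Cr => //; lra.
apply: (@pseries_snd_diffs _ _ r2).
- by apply: (power_series_cvg_le c0 _ Cr); lra.
- by apply: pseries_diffs_cvg Cr => //; lra.
- by apply: pseries_diffs_cvg C1; [exact: pseries_diffs_ge0 | lra].
- by rewrite !ger0_norm.
Qed.

(** Left continuity of a polynomial at r, made explicit by (1 - d)^k >= 1 - k d. It carries bounds
    from inside the disc to its boundary one partial sum at a time. *)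
Lemma power_sum_left_limit c (r M : R) N : (forall k, 0 <= c k) -> 0 < r ->
  (forall t, 0 < t < r -> \sum_(0 <= k < N) c k * t ^+ k <= M) ->
  \sum_(0 <= k < N) c k * r ^+ k <= M.
Proof.
move=> c0 r0 H; set S := \sum_(0 <= k < N) _.
have S0 : 0 <= S by apply: sumr_ge0 => k _; rewrite power_term_ge0 // ltW.
have key (d : R) : 0 < d < 1 -> (1 - N%:R * d) * S <= M.
  move=> /andP[d0 d1].
  have rd : 0 < r * (1 - d) < r by apply/andP; split; nra.
  apply: le_trans (H _ rd).
  rewrite /S mulr_sumr big_nat_cond [leRHS]big_nat_cond; apply: ler_sum => k /andP[/andP[_ kN] _].
  rewrite exprMn mulrC -mulrA ler_wpM2l // ler_wpM2l ?exprn_ge0 ?(ltW r0) //.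
  have : 1 - k%:R * d <= (1 - d) ^+ k.
    elim: k {kN} => [|k IH]; first by rewrite mul0r subr0 expr0.
    have d1' : 0 <= 1 - d by lra.
    have := ler_wpM2r d1' IH; rewrite exprS -natr1.
    have : 0 <= k%:R * (d * d) by rewrite !mulr_ge0 // ltW.
    lra.
  apply: le_trans; rewrite lerB // ler_wpM2r ?(ltW d0) // ler_nat ltnW //.
apply/ler_addgt0Pr => e e0.
pose d := Num.min (1 / 2) (e / (N%:R * S + 1)).
have NS : 0 < N%:R * S + 1 by rewrite ltr_wpDl // mulr_ge0.
have d01 : 0 < d < 1.
  rewrite /d lt_min gt_min; apply/andP; split; last by apply/orP; left; lra.
  by apply/andP; split; [lra | exact: divr_gt0].
have : d <= e / (N%:R * S + 1) by rewrite /d ge_min lexx orbT.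
rewrite ler_pdivlMr // => de.
have := key d d01; have [d0 _] := andP d01; nra.
Qed.

(* Chebyshev's sum inequality: [t ^ n s ^ k - s ^ n t ^ k] has the sign of [n - k]. *)
Lemma size_biased_cross c (s t : R) N : (forall k, 0 <= c k) -> 0 <= s <= t ->
  (\sum_(0 <= k < N) k%:R * c k * s ^+ k) * (\sum_(0 <= k < N) c k * t ^+ k) <=
  (\sum_(0 <= k < N) k%:R * c k * t ^+ k) * (\sum_(0 <= k < N) c k * s ^+ k).
Proof.
move=> c0 /andP[s0 st]; have t0 : 0 <= t by lra.
elim: N => [|N IH]; first by rewrite !big_nil !mul0r.
rewrite !big_nat_recr //=.
set As := \sum_(0 <= k < N) k%:R * c k * s ^+ k in IH *.
set At := \sum_(0 <= k < N) k%:R * c k * t ^+ k in IH *.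
set Bs := \sum_(0 <= k < N) c k * s ^+ k in IH *.
set Bt := \sum_(0 <= k < N) c k * t ^+ k in IH *.
suff H : 0 <= (N%:R * t ^+ N) * Bs + At * s ^+ N - (N%:R * s ^+ N) * Bt - As * t ^+ N.
  have := mulr_ge0 (c0 N) H; lra.
rewrite /As /At /Bs /Bt !mulr_sumr !mulr_suml -big_split /= -!sumrB.
rewrite big_nat_cond; apply: sumr_ge0 => k /andP[/andP[_ kN] _].
have -> : N%:R * t ^+ N * (c k * s ^+ k) + k%:R * c k * t ^+ k * s ^+ N -
   N%:R * s ^+ N * (c k * t ^+ k) - k%:R * c k * s ^+ k * t ^+ N =
   c k * (N%:R - k%:R) * (t ^+ N * s ^+ k - s ^+ N * t ^+ k) by ring.
rewrite mulr_ge0 ?mulr_ge0 ?subr_ge0 ?ler_nat ?(ltnW kN) //.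
rewrite -(subnK (ltnW kN)) !exprD -!mulrA [t ^+ k * s ^+ k]mulrC.
by rewrite ler_wpM2r ?mulr_ge0 ?exprn_ge0 // lerXn2r ?nnegrE.
Qed.

(** A criterion suited to monotone functions, with finite and infinite limits treated alike. *)
Lemma cvg_sup_EFin (F : set_system R) (g : R -> R) (L : \bar R) : ProperFilter F ->
  L != -oo%E ->
  (\forall t \near F, ((g t)%:E <= L)%E) ->
  (forall l : R, (l%:E < L)%E -> \forall t \near F, l < g t) ->
  (g t)%:E @[t --> F] --> L.
Proof.
move=> FF; case: L => [L| |] // _ gL lg.
  apply/cvg_EFin; first exact: nearW.
  apply/cvgrPdist_le => e e0 /=.
  have := lg (L - e); rewrite lte_fin ltrBlDr ltrDl e0 => /(_ isT) H.
  apply: filterS2 gL H => t; rewrite lee_fin => h1 h2.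
  by rewrite ger0_norm ?subr_ge0 //; lra.
apply/cvgeyPgt => l; apply: filterS (lg l (ltry l)) => t.
by rewrite lte_fin.
Qed.

End NonnegPowerSeries.

(** * Monotonicity of psi and the defining properties of tau *)

Section CriticalParameter.
Variables (R : realType) (S : nat -> finType) (kappa : forall k, S k -> R).
Hypothesis kappa_ge0 : forall n (r : S n), 0 <= kappa r.
Hypothesis omega0 : 0 < omega kappa 0.
Hypothesis omega2 : exists k, (2 <= k)%N /\ 0 < omega kappa k.

Notation a := (omega kappa).
Notation rho := (rho_phi kappa).
Notation Phi := (phi kappa).
Notation Psi := (psi kappa).

Lemma omega_ge0 k : 0 <= a k.
Proof. by rewrite /omega divr_ge0 // sumr_ge0. Qed.

Let C t := cvgn (series (fun k => a k * t ^+ k)).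
(** This is t phi'(t), written as a series so that it makes sense at the radius of convergence,
    where phi need not be differentiable. *)
Let D t : R := limn (series (fun k => k%:R * a k * t ^+ k)).

Lemma rho_ge0 : (0 <= rho)%E.
Proof.
apply: ereal_sup_ubound; exists 0 => //; split => //.
apply: (nneg_series_cvg (M := a 0%N)) => [k|N].
  by rewrite mulr_ge0 ?omega_ge0 // exprn_ge0.
case: N => [|N]; first by rewrite big_nil omega_ge0.
rewrite big_nat_recl // expr0 mulr1 big1 ?addr0 // => k _.
by rewrite expr0n mulr0.
Qed.

Lemma le_rho t : 0 <= t -> C t -> (t%:E <= rho)%E.
Proof. by move=> t0 Ct; apply: ereal_sup_ubound; exists t. Qed.

Lemma lt_rho t : (t%:E < rho)%E -> exists2 r, t < r & C r.
Proof.
move=> /ereal_sup_gt[_ [r [r0 Cr] <-]]; rewrite lte_fin => tr.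
by exists r.
Qed.

Lemma lt_rhoC t : 0 <= t -> (t%:E < rho)%E -> C t.
Proof.
move=> t0 /lt_rho[r tr Cr]; apply: (power_series_cvg_le omega_ge0 _ Cr).
by rewrite t0 ltW.
Qed.

Lemma Phi_ge t : 0 <= t -> C t -> a 0%N <= Phi t.
Proof.
move=> t0 Ct; apply: (series_lim_ge (K := 1)) => // -[//|N] _.
rewrite big_nat_recl // expr0 mulr1 lerDl sumr_ge0 // => k _.
by rewrite mulr_ge0 ?omega_ge0 // exprn_ge0.
Qed.

Lemma Phi_gt0 t : 0 <= t -> C t -> 0 < Phi t.
Proof. by move=> t0 Ct; apply: lt_le_trans (Phi_ge t0 Ct). Qed.

Lemma size_biased_sum_cvg t : 0 <= t -> (t%:E < rho)%E ->
  cvgn (series (fun k => k%:R * a k * t ^+ k)).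
Proof.
move=> t0 /lt_rho[r tr Cr].
have Cd : cvgn (pseries (pseries_diffs a) t).
  by apply: pseries_diffs_cvg Cr; [exact: omega_ge0 | rewrite t0].
by have [] := size_biased_lim t0 Cd.
Qed.

Lemma psiE t : 0 <= t -> (t%:E < rho)%E -> Psi t = D t / Phi t.
Proof.
move=> t0 /lt_rho[r tr Cr].
have Cd : cvgn (pseries (pseries_diffs a) t).
  by apply: pseries_diffs_cvg Cr; [exact: omega_ge0 | rewrite t0].
have tr' : 0 <= t < r by rewrite t0.
have Hd := nneg_pseries_is_derive omega_ge0 tr' Cr.
have [_ DE] := size_biased_lim t0 Cd.
by rewrite /psi /D DE derive1E (derive_val (is_derive := Hd)).
Qed.

Lemma size_biased_sum_ge0 t : 0 <= t -> (t%:E < rho)%E -> 0 <= D t.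
Proof.
move=> t0 tr; apply: (series_lim_ge (K := 0)) => [|N _]; first exact: size_biased_sum_cvg.
by apply: sumr_ge0 => k _; apply: size_biased_term_ge0 => //; exact: omega_ge0.
Qed.

Lemma psi_mono s t : 0 <= s <= t -> (t%:E < rho)%E -> Psi s <= Psi t.
Proof.
move=> /andP[s0 st] tr; have t0 : 0 <= t by lra.
have sr : (s%:E < rho)%E by apply: le_lt_trans tr; rewrite lee_fin.
have Cs := lt_rhoC s0 sr; have Ct := lt_rhoC t0 tr.
have Ds := size_biased_sum_cvg s0 sr; have Dt := size_biased_sum_cvg t0 tr.
rewrite !psiE // ler_pdivrMr ?Phi_gt0 // mulrAC ler_pdivlMr ?Phi_gt0 //.
have Hs := cvgM Ds Ct; have Ht := cvgM Dt Cs.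
refine (ler_cvg_to (Hs _) (Ht _) _).
apply: nearW => N /=; rewrite !seriesEnat /=.
by apply: size_biased_cross; [exact: omega_ge0 | rewrite s0].
Qed.

Lemma psi_small : (0 < rho)%E -> exists s, [/\ 0 < s, (s%:E < rho)%E & Psi s < 1].
Proof.
move=> rho0.
have [r r0 Cr] := lt_rho rho0.
pose q := r / 2.
have q0 : 0 < q by rewrite /q; lra.
have qr : (q%:E < rho)%E.
  by apply: lt_le_trans (le_rho (ltW r0) Cr); rewrite lte_fin /q; lra.
have : 0 <= D q := size_biased_sum_ge0 (ltW q0) qr.
set Dq := D q => Dq0.
set A0 : R := a 0%N; have A00 : 0 < A0 := omega0.
(* D has no constant term, so passing from q to s multiplies it by at most s / q, and this quotient
   brings D(s) below a_0 <= phi(s). *)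
pose s := q * (A0 / (A0 + Dq + 1)).
have den : 0 < A0 + Dq + 1 by lra.
have fr : 0 < A0 / (A0 + Dq + 1) <= 1.
  by rewrite divr_gt0 // ler_pdivrMr // mul1r; lra.
have [fr0 fr1] := andP fr.
have s0 : 0 < s by rewrite mulr_gt0.
have sq : s <= q by rewrite /s ler_piMr // ltW.
have sr : (s%:E < rho)%E by apply: le_lt_trans qr; rewrite lee_fin.
exists s; split => //.
have Cs := lt_rhoC (ltW s0) sr.
rewrite psiE ?(ltW s0) // ltr_pdivrMr ?Phi_gt0 ?(ltW s0) // mul1r.
apply: lt_le_trans (Phi_ge (ltW s0) Cs).
apply: (@le_lt_trans _ _ (A0 / (A0 + Dq + 1) * Dq)); last first.
  by rewrite mulrAC ltr_pdivrMr // ltr_pM2l //; lra.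
apply: series_lim_le; first exact: size_biased_sum_cvg (ltW s0) sr.
move=> N; apply: (@le_trans _ _ (A0 / (A0 + Dq + 1) *
    \sum_(0 <= k < N) k%:R * a k * q ^+ k)); last first.
  rewrite ler_wpM2l ?(ltW fr0) //; apply: nneg_series_le_lim; last exact: size_biased_sum_cvg (ltW q0) qr.
  by move=> k; apply: size_biased_term_ge0; [exact: omega_ge0 | exact: ltW].
rewrite mulr_sumr; apply: ler_sum => -[|k] _; first by rewrite !mul0r mulr0.
have -> : k.+1%:R * a k.+1 * s ^+ k.+1 =
    (A0 / (A0 + Dq + 1)) ^+ k.+1 * (k.+1%:R * a k.+1 * q ^+ k.+1).
  by rewrite /s exprMn; ring.
rewrite ler_wpM2r //.
  by apply: size_biased_term_ge0; [exact: omega_ge0 | exact: ltW].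
rewrite exprS ler_piMr ?(ltW fr0) // exprn_ile1 // ltW //.
Qed.

(** D - phi is the series with coefficients (k - 1) a_k, whose only negative term is the constant
    one; truncation therefore gives a lower bound. *)
Lemma D_sub_Phi t K : 0 <= t -> (t%:E < rho)%E -> (0 < K)%N ->
  (\sum_(1 <= k < K) (k%:R - 1) * (a k * t ^+ k)) - a 0%N <= D t - Phi t.
Proof.
move=> t0 tr K0; have Ct := lt_rhoC t0 tr; have Dt := size_biased_sum_cvg t0 tr.
have H : (fun N => \sum_(0 <= k < N) (k%:R - 1) * (a k * t ^+ k)) @ \oo --> D t - Phi t.
  have -> : (fun N => \sum_(0 <= k < N) (k%:R - 1) * (a k * t ^+ k)) =
      (series (fun k => k%:R * a k * t ^+ k) - series (fun k => a k * t ^+ k)).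
    apply/funext => N; rewrite !fctE !seriesEnat /= -sumrB.
    by apply: eq_bigr => k _; ring.
  by have H := cvgB Dt Ct; exact: (H _).
rewrite -(cvg_lim _ H) //; apply: limr_ge; first exact: cvgP H.
exists K => // N /= KN.
have N0 : (0 < N)%N by exact: leq_trans KN.
rewrite [leRHS]big_ltn // sub0r mulN1r expr0 mulr1 addrC lerD2l.
rewrite (big_cat_nat (n := K) (p := N)) //= lerDl big_nat_cond.
apply: sumr_ge0 => k /andP[/andP[Kk _] _].
apply: mulr_ge0; first by rewrite subr_ge0 ler1n (leq_trans K0).
by apply: power_term_ge0 => //; exact: omega_ge0.
Qed.

Lemma psi_large : rho = +oo%E -> exists t, 0 < t /\ 1 < Psi t.
Proof.
move=> rhoE; have [k0 [k02 ak0]] := omega2.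
(* Chosen so that a_k0 t exceeds a_0: the term of degree k0 alone then makes D - phi positive. *)
pose t := 1 + a 0%N / a k0.
have t1 : 1 < t by rewrite /t ltrDl divr_gt0.
have t0 : 0 < t by lra.
have tr : (t%:E < rho)%E by rewrite rhoE ltry.
exists t; split => //.
have Ct := lt_rhoC (ltW t0) tr.
rewrite psiE ?(ltW t0) // ltr_pdivlMr ?Phi_gt0 ?(ltW t0) // mul1r -subr_gt0.
apply: lt_le_trans (D_sub_Phi (K := k0.+1) (ltW t0) tr isT).
rewrite subr_gt0 big_nat_recr /=; last exact: ltnW.
apply: ltr_wpDl.
  rewrite big_nat_cond; apply: sumr_ge0 => k /andP[/andP[Kk _] _].
  apply: mulr_ge0; first by rewrite subr_ge0 ler1n.
  by apply: power_term_ge0 (ltW t0); exact: omega_ge0.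
apply: (@lt_le_trans _ _ (a k0 * t)).
  by rewrite /t mulrDr mulr1 mulrCA divff ?gt_eqF // mulr1 ltrDr.
apply: (@le_trans _ _ (a k0 * t ^+ k0)).
  rewrite ler_wpM2l ?omega_ge0 // -{1}[t]expr1 ler_weXn2l //; [exact: ltW|exact: ltnW].
rewrite ler_peMl //; first by apply: power_term_ge0 (ltW t0); exact: omega_ge0.
have : 2 <= k0%:R :> R by rewrite ler_nat.
lra.
Qed.

(** As psi is nondecreasing, the limit that defines [nu] is a supremum, for finite and infinite
    radius at once. *)
Lemma nuP : (0 < rho)%E ->
  (forall t, 0 < t -> (t%:E < rho)%E -> ((Psi t)%:E <= nu kappa)%E) /\
  (forall l : R, (l%:E < nu kappa)%E -> exists t, [/\ 0 < t, (t%:E < rho)%E & l < Psi t]).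
Proof.
move=> rho0.
pose A := [set (Psi t)%:E | t in [set t : R | 0 < t /\ (t%:E < rho)%E]].
suff -> : nu kappa = ereal_sup A.
  split => [t t0 tr|l /ereal_sup_gt[_ [t [t0 tr] <-]]]; last first.
    by rewrite lte_fin => lt; exists t.
  by apply: ereal_sup_ubound; exists t.
have [s [s0 sr _]] := psi_small rho0.
have LN : ereal_sup A != -oo%E.
  rewrite -ltNye; apply: lt_le_trans (ltNyr (Psi s)) _.
  by apply: ereal_sup_ubound; exists s.
have main (F : set_system R) : ProperFilter F ->
    (forall t0, 0 < t0 -> (t0%:E < rho)%E -> \forall t \near F, t0 < t /\ (t%:E < rho)%E) ->
    lim ((Psi t)%:E @[t --> F]) = ereal_sup A.
  move=> FF HF; apply: cvg_lim; first exact: ereal_hausdorff.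
  apply: cvg_sup_EFin => // [|l /ereal_sup_gt[_ [t [t0 tr] <-]]].
    apply: filterS (HF s s0 sr) => t [st tr]; apply: ereal_sup_ubound.
    by exists t => //; split => //; exact: lt_trans st.
  rewrite lte_fin => lt; apply: filterS (HF t t0 tr) => t' [tt' tr'].
  by apply: lt_le_trans lt _; apply: psi_mono => //; rewrite !ltW.
rewrite /nu; move: rho0 sr main; case: rho_phi => [r| |] // rho0 sr main.
  rewrite ifF; last by rewrite gt_eqF // -lte_fin.
  apply: main => t0 _ t0r; rewrite lte_fin in t0r.
  by near=> t; split; [near: t; exact: nbhs_left_gt | rewrite lte_fin; near: t; exact: nbhs_left_lt].
apply: main => t0 _ _; near=> t; split; last exact: ltry.
by near: t; apply: nbhs_pinfty_gt; rewrite num_real.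
Unshelve. all: by end_near. Qed.

(** The identity psi = nu extended to the boundary point: for nu <= 1 both series still converge at
    the radius r, and their quotient there is the limit of psi. *)
Lemma boundary_size_biased (r : R) : rho = r%:E -> 0 < r -> (nu kappa <= 1)%E ->
  exists v, [/\ nu kappa = v%:E, 0 <= v, C r,
    cvgn (series (fun k => k%:R * a k * r ^+ k)) & D r = v * Phi r].
Proof.
move=> rhoE r0 nu1.
have rho0 : (0 < rho)%E by rewrite rhoE lte_fin.
have [nu_ub nu_sup] := nuP rho0.
have a0 := omega_ge0.
have ltr t : t < r -> (t%:E < rho)%E by rewrite rhoE lte_fin.
have psi0 t : 0 < t -> t < r -> 0 <= Psi t.
  move=> t0 /ltr tr; rewrite psiE ?(ltW t0) // divr_ge0 ?size_biased_sum_ge0 ?(ltW t0) //.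
  by apply/ltW/Phi_gt0; [exact: ltW | exact: lt_rhoC (ltW t0) tr].
have r2 : 0 < r / 2 < r by apply/andP; split; lra.
have [r20 r2r] := andP r2.
have [v nuE] : exists v, nu kappa = v%:E.
  have := nu_ub _ r20 (ltr _ r2r).
  by case: nu nu1 => [v| |] //; exists v.
have v0 : 0 <= v.
  by rewrite -lee_fin -nuE; apply: le_trans (nu_ub _ r20 (ltr _ r2r)); rewrite lee_fin psi0.
have v1 : v <= 1 by rewrite -lee_fin -nuE.
have DPhi t : 0 < t -> t < r -> D t <= v * Phi t.
  move=> t0 tr; have := nu_ub _ t0 (ltr _ tr); rewrite nuE lee_fin psiE ?(ltW t0) ?ltr //.
  by rewrite ler_pdivrMr // Phi_gt0 ?(ltW t0) //; apply: lt_rhoC (ltW t0) (ltr _ tr).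
have b0 k : 0 <= k%:R * a k by rewrite mulr_ge0.
have cvD : cvgn (series (fun k => k%:R * a k * r ^+ k)).
  (* Inside the disc D <= phi bounds the sum of (k - 1) a_k t^k over k >= 2 by a_0, and k <= 2 (k -
     1) there; the term k = 1 is bounded on its own. *)
  apply: (nneg_series_cvg (M := a 1%N * r + 2 * a 0%N)).
    by move=> k; apply: size_biased_term_ge0 (ltW r0).
  move=> N; apply: (@power_sum_left_limit _ (fun k => k%:R * a k)) => // t /andP[t0 tr].
  have Ct := lt_rhoC (ltW t0) (ltr _ tr).
  pose K := N.+2.
  have t_ge0 k : 0 <= k%:R * a k * t ^+ k by apply: size_biased_term_ge0 (ltW t0).
  apply: (le_trans (ler_sum_widen t_ge0 (_ : (N <= K)%N))); first by rewrite /K; lia.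
  have H := D_sub_Phi (K := K) (ltW t0) (ltr _ tr) isT.
  have Pt := Phi_gt0 (ltW t0) Ct.
  have DP : D t - Phi t <= 0.
    rewrite subr_le0; apply: le_trans (DPhi t t0 tr) _.
    by rewrite ler_piMl // ltW.
  have {}H := le_trans H DP; rewrite subr_le0 /K big_ltn // subrr mul0r add0r in H.
  rewrite /K big_ltn // mul0r mul0r add0r big_ltn // expr1 mul1r lerD //.
    by rewrite ler_wpM2l // ltW.
  rewrite -/K in H *; apply: le_trans (ler_wpM2l (ler0n R 2) H).
  rewrite mulr_sumr big_nat_cond [leRHS]big_nat_cond; apply: ler_sum => k /andP[/andP[k2 _] _].
  rewrite -mulrA [leRHS]mulrA ler_wpM2r ?power_term_ge0 ?(ltW t0) //.
  have : 2 <= k%:R :> R by rewrite ler_nat.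
  lra.
have Cr : C r.
  have u0 k : 0 <= k%:R * a k * r ^+ k by apply: size_biased_term_ge0 (ltW r0).
  apply: (nneg_series_cvg (M := a 0%N + D r)) => [k|[|N]]; first exact: power_term_ge0 (ltW r0).
    by rewrite big_nil addr_ge0 //; apply: (series_lim_ge (K := 0)) => // N _; exact: sumr_ge0.
  rewrite big_ltn // expr0 mulr1 lerD2l; apply: le_trans (nneg_series_le_lim N.+1 u0 cvD).
  rewrite [leRHS]big_ltn // mul0r mul0r add0r big_nat_cond [leRHS]big_nat_cond.
  apply: ler_sum => k /andP[/andP[k1 _] _].
  by rewrite -mulrA ler_peMl ?power_term_ge0 ?(ltW r0) // ler1n.
exists v; split => //; apply/eqP; rewrite eq_le; apply/andP; split.
  apply: series_lim_le => // N.
  apply: (@power_sum_left_limit _ (fun k => k%:R * a k)) => // t /andP[t0 tr].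
  have Dt := size_biased_sum_cvg (ltW t0) (ltr _ tr).
  apply: (@le_trans _ _ (D t)).
    by apply: nneg_series_le_lim => // k; apply: size_biased_term_ge0 (ltW t0).
  apply: le_trans (DPhi t t0 tr) _; rewrite ler_wpM2l //.
  apply: series_lim_le; first exact: lt_rhoC (ltW t0) (ltr _ tr).
  move=> M; apply: le_trans (nneg_series_le_lim M (fun k => power_term_ge0 a0 k (ltW r0)) Cr).
  by apply: power_sum_mono => //; rewrite !ltW.
rewrite -[leRHS]addr0; apply/ler_addgt0Pr => e e0.
have Pr := Phi_gt0 (ltW r0) Cr.
pose l := v - e / Phi r.
have [t0 [t00 t0r lt0]] : exists t, [/\ 0 < t, (t%:E < rho)%E & l < Psi t].
  by apply: nu_sup; rewrite nuE lte_fin /l ltrBlDr ltrDl divr_gt0.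
rewrite addr0 -lerBlDr (_ : v * Phi r - e = l * Phi r); last first.
  by rewrite /l; field; rewrite gt_eqF.
have [l0|l0] := leP 0 l; last first.
  apply: (@le_trans _ _ 0); first by rewrite mulr_le0_ge0 // ltW.
  by apply: (series_lim_ge (K := 0)) => // N _; apply: sumr_ge0 => k _; apply: size_biased_term_ge0 (ltW r0).
have l' N : l * \sum_(0 <= k < N) a k * r ^+ k <= D r.
  rewrite mulr_sumr; under eq_bigr do rewrite mulrA.
  apply: (@power_sum_left_limit _ (fun k => l * a k)) => // [k|t /andP[tt0 tr]].
    exact: mulr_ge0.
  (* Moving t up to at least t0 ensures psi >= l there, so the partial sum is compared through l
     phi(t') <= D(t') <= D(r). *)
  pose t' := Num.max t t0.
  have t'r : t' < r by rewrite /t' gt_max tr; rewrite rhoE in t0r.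
  have t'0 : 0 < t' by rewrite lt_max tt0.
  have Ct' := lt_rhoC (ltW t'0) (ltr _ t'r).
  apply: (@le_trans _ _ (l * Phi t')).
    under eq_bigr do rewrite -mulrA; rewrite -mulr_sumr ler_wpM2l //.
    apply: (@le_trans _ _ (\sum_(0 <= k < N) a k * t' ^+ k)).
      by apply: power_sum_mono => //; rewrite (ltW tt0) le_max lexx.
    by apply: nneg_series_le_lim => // k; apply: power_term_ge0 (ltW t'0).
  have lP : l <= Psi t'.
    apply: le_trans (ltW lt0) _; apply: psi_mono; last exact: ltr.
    by rewrite (ltW t00) le_max lexx orbT.
  apply: (@le_trans _ _ (D t')).
    by move: lP; rewrite psiE ?(ltW t'0) ?ltr // ler_pdivlMr // Phi_gt0 // ltW.
  apply: series_lim_le; first exact: size_biased_sum_cvg (ltW t'0) (ltr _ t'r).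
  move=> M; apply: le_trans (nneg_series_le_lim M (fun k => size_biased_term_ge0 a0 k (ltW r0)) cvD).
  by apply: power_sum_mono => //; rewrite !ltW.
have [l00|l_gt0] := eqVneq l 0.
  rewrite l00 mul0r; apply: (series_lim_ge (K := 0)) => // N _.
  by apply: sumr_ge0 => k _; apply: size_biased_term_ge0 (ltW r0).
have {}l_gt0 : 0 < l by rewrite lt_neqAle eq_sym l_gt0.
rewrite mulrC -ler_pdivlMr //; apply: series_lim_le => // N.
by rewrite ler_pdivlMr // mulrC.
Qed.

Lemma critical_root : (0 < rho)%E -> (1 < nu kappa)%E ->
  exists t, [/\ 0 < t, (t%:E < rho)%E & Psi t = 1].
Proof.
move=> rho0 nu1; have [s [s0 sr Ps]] := psi_small rho0.
have [_ /(_ 1 nu1)[t1 [t10 t1r Pt1]]] := nuP rho0.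
have st : s <= t1.
  rewrite leNgt; apply/negP => ts.
  have := psi_mono (s := t1) (t := s); rewrite !(ltW ts) !(ltW t10) => /(_ isT sr).
  by rewrite leNgt (lt_trans Ps Pt1).
have [r t1r' Cr] := lt_rho t1r.
pose r2 := (t1 + r) / 2.
have [t1r2 r2r] : t1 < r2 /\ r2 < r by rewrite /r2; split; lra.
have r20 : 0 <= r2 by apply/ltW; exact: lt_trans t1r2.
have r2rho : (r2%:E < rho)%E.
  by apply: lt_le_trans (le_rho _ Cr); [rewrite lte_fin | apply/ltW; exact: le_lt_trans r2r].
have Dr2 := size_biased_sum_cvg r20 r2rho.
(* The intermediate value theorem is applied to D - phi, whose zeros are those of psi - 1, so that
   only power series have to be differentiated. *)
have cont : {within `[s, t1], continuous (fun x => D x - Phi x)}.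
  apply: derivable_within_continuous => x; rewrite in_itv /= => /andP[sx xt].
  have x0 : 0 <= x by apply/ltW; exact: lt_le_trans sx.
  have xr2 : 0 <= x < r2 by rewrite x0 (le_lt_trans xt).
  have xr : 0 <= x < r by rewrite x0 (le_lt_trans xt).
  have b0 k : 0 <= k%:R * a k by rewrite mulr_ge0 ?omega_ge0.
  have [d1 _] := nneg_pseries_is_derive b0 xr2 Dr2.
  have [d2 _] := nneg_pseries_is_derive omega_ge0 xr Cr.
  exact: derivableB.
have val t : 0 < t -> (t%:E < rho)%E -> D t - Phi t = (Psi t - 1) * Phi t.
  move=> t0 tr; rewrite psiE ?(ltW t0) // mulrBl mul1r divfK //.
  by rewrite gt_eqF // Phi_gt0 ?(ltW t0) //; exact: lt_rhoC (ltW t0) tr.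
have Phip t : 0 < t -> (t%:E < rho)%E -> 0 < Phi t.
  by move=> t0 tr; rewrite Phi_gt0 ?(ltW t0) //; exact: lt_rhoC (ltW t0) tr.
have [] := @IVT _ (fun x => D x - Phi x) s t1 0 st cont.
  rewrite ge_min le_max !val //; apply/andP; split; apply/orP.
    by left; rewrite mulr_le0_ge0 ?(ltW (Phip _ _ _)) // subr_le0 ltW.
  by right; rewrite mulr_ge0 ?(ltW (Phip _ _ _)) // subr_ge0 ltW.
move=> c; rewrite in_itv /= => /andP[sc ct] DPc.
have c0 : 0 < c by exact: lt_le_trans sc.
have cr : (c%:E < rho)%E by apply: le_lt_trans t1r; rewrite lee_fin.
exists c; split => //; apply/eqP; rewrite -subr_eq0.
have := val c c0 cr; rewrite DPc => /esym/eqP; rewrite mulf_eq0 => /orP[//|].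
by rewrite gt_eqF // Phip.
Qed.

(** Unites the regimes rho = 0, tau on the boundary and tau an interior root. The alternative
    between mu = 1 and tau = rho is what the minimality of phi(t) / t at tau rests on. *)
Lemma tau_spec :
  [/\ 0 <= tau kappa, C (tau kappa),
      cvgn (series (fun k => k%:R * a k * tau kappa ^+ k)) &
      D (tau kappa) = mu kappa * Phi (tau kappa)] /\
  [/\ 0 <= mu kappa <= 1, mu kappa = 1 \/ (tau kappa)%:E = rho &
      tau kappa = 0 -> rho = 0%E].
Proof.
have [rho0|rho_le0] := ltP 0%E rho; last first.
  have rhoE : rho = 0%E by apply/eqP; rewrite eq_le rho_le0 rho_ge0.
  have nuE : nu kappa = 0%E by rewrite /nu rhoE /= eqxx.
  have tauE : tau kappa = 0 by rewrite /tau nuE rhoE lee_fin ler10.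
  have muE : mu kappa = 0 by rewrite /mu nuE /Order.min lte_fin ltr01.
  have DE : series (fun k => k%:R * a k * 0 ^+ k) = (fun=> 0).
    apply/funext => N; rewrite seriesEnat /= big1 // => -[|k] _.
      by rewrite !mul0r.
    by rewrite expr0n mulr0.
  rewrite tauE muE; split; split => //.
  - apply: (nneg_series_cvg (M := a 0%N)) => [k|[|N]].
    + by apply: power_term_ge0 => //; exact: omega_ge0.
    + by rewrite big_nil omega_ge0.
    rewrite big_nat_recl // expr0 mulr1 big1 ?addr0 // => k _.
    by rewrite expr0n mulr0.
  - by rewrite DE; exact: is_cvg_cst.
  - by rewrite /D DE mul0r; exact: lim_cst.
  - by rewrite lexx ler01.
  - by right.
have nu_fin_bdry : (nu kappa <= 1)%E -> exists2 r, rho = r%:E & 0 < r.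
  move=> nu1; move: rho0; case rhoE : rho => [r| |] // r0.
    by exists r => //; rewrite -lte_fin.
  have [t [t0 Pt]] := psi_large rhoE.
  have rho0 : (0 < rho)%E by rewrite rhoE.
  have [/(_ t t0)] := nuP rho0; rewrite rhoE => /(_ (ltry _)) h _.
  by have := le_trans h nu1; rewrite lee_fin leNgt Pt.
have muE1 : (1 <= nu kappa)%E -> mu kappa = 1.
  by move=> nu1; rewrite /mu min_r.
have [nu1|nu1] := leP 1%E (nu kappa); last first.
  have [r rhoE r0] := nu_fin_bdry (ltW nu1).
  have [v [nuE v0 Cr cvD DE]] := boundary_size_biased rhoE r0 (ltW nu1).
  have tauE : tau kappa = r by rewrite /tau leNgt nu1 rhoE.
  have v1 : v <= 1 by rewrite -lee_fin -nuE ltW.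
  have muE : mu kappa = v by rewrite /mu min_l ?nuE // -nuE ltW.
  rewrite tauE muE; split; split => //; first exact: ltW.
  - by rewrite v0.
  - by right.
  - by move=> h; rewrite h ltxx in r0.
have ex : exists t : R, 0 < t /\ (t%:E <= rho)%E /\ psibar kappa t = 1%E.
  have [nu_le1|nu_gt1] := leP (nu kappa) 1%E.
    have [r rhoE r0] := nu_fin_bdry nu_le1.
    exists r; split => //; split; first by rewrite rhoE.
    by rewrite /psibar rhoE eqxx; apply/eqP; rewrite eq_le nu_le1.
  have [t [t0 tr Pt]] := critical_root rho0 nu_gt1.
  exists t; split => //; split; first exact: ltW.
  by rewrite /psibar lt_eqF // Pt.
have [t0 [tr Pt]] : 0 < tau kappa /\ ((tau kappa)%:E <= rho)%E /\ psibar kappa (tau kappa) = 1%E.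
  rewrite /tau nu1; case: pselect => // h.
  by case: (cid h).
rewrite muE1 // mul1r.
have tn0 : tau kappa = 0 -> rho = 0%E by move=> h; rewrite h ltxx in t0.
move: Pt; rewrite /psibar; case: eqP => [tE|tn].
  move=> nuE; have nu_le1 : (nu kappa <= 1)%E by rewrite nuE.
  have [v [nuE' v0 Cr cvD DE]] := boundary_size_biased (esym tE) t0 nu_le1.
  have vE : v = 1 by move: nuE'; rewrite nuE => -[].
  rewrite vE mul1r in DE.
  by split; split => //; [exact: ltW | rewrite ler01 lexx | left].
have tlt : ((tau kappa)%:E < rho)%E by rewrite lt_neqAle tr andbT; apply/eqP.
move=> [] Pt; have Ct := lt_rhoC (ltW t0) tlt.
split; split => //; [exact: ltW | exact: size_biased_sum_cvg (ltW t0) tlt | | by rewrite ler01 lexx | by left].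
move: Pt; rewrite psiE ?(ltW t0) // => /(canRL (divfK _)) ->; first by rewrite mul1r.
by rewrite gt_eqF // Phi_gt0 ?(ltW t0).
Qed.

Lemma tau_ge0 : 0 <= tau kappa.
Proof. by have [[]] := tau_spec. Qed.

Lemma Phi_tau_gt0 : 0 < Phi (tau kappa).
Proof. by have [[t0 Ct _ _] _] := tau_spec; exact: Phi_gt0. Qed.

Lemma Phi_tau_cvg : series (fun k => a k * tau kappa ^+ k) @ \oo --> Phi (tau kappa).
Proof. by have [[t0 Ct _ _] _] := tau_spec; exact: Ct. Qed.

Lemma Phi_tau_bound N : \sum_(0 <= k < N) a k * tau kappa ^+ k <= Phi (tau kappa).
Proof.
have [[t0 Ct _ _] _] := tau_spec; apply: nneg_series_le_lim => // k.
by apply: power_term_ge0 => //; exact: omega_ge0.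
Qed.

Lemma size_biased_tau_cvg : series (fun k => k%:R * a k * tau kappa ^+ k) @ \oo -->
  mu kappa * Phi (tau kappa).
Proof. by have [[t0 Ct CD <-] _] := tau_spec; exact: CD. Qed.

Lemma Phi_tau0 : tau kappa = 0 -> Phi (tau kappa) = a 0%N.
Proof.
move=> ->; apply: cvg_lim => //; rewrite -(cvg_shiftS (series _)).
rewrite (_ : [sequence _]_n = fun=> a 0%N); first exact: cvg_cst.
apply/funext => N; rewrite seriesEnat /= big_nat_recl // expr0 mulr1 big1 ?addr0 //.
by move=> k _; rewrite expr0n mulr0.
Qed.

(* By convexity of the monomials, phi lies above its tangent line at tau, which
   has slope mu phi(tau) / tau. *)
Lemma Phi_tau_opt (t W : R) : 0 < t ->
  (forall N, \sum_(0 <= k < N) a k * t ^+ k <= W) ->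
  t * Phi (tau kappa) <= tau kappa * W.
Proof.
move=> t0 HW; have [[tau0 _ _ _] [/andP[mu0 mu1] Hmu Htau0]] := tau_spec.
have Ct : C t.
  apply: (nneg_series_cvg (M := W)) => // k.
  by apply: power_term_ge0 (ltW t0); exact: omega_ge0.
have trho := le_rho (ltW t0) Ct.
set u := tau kappa in tau0 Hmu Htau0 *.
set V := Phi u.
have V0 : 0 < V by exact: Phi_tau_gt0.
(* The tangent-line inequality for t^k at u, multiplied by u so that it also covers u = 0. *)
have bern k : u ^+ k.+1 + k%:R * u ^+ k * (t - u) <= u * t ^+ k.
  elim: k => [|k IH]; first by rewrite mul0r mul0r addr0 expr0 expr1 mulr1.
  have h0 : 0 <= k%:R * u ^+ k * (t - u) ^+ 2.
    by apply: mulr_ge0; [apply: mulr_ge0 => //; exact: exprn_ge0 | exact: sqr_ge0].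
  have := ler_wpM2r (ltW t0) IH.
  rewrite [u ^+ k.+2]exprS (exprS t) !(exprS u k) -natr1 in h0 *; lra.
have H1 : (fun N => u * \sum_(0 <= k < N) a k * u ^+ k +
    (t - u) * \sum_(0 <= k < N) k%:R * a k * u ^+ k) @ \oo --> u * V + (t - u) * (mu kappa * V).
  have h1 : (fun N => u * series (fun k => a k * u ^+ k) N) @ \oo --> u * V.
    by apply: cvgMr; exact: Phi_tau_cvg.
  have h2 : (fun N => (t - u) * series (fun k => k%:R * a k * u ^+ k) N) @ \oo -->
      (t - u) * (mu kappa * V).
    by apply: cvgMr; exact: size_biased_tau_cvg.
  have h := cvgD h1 h2; apply: cvg_trans (h _).
  by apply: near_eq_cvg; apply: nearW => N; rewrite !fctE !seriesEnat.
have H2 : u * V + (t - u) * (mu kappa * V) <= u * W.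
  rewrite -(cvg_lim _ H1) //; apply: limr_le; first exact: cvgP H1.
  apply: nearW => N; apply: le_trans (ler_wpM2l tau0 (HW N)).
  rewrite !mulr_sumr -big_split /=; apply: ler_sum => k _.
  have := ler_wpM2l (omega_ge0 k) (bern k); rewrite exprS; lra.
(* For mu = 1 the tangent passes through the origin. Otherwise tau = rho, so t <= tau, and the
   defect (u - t) (1 - mu) phi(u) has the right sign. *)
apply: le_trans H2; case: Hmu => [->|tE]; first by apply: eqr_le; ring.
have tu : t <= u by rewrite -lee_fin tE.
have : 0 <= (u - t) * (1 - mu kappa) * V by rewrite !mulr_ge0 ?subr_ge0 // ltW.
lra.
Qed.

End CriticalParameter.

(** * Weighted counting of trees extending a partial tree *)

Section Boxes.
Variable n : nat.

Lemma boxval_inj : injective (@boxval n).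
Proof.
move=> [k t] [k' t']; rewrite /boxval /= => tt'.
have kk' : k = k'.
  by apply: val_inj; rewrite /= -(size_tuple t) -(size_tuple t') -!(size_map val) tt'.
case: _ / kk' in t' tt' *; congr existT; apply: val_inj.
exact: (inj_map val_inj) tt'.
Qed.

Lemma boxval_onto (v : seq nat) : (size v < n)%N -> all (fun i => (i < n)%N) v ->
  exists b : Box n, boxval b = v.
Proof.
move=> sv av; have n0 : (0 < n)%N by exact: leq_ltn_trans sv.
pose t : seq 'I_n := map (insubd (Ordinal n0)) v.
have st : size t == size v by rewrite size_map.
exists (existT (fun k : 'I_n => k.-tuple 'I_n) (Ordinal sv) (Tuple st)).
rewrite /boxval /= /t -map_comp -[RHS]map_id; apply/eq_in_map => i /(allP av) ? /=.
by rewrite val_insubd ifT.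
Qed.

Lemma size_boxval (b : Box n) : (size (boxval b) < n)%N.
Proof. by rewrite /boxval size_map size_tuple. Qed.

Lemma boxval_letter (b : Box n) i : i \in boxval b -> (i < n)%N.
Proof. by move/mapP => [j _ ->]. Qed.

Lemma pick_boxval (b : Box n) : [pick b' | boxval b' == boxval b] = Some b.
Proof.
case: pickP => [b' /eqP/boxval_inj -> //|/(_ b)]; by rewrite eqxx.
Qed.

End Boxes.

Definition xdeg (S : nat -> Type) (x : Xval S) : nat :=
  if x is XStr k _ then k else 0%N.

Definition tree_like (S : nat -> Type) (t : seq nat -> Xval S) : Prop :=
  t [::] <> XStar /\ forall v i, t (rcons v i) <> XStar <-> (0 < i)%N && allowsX (t v) i.

Section Encodings.
Variables (S : nat -> finType) (n : nat).
Implicit Type e : EBox S n.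

Definition xval_of_opt (o : option {k : 'I_n & S k}) : Xval S :=
  if o is Some p then XStr (tagged p) else XStar.

Definition opt_of_xval (y : Xval S) : option {k : 'I_n & S k} :=
  match y with
  | XStr k r => match @idP (k < n)%N with
     | ReflectT lt => Some (existT (fun k : 'I_n => S k) (Ordinal lt) r)
     | ReflectF _ => None
     end
  | _ => None
  end.

Lemma opt_of_xvalK k (r : S k) : (k < n)%N -> xval_of_opt (opt_of_xval (XStr r)) = XStr r.
Proof. by move=> kn; rewrite /opt_of_xval; case: {-}_ / idP => [lt //|]; rewrite kn. Qed.

Lemma xval_of_optK : cancel xval_of_opt opt_of_xval.
Proof.
move=> [[[k kn] r]|] //=.
by case: {-}_ / idP => [lt|]; rewrite ?kn // (bool_irrelevance lt kn).
Qed.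

Lemma xval_of_opt_inj : injective xval_of_opt.
Proof. exact: can_inj xval_of_optK. Qed.

Lemma ext_boxval e (b : Box n) : ext e (boxval b) = xval_of_opt (e b).
Proof. by rewrite /ext pick_boxval. Qed.

Lemma ext_out e v : ext e v <> XStar -> exists2 b : Box n, boxval b = v & e b <> None.
Proof.
rewrite /ext; case: pickP => // b /eqP bv.
by case eb : (e b) => [p|] // _; exists b => //; rewrite eb.
Qed.

Lemma ext_opt e v : xval_of_opt (opt_of_xval (ext e v)) = ext e v.
Proof.
have [p ->] : exists p, ext e v = xval_of_opt p; last by rewrite xval_of_optK.
by rewrite /ext; case: pickP => [b _|_]; [exists (e b) | exists None].
Qed.

Lemma ext_finite e v : ext e v <> XInfty.
Proof. by rewrite /ext; case: pickP => // b _; case: (e b). Qed.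

Lemma ext_inj e e' : ext e =1 ext e' -> e = e'.
Proof.
move=> ee'; apply/ffunP => b; apply: xval_of_opt_inj.
by rewrite -!ext_boxval ee'.
Qed.

Lemma tree_like_shape e : tree_like (ext e) <-> is_plane_tree (shape_ext (eshape e)).
Proof.
have H v : shape_ext (eshape e) v =
    if ext e v is XStr k _ then Some (Some k) else None.
  rewrite /shape_ext /ext; case: pickP => // b _; rewrite ffunE.
  by case: (e b).
have H0 v : shape_ext (eshape e) v <> None <-> ext e v <> XStar.
  by rewrite H; have := @ext_finite e v; case: (ext e v).
have H1 v i : allows (shape_ext (eshape e) v) i = allowsX (ext e v) i.
  by rewrite H; have := @ext_finite e v; case: (ext e v).
split=> -[t0 t1]; split; rewrite ?H0 //; try by apply/H0.
  by move=> v i; rewrite H0 H1.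
by move=> v i; rewrite -H1 -H0.
Qed.

End Encodings.

Section PartialTrees.
Variable S : nat -> finType.
Implicit Types (L : seq (seq nat)) (x t : seq nat -> Xval S).

(* A finite, prefix-closed set L of explored vertices; their children in x need not be
   explored, so L is an initial piece of many finite trees. *)
Definition partial_tree L x : Prop :=
  [/\ uniq L,
      (forall v, v \in L -> exists k (r : S k), x v = XStr r) &
      (forall v i, rcons v i \in L -> v \in L /\ (0 < i)%N && allowsX (x v) i)].

(** The root and all children of explored vertices. Those outside L are pending, and for a partial
    tree there are one plus the sum of the degrees minus the size of L of them. *)
Definition kids L x : seq (seq nat) :=
  [::] :: [seq rcons v i | v <- L, i <- iota 1 (xdeg (x v))].

Lemma mem_kids L x u : u \in kids L x ->
  u = [::] \/ exists v i, [/\ v \in L, (0 < i <= xdeg (x v))%N & u = rcons v i].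
Proof.
rewrite inE => /orP[/eqP ->|/allpairsPdep[v [i [vL iv ->]]]]; [by left | right].
by exists v, i; split => //; move: iv; rewrite mem_iota add1n ltnS.
Qed.

Lemma root_kids L x : [::] \in kids L x.
Proof. by rewrite inE eqxx. Qed.

Lemma rcons_kids L x v i : v \in L -> (0 < i <= xdeg (x v))%N -> rcons v i \in kids L x.
Proof.
move=> vL iv; rewrite inE; apply/orP; right; apply/allpairsPdep; exists v, i.
by split => //; rewrite mem_iota add1n ltnS.
Qed.

Lemma size_kids L x : size (kids L x) = (\sum_(v <- L) xdeg (x v)).+1.
Proof.
rewrite /= size_allpairs_dep sumnE big_map; congr _.+1.
by apply: eq_bigr => v _; rewrite size_iota.
Qed.

Lemma uniq_kids L x : uniq L -> uniq (kids L x).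
Proof.
move=> uL; rewrite /kids cons_uniq; apply/andP; split.
  apply/negP => /allpairsPdep[v [i [_ _]]] /(congr1 size).
  by rewrite size_rcons.
apply: allpairs_uniq_dep => // [v _|[v i] [v' i'] _ _ /=]; first exact: iota_uniq.
by move/rcons_inj => [-> ->].
Qed.

Lemma allowsX_xdeg (y : Xval S) k (r : S k) i : y = XStr r -> allowsX y i = (i <= xdeg y)%N.
Proof. by move=> ->. Qed.

Lemma partial_tree_sub_kids L x : partial_tree L x -> {subset L <= kids L x}.
Proof.
case=> _ xL cL v; case/lastP: v => [|v i] vL; first exact: root_kids.
have [vL' /andP[i0 iv]] := cL v i vL.
have [k [r xv]] := xL v vL'.
by apply: rcons_kids => //; rewrite i0 -(allowsX_xdeg _ xv).
Qed.

Lemma size_partial_tree L x : partial_tree L x ->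
  (size L <= (\sum_(v <- L) xdeg (x v)).+1)%N.
Proof.
move=> pL; rewrite -(size_kids L x); apply: uniq_leq_size; first by case: pL.
exact: partial_tree_sub_kids.
Qed.

Lemma kids_in_tree L x t : partial_tree L x -> tree_like t ->
  (forall v, v \in L -> t v = x v) -> forall u, u \in kids L x -> t u <> XStar.
Proof.
move=> [_ xL _] [t0 t1] tx u /mem_kids[->//|[v [i [vL /andP[i0 iv] ->]]]].
have [k [r xv]] := xL v vL.
by apply/t1; rewrite i0 tx // (allowsX_xdeg _ xv).
Qed.

Lemma tree_in_kids L x t : partial_tree L x -> tree_like t ->
  (forall v, v \in L -> t v = x v) -> {subset kids L x <= L} ->
  forall v, t v <> XStar -> v \in L.
Proof.
move=> [_ xL _] [t0 t1] tx kL; elim/last_ind => [_|v i IH]; first exact/kL/root_kids.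
move/t1 => /andP[i0 iv]; have tv : t v <> XStar by move=> E; rewrite E in iv.
have vL := IH tv; have [k [r xv]] := xL v vL.
by apply/kL/rcons_kids => //; rewrite i0 -(allowsX_xdeg _ xv) -tx.
Qed.

Lemma partial_tree_cons L x v k (r : S k) : partial_tree L x ->
  v \in kids L x -> v \notin L ->
  partial_tree (v :: L) (fun u => if u == v then XStr r else x u).
Proof.
move=> [uL xL cL] vk vL; split; first by rewrite cons_uniq vL.
  move=> u; rewrite inE => /orP[/eqP ->|uL']; first by exists k, r; rewrite eqxx.
  by case: eqP => [_|_]; [exists k, r | exact: xL].
have aux u i : u \in L /\ (0 < i)%N && allowsX (x u) i ->
    u \in v :: L /\ (0 < i)%N && allowsX (if u == v then XStr r else x u) i.
  move=> [uL' H]; split; first by rewrite inE uL' orbT.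
  by case: eqP => // E; move: vL; rewrite -E uL'.
move=> u i; rewrite inE => /orP[/eqP E|/cL]; last exact: aux.
apply: aux; move: vk; rewrite -E => /mem_kids[/(congr1 size)|]; first by rewrite size_rcons.
move=> [u' [i' [uL' ii' /rcons_inj[Eu Ei]]]]; rewrite Eu Ei.
have [k' [r' xu]] := xL u' uL'.
by rewrite uL' (allowsX_xdeg _ xu).
Qed.

(* Prefixes of an explored vertex are explored, hence depth, labels and degrees are
   bounded by the number of explored vertices. *)
Lemma partial_tree_prefix L x v m : partial_tree L x -> v \in L -> take m v \in L.
Proof.
move=> [_ _ cL]; elim/last_ind: v => [|v i IH] vL //.
have [vL' _] := cL v i vL.
rewrite -cats1 take_cat; case: ifP => _; first exact: IH.
by case: (m - size v)%N => [|k] /=; rewrite ?cats0 ?cats1.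
Qed.

Lemma partial_tree_depth L x v : partial_tree L x -> v \in L -> (size v < size L)%N.
Proof.
move=> pL vL; pose s := [seq take m v | m <- iota 0 (size v).+1].
have -> : (size v).+1 = size s by rewrite size_map size_iota.
apply: uniq_leq_size; last by move=> u /mapP[m _ ->]; apply: partial_tree_prefix pL vL.
rewrite map_inj_in_uniq ?iota_uniq // => m m'; rewrite !mem_iota !add0n !ltnS /= => mv mv'.
by move/(congr1 size); rewrite !size_take_min !(minn_idPl _).
Qed.

Lemma closed_tree_degree L x v : partial_tree L x -> {subset kids L x <= L} ->
  v \in L -> (xdeg (x v) < size L)%N.
Proof.
move=> pL kL vL; pose s := [::] :: [seq rcons v i | i <- iota 1 (xdeg (x v))].
have -> : (xdeg (x v)).+1 = size s by rewrite /= size_map size_iota.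
apply: uniq_leq_size.
  rewrite /s cons_uniq map_inj_uniq ?iota_uniq ?andbT; last by move=> i j /rcons_inj[].
  by apply/negP => /mapP[i _ /(congr1 size)]; rewrite size_rcons.
move=> u; rewrite inE => /orP[/eqP ->|/mapP[i]]; first exact/kL/root_kids.
by rewrite mem_iota add1n ltnS => iv ->; apply/kL/rcons_kids.
Qed.

Lemma closed_tree_letter L x v i : partial_tree L x -> {subset kids L x <= L} ->
  v \in L -> i \in v -> (i < size L)%N.
Proof.
move=> pL kL; elim/last_ind: v => [//|v j IH] vL.
have [_ xL cL] := pL; have [vL' /andP[_ jv]] := cL v j vL.
rewrite mem_rcons inE => /orP[/eqP ->|]; last exact: IH.
have [k [r xv]] := xL v vL'; move: jv; rewrite (allowsX_xdeg _ xv) => jv.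
exact: leq_ltn_trans jv (closed_tree_degree pL kL vL').
Qed.

End PartialTrees.

Lemma sum_some (R : nmodType) (T : finType) (F : option T -> R) :
  \sum_(o : option T | o != None) F o = \sum_(p : T) F (Some p).
Proof.
rewrite (reindex_omap Some (fun o => o)) /=; last by case.
by apply: eq_bigl => p; rewrite eqxx.
Qed.

Section WeightedCounting.
Variables (R : realType) (S : nat -> finType) (kappa : forall k, S k -> R).
Hypothesis kappa_ge0 : forall n (r : S n), 0 <= kappa r.

Definition str_weight (y : Xval S) : R :=
  if y is XStr k r then kappa r / (k`!)%:R else 1.

Definition tree_weight n (e : EBox S n) : R :=
  \prod_(b : Box n) str_weight (xval_of_opt (e b)).

Definition extends n (e : EBox S n) (L : seq (seq nat)) (x : seq nat -> Xval S) : bool :=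
  `[< forall v, v \in L -> ext e v = x v >].

Lemma str_weight_ge0 y : 0 <= str_weight y.
Proof. by case: y => //= k r; rewrite divr_ge0. Qed.

Lemma sum_str_weight k : \sum_(r : S k) str_weight (XStr r) = omega kappa k.
Proof. by rewrite /omega /wsum mulr_suml. Qed.

Lemma wsum_eq0 k (r : S k) : wsum kappa k = 0 -> kappa r = 0.
Proof.
move=> /eqP; rewrite psumr_eq0 // => /allP /(_ r); rewrite mem_index_enum => /(_ isT).
by move/eqP.
Qed.

Lemma omega_cond k (r : S k) :
  omega kappa k * (kappa r / wsum kappa k) = kappa r / (k`!)%:R.
Proof.
(* If size k has total weight 0, then so has every structure of that size, and both sides vanish
   with the convention that division by 0 gives 0. *)
rewrite /omega; have [w0|wn0] := eqVneq (wsum kappa k) 0.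
  by rewrite w0 mul0r mul0r wsum_eq0 // mul0r.
by field; rewrite wn0 andbT pnatr_eq0 -lt0n fact_gt0.
Qed.

Lemma omegaW_condW n (e : EBox S n) :
  omegaW kappa (eshape e) * condW kappa e = tree_weight e.
Proof.
rewrite /omegaW /condW /tree_weight -big_split /=; apply: eq_bigr => b _.
rewrite ffunE; case: (e b) => [p|] /=; last by rewrite mulr1.
exact: omega_cond.
Qed.

Lemma plane_tree_nE n (s : {ffun Box n -> option 'I_n}) :
  plane_tree_n s = `[< is_plane_tree (shape_ext s) >] && (#|[pred b | s b != None]| == n).
Proof.
rewrite /plane_tree_n; congr (_ && (_ == _)); apply: eq_card => b.
by rewrite inE; apply/idP/idP; rewrite in_setE.
Qed.

Lemma plane_tree_nP n (e : EBox S n) : plane_tree_n (eshape e) ->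
  tree_like (ext e) /\
  exists V : seq (seq nat), [/\ uniq V, size V = n & forall v, v \in V <-> ext e v <> XStar].
Proof.
rewrite plane_tree_nE => /andP[/asboolP/tree_like_shape te /eqP ne]; split => //.
exists [seq boxval b | b <- enum [pred b | eshape e b != None]]; split.
- by rewrite (map_inj_uniq (@boxval_inj n)) enum_uniq.
- by rewrite size_map -cardE ne.
move=> v; split.
  move=> /mapP[b]; rewrite mem_enum inE ffunE => eb ->; rewrite ext_boxval.
  by case: (e b) eb.
move=> /ext_out[b <- eb]; apply/mapP; exists b => //.
by rewrite mem_enum inE ffunE; case: (e b) eb.
Qed.

Lemma plane_open_lt n (e : EBox S n) L x v : partial_tree L x -> plane_tree_n (eshape e) ->
  extends e L x -> v \in kids L x -> v \notin L -> (size L < n)%N.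
Proof.
move=> pL /plane_tree_nP[te [V [uV sV VE]]] /asboolP eL vk vL.
rewrite -sV; apply: (@uniq_leq_size _ (v :: L)).
  by rewrite cons_uniq vL; case: pL.
have H := kids_in_tree pL te eL.
move=> u; rewrite inE => /orP[/eqP ->|uL]; apply/VE; apply: H => //.
exact: partial_tree_sub_kids.
Qed.

Lemma plane_closed_eq n (e : EBox S n) L x : partial_tree L x -> plane_tree_n (eshape e) ->
  extends e L x -> {subset kids L x <= L} -> size L = n.
Proof.
move=> pL /plane_tree_nP[te [V [uV sV VE]]] /asboolP eL kL.
have [uL _ _] := pL; rewrite -sV; apply/perm_size/uniq_perm => // v.
apply/idP/idP => vv; first by apply/VE/(kids_in_tree pL te eL)/partial_tree_sub_kids.
by move/VE: vv; exact: tree_in_kids pL te eL kL v.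
Qed.

(** L is contained in [kids L x], so comparing the two sizes decides whether the exploration is
    complete or some vertex is pending. *)
Lemma open_vertexP L (x : seq nat -> Xval S) : partial_tree L x ->
  ((\sum_(v <- L) xdeg (x v)).+1 = size L /\ {subset kids L x <= L}) \/
  ((size L < (\sum_(v <- L) xdeg (x v)).+1)%N /\ exists2 v, v \in kids L x & v \notin L).
Proof.
move=> pL; have [uL _ _] := pL.
have sub := partial_tree_sub_kids pL.
case: (boolP (all (mem L) (kids L x))) => [/allP kL|/allPn[v vk vL]]; [left|right].
  split=> //; rewrite -(size_kids L x); apply/perm_size/uniq_perm => //; first exact: uniq_kids.
  by move=> v; apply/idP/idP; [exact: kL | exact: sub].
split; last by exists v.
rewrite -(size_kids L x); apply: (@uniq_leq_size _ (v :: L)).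
  by rewrite cons_uniq uL andbT.
by move=> u; rewrite inE => /orP[/eqP ->//|]; exact: sub.
Qed.

Lemma tree_weight_ext n (e : EBox S n) L x : uniq L ->
  (forall v, v \in L -> exists k (r : S k), x v = XStr r) ->
  (forall v, v \in L -> ext e v = x v) -> (forall v, ext e v <> XStar -> v \in L) ->
  tree_weight e = \prod_(v <- L) str_weight (x v).
Proof.
move=> uL xL eL Le.
transitivity (\prod_(v <- L) str_weight (ext e v)); last first.
  by apply: eq_big_seq => v vL; rewrite eL.
have pL : perm_eq L [seq boxval b | b <- enum [pred b | e b != None]].
  apply: uniq_perm => //.
    by rewrite (map_inj_uniq (@boxval_inj n)) enum_uniq.
  move=> v; apply/idP/mapP => [vL|[b]].
    have [k [r xv]] := xL v vL.
    have /ext_out[b bv eb] : ext e v <> XStar by rewrite eL // xv.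
    by exists b => //; rewrite mem_enum inE; apply/eqP.
  rewrite mem_enum inE => eb ->; apply: Le; rewrite ext_boxval.
  by case: (e b) eb.
rewrite (perm_big _ pL) /= big_map big_enum_cond /= /tree_weight.
rewrite (bigID (fun b => e b != None)) /= [X in _ * X]big1 ?mulr1; last first.
  by move=> b; rewrite negbK => /eqP ->.
by apply: eq_big => [b|b _]; rewrite ?andbT ?ext_boxval.
Qed.

(** Without pending vertices exactly one enriched tree extends the pattern. Its depth, labels and
    degrees are below the number of its vertices, so it fits into the box. *)
Lemma closed_tree_sum n L x : partial_tree L x -> {subset kids L x <= L} -> size L = n ->
  \sum_(e : EBox S n | plane_tree_n (eshape e) && extends e L x) tree_weight e =
  \prod_(v <- L) str_weight (x v).
Proof.
move=> pL kL sL; have [uL xL cL] := pL.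
pose e0 : EBox S n := [ffun b => if boxval b \in L then opt_of_xval n (x (boxval b)) else None].
have e0L v : v \in L -> ext e0 v = x v.
  move=> vL; have [k [r xv]] := xL v vL.
  have [b bv] : exists b : Box n, boxval b = v.
    apply: boxval_onto; first by rewrite -sL (partial_tree_depth pL).
    by apply/allP => i iv; rewrite -sL; apply: closed_tree_letter pL kL vL iv.
  rewrite -bv ext_boxval ffunE bv vL xv opt_of_xvalK //.
  by have := closed_tree_degree pL kL vL; rewrite xv sL.
have Le0 v : ext e0 v <> XStar -> v \in L.
  move=> /ext_out[b <-]; rewrite ffunE; case: ifP => //.
have te0 : tree_like (ext e0).
  split; first by rewrite e0L; [have [k [r ->]] := xL _ (kL _ (root_kids L x)) | exact/kL/root_kids].
  move=> v i; split.
    move=> /Le0 /cL [vL]; by rewrite e0L.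
  move=> /andP[i0 iv]; have vL : v \in L by apply: Le0 => E; rewrite E in iv.
  have [k [r xv]] := xL v vL.
  have viL : rcons v i \in L.
    by apply/kL/rcons_kids => //; rewrite i0 -(allowsX_xdeg _ xv) -e0L.
  by have [k' [r' xvi]] := xL _ viL; rewrite e0L // xvi.
have ce0 : #|[pred b | eshape e0 b != None]| = n.
  rewrite -[RHS]sL cardE -(size_map (@boxval n)); apply/perm_size/uniq_perm => //.
    by rewrite (map_inj_uniq (@boxval_inj n)) enum_uniq.
  move=> v; apply/mapP/idP => [[b]|vL].
    rewrite mem_enum inE ffunE => eb ->; apply: Le0; rewrite ext_boxval.
    by case: (e0 b) eb.
  have [k [r xv]] := xL v vL.
  have /ext_out[b bv eb] : ext e0 v <> XStar by rewrite e0L // xv.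
  by exists b => //; rewrite mem_enum inE ffunE; case: (e0 b) eb.
have pe0 : plane_tree_n (eshape e0).
  by rewrite plane_tree_nE; apply/andP; split; [apply/asboolP/tree_like_shape | apply/eqP].
rewrite (big_pred1 e0); first exact: tree_weight_ext.
move=> e; apply/idP/eqP => [/andP[pe /asboolP eL]|->]; last by rewrite pe0; apply/asboolP.
have [te _] := plane_tree_nP pe.
apply: ext_inj => v; case: (boolP (v \in L)) => vL; first by rewrite eL // e0L.
have -> : ext e v = XStar.
  by apply: contrapT => H; move: vL; rewrite (tree_in_kids pL te eL kL H).
by apply/esym; apply: contrapT => /Le0 H; rewrite H in vL.
Qed.

(** Induction on the number of unexplored vertices, by exploring an arbitrary pending one. The order
    is immaterial since [forest] sees only how many vertices are pending. *)
Theorem partial_tree_sum n L x : partial_tree L x -> (size L <= n)%N ->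
  \sum_(e : EBox S n | plane_tree_n (eshape e) && extends e L x) tree_weight e =
  \prod_(v <- L) str_weight (x v) *
  forest (omega kappa) ((\sum_(v <- L) xdeg (x v)).+1 - size L) (n - size L).
Proof.
move Em : (n - size L)%N => m; elim: m L x Em => [|m IH] L x Em pL Ln.
  have sL : size L = n by lia.
  have [[-> kL]|[lt [v vk vL]]] := open_vertexP pL.
    by rewrite closed_tree_sum // subnn /= mulr1.
  rewrite [LHS]big_pred0 /=; last first.
    move=> e; apply/negP => /andP[pe eL].
    by have := plane_open_lt pL pe eL vk vL; rewrite sL ltnn.
  by rewrite subn_eq0 leqNgt lt mulr0.
have [[E kL]|[lt [v vk vL]]] := open_vertexP pL.
  rewrite E subnn /= mulr0 big_pred0 // => e; apply/negP => /andP[pe eL].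
  by have sL := plane_closed_eq pL pe eL kL; rewrite sL subnn in Em.
have n0 : (0 < n)%N by lia.
have [j jE] : exists j, ((\sum_(u <- L) xdeg (x u)).+1 - size L = j.+1)%N.
  by exists ((\sum_(u <- L) xdeg (x u)) - size L)%N; lia.
rewrite jE (@forestS _ _ j m n); last by lia.
pose x' k (r : S k) u := if u == v then XStr r else x u.
have xx' k (r : S k) u : u \in L -> x' k r u = x u.
  by rewrite /x'; case: eqP => // -> vL'; rewrite vL' in vL.
pose getv (e : EBox S n) : option {k : 'I_n & S k} := opt_of_xval n (ext e v).
(* The sum is split according to the structure at v, which is never absent because v is a child of
   an explored vertex or the root. *)
rewrite (partition_big getv (fun o => o != None)) /=; last first.
  move=> e /andP[pe /asboolP eL]; have [te _] := plane_tree_nP pe.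
  have := kids_in_tree pL te eL vk => /ext_out[b bv eb].
  rewrite /getv -bv ext_boxval; case: (e b) eb => // -[[k kn] r] _ /=.
  by case: {-}_ / idP => // -[].
rewrite sum_some mulr_sumr big_mkord.
rewrite -(sig_big_dep xpredT (fun _ _ => true) (fun (k : 'I_n) (r : S k) =>
   \sum_(e : EBox S n | plane_tree_n (eshape e) && extends e L x &&
       (getv e == Some (existT (fun k : 'I_n => S k) k r))) tree_weight e)) /=.
apply: eq_bigr => k _.
transitivity (\sum_(r : S k) str_weight (XStr r) *
   (\prod_(u <- L) str_weight (x u) * forest (omega kappa) (j + k) m)); last first.
  by rewrite -mulr_suml sum_str_weight; ring.
apply: eq_bigr => r _.
have pL' := partial_tree_cons r pL vk vL.
have H : \sum_(u <- v :: L) xdeg (x' k r u) = (k + \sum_(u <- L) xdeg (x u))%N.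
  rewrite big_cons {1}/x' eqxx /=; congr (_ + _)%N.
  by apply: eq_big_seq => u uL; rewrite xx'.
have := IH (v :: L) (x' k r) _ pL' _; rewrite H /= => IH'.
transitivity (\sum_(e : EBox S n | plane_tree_n (eshape e) && extends e (v :: L) (x' k r)) tree_weight e).
  apply: eq_bigl => e; rewrite -andbA; congr (_ && _); apply/idP/idP.
    move=> /andP[/asboolP eL /eqP gv]; apply/asboolP => u.
    rewrite inE => /orP[/eqP ->|uL]; last by rewrite xx' // eL.
    by rewrite /x' eqxx -[LHS]ext_opt -/(getv e) gv.
  move=> /asboolP eL; apply/andP; split.
    by apply/asboolP => u uL; rewrite eL ?xx' // inE uL orbT.
  apply/eqP; rewrite /getv eL ?inE ?eqxx // /x' eqxx.
  exact: (xval_of_optK (Some (existT (fun k : 'I_n => S k) k r))).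
rewrite IH' ?big_cons; [|lia|lia].
rewrite {1}/x' eqxx mulrA; congr (_ * forest _ _ _); last by lia.
by congr (_ * _); apply: eq_big_seq => u uL; rewrite xx'.
Qed.

Lemma sum_tree_weight_shape n (s : {ffun Box n -> option 'I_n}) :
  \sum_(e : EBox S n | eshape e == s) tree_weight e = omegaW kappa s.
Proof.
pose tg (p : {k : 'I_n & S k}) : 'I_n := tag p.
transitivity (\prod_(b : Box n) \sum_(p : option {k : 'I_n & S k} | omap tg p == s b)
   str_weight (xval_of_opt p)).
  rewrite bigA_distr_big_dep /=; apply: eq_bigl => e.
  apply/eqP/familyP => [<- b|H]; first by rewrite unfold_in /= ffunE.
  by apply/ffunP => b; have := H b; rewrite unfold_in ffunE => /eqP.
apply: eq_bigr => b _; case: (s b) => [k|]; last first.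
  by rewrite (big_pred1 None) // => -[p|].
rewrite -sum_str_weight.
rewrite (eq_bigl (fun p => (p != None) && (omap tg p == Some k))); last by case.
rewrite big_mkcondr sum_some /=.
rewrite -(sig_big_dep xpredT (fun _ _ => true) (fun (k' : 'I_n) (r : S k') =>
   if Some k' == Some k then str_weight (XStr r) else 0)) /=.
rewrite (bigD1 k) //= eqxx [X in _ + X]big1 ?addr0 // => k' k'k.
by rewrite big1 // => r _; case: eqP => // -[E]; rewrite E eqxx in k'k.
Qed.

Lemma Zn_sum n : Zn kappa n = \sum_(e : EBox S n | plane_tree_n (eshape e)) tree_weight e.
Proof.
rewrite /Zn (partition_big (@eshape S n) (@plane_tree_n n)) //=.
apply: eq_bigr => s ps; rewrite -sum_tree_weight_shape.
by apply: eq_bigl => e; apply/eqP/andP => [->|[_ /eqP]].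
Qed.

Lemma Zn_forest n : Zn kappa n = forest (omega kappa) 1 n.
Proof.
have p0 : partial_tree [::] (fun=> XStar : Xval S) by split.
have := partial_tree_sum p0 (leq0n n); rewrite !big_nil [size _]/= !subn0 mul1r => <-.
rewrite Zn_sum; apply: eq_bigl => e.
by rewrite (_ : extends _ _ _) ?andbT //; apply/asboolP.
Qed.

Lemma En_sum (f : (seq nat -> Xval S) -> R) n :
  En kappa f n =
  \sum_(e : EBox S n | plane_tree_n (eshape e)) tree_weight e / Zn kappa n * f (ext e).
Proof.
by apply: eq_bigr => e _; rewrite -omegaW_condW; congr (_ * _); rewrite mulrAC.
Qed.

Lemma tree_weight_ge0 n (e : EBox S n) : 0 <= tree_weight e.
Proof. by apply: prodr_ge0 => b _; exact: str_weight_ge0. Qed.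

End WeightedCounting.

(** * Limits of pattern probabilities *)

Lemma ratio_shift_cvg (R : realType) (i j : nat) :
  (n - i)%:R / (n - j)%:R @[n --> \oo] --> (1 : R).
Proof.
apply/cvgrPdist_le => e e0.
exists (i + j + Num.bound ((i + j)%:R / e) + 1)%N => // n /= nN.
set K := Num.bound _ in nN.
have Kn : (K <= n - j)%N by clear -nN; lia.
have nj0 : (0 < n - j)%N by clear -nN; lia.
have iN : (i <= n)%N by clear -nN; lia.
have jN : (j <= n)%N by clear -nN; lia.
have hK : (i + j)%:R / e < K%:R by apply: archi_boundP; rewrite divr_ge0 // ltW.
have nj : 0 < (n - j)%:R :> R by rewrite ltr0n.
rewrite -[X in `|X - _|](@divff _ ((n - j)%:R : R)) ?gt_eqF // -mulrBl.
rewrite normrM normfV [X in _ / X]ger0_norm ?(ltW nj) // ler_pdivrMr //.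
rewrite ltr_pdivrMr // in hK.
have h1 : (i + j)%:R <= e * (n - j)%:R.
  apply/ltW/(lt_le_trans hK); rewrite mulrC ler_wpM2l ?(ltW e0) // ler_nat //.
apply: le_trans h1; rewrite !natrB // natrD ler_norml.
have i0 : 0 <= i%:R :> R by []. have j0 : 0 <= j%:R :> R by [].
by apply/andP; split; lra.
Qed.

Section PatternLimits.
Variables (R : realType) (S : nat -> finType) (kappa : forall k, S k -> R).
Hypothesis kappa_ge0 : forall n (r : S n), 0 <= kappa r.
Hypothesis omega0 : 0 < omega kappa 0.
Hypothesis omega2 : exists k, (2 <= k)%N /\ 0 < omega kappa k.

Notation a := (omega kappa).
Notation u := (tau kappa).
Notation V := (phi kappa u).

Definition tree_filter : set_system nat := within [set n | 0 < Zn kappa n] \oo.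
Notation F := tree_filter.

Global Instance tree_filter_filter : Filter F.
Proof. exact: within_filter. Qed.

Definition pattern_prob n (L : seq (seq nat)) (x : seq nat -> Xval S) : R :=
  (\sum_(e : EBox S n | plane_tree_n (eshape e) && extends e L x) tree_weight kappa e) / Zn kappa n.

Definition str_prob (y : Xval S) : R :=
  if y is XStr k r then pi_ kappa k * (kappa r / wsum kappa k) else 1.

Lemma str_probE y : str_prob y = u ^+ xdeg y * str_weight kappa y / (if y is XStr _ _ then V else 1).
Proof.
case: y => [||k r] /=; rewrite ?expr0 ?mulr1 ?divr1 //.
by rewrite /pi_ -omega_cond //; ring.
Qed.

Let h := cpow_shift a.

Lemma Zn_cpow n : (0 < n)%N -> n%:R * Zn kappa n = h 0 0 n.
Proof.
move=> n0; rewrite Zn_forest forest_cpow // mul1r /h /cpow_shift !subn0.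
by rewrite subn1.
Qed.

Lemma cvg_tree_filter (g : nat -> R) (l : R) : g n @[n --> \oo] --> l -> g n @[n --> F] --> l.
Proof.
move=> gl Q HQ; have H : \forall n \near \oo, Q (g n) := gl Q HQ.
have H' : \forall n \near \oo, 0 < Zn kappa n -> Q (g n) by apply: filterS H.
exact: H'.
Qed.

Lemma cvg_tree_filter_cpow (g : nat -> R) (l : R) :
  g n @[n --> within [set n | 0 < h 0 0 n] \oo] --> l -> g n @[n --> F] --> l.
Proof.
move=> gl Q HQ; have H : \forall n \near \oo, 0 < h 0 0 n -> Q (g n) := gl Q HQ.
have n1 : \forall n \near \oo, (0 < n)%N by exists 1%N.
have H' : \forall n \near \oo, 0 < Zn kappa n -> Q (g n).
  apply: filterS2 H n1 => n Hn n0 Z0; apply: Hn.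
  by rewrite -Zn_cpow // mulr_gt0 // ltr0n.
exact: H'.
Qed.

Lemma near_tree_filter (Q : nat -> Prop) N :
  (forall n, (N <= n)%N -> 0 < Zn kappa n -> Q n) -> \forall n \near F, Q n.
Proof. by move=> HQ; exists N => // n /= Nn Zn0; exact: HQ. Qed.

Lemma shift_ratio_cvg D l (ds : seq nat) :
  (forall d, d \in ds -> 0 < a d) -> D = sumn ds -> l = size ds ->
  h D l n / h 0 0 n @[n --> F] --> u ^+ D / V ^+ l.
Proof.
move=> ds0 DE lE; apply: cvg_tree_filter_cpow.
have a0 := omega_ge0 kappa_ge0.
exact: (@cpow_ratio_cvg_sub R a u V a0 omega0 omega2 (tau_ge0 kappa_ge0 omega0 omega2)
  (Phi_tau_gt0 kappa_ge0 omega0 omega2) (Phi_tau_bound kappa_ge0 omega0 omega2)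
  (Phi_tau_opt kappa_ge0 omega0 omega2) (@Phi_tau0 _ _ kappa) D l ds).
Qed.

Lemma omega_gt0 k (r : S k) : 0 < str_weight kappa (XStr r) -> 0 < a k.
Proof.
move=> w0; apply: lt_le_trans w0 _; rewrite -sum_str_weight (bigD1 r) //= lerDl.
by apply: sumr_ge0 => r' _; rewrite divr_ge0.
Qed.

Lemma pattern_prob_forest n L x : partial_tree L x -> (size L <= n)%N ->
  pattern_prob n L x = \prod_(v <- L) str_weight kappa (x v) *
    forest a ((\sum_(v <- L) xdeg (x v)).+1 - size L) (n - size L) / Zn kappa n.
Proof. by move=> pL Ln; rewrite /pattern_prob partial_tree_sum. Qed.

(** The cycle lemma yields the factor K / (n - l) for the K pending vertices, and normalising by Zn
    contributes n. The K that survives counts the pending vertices through which the spine can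
    leave. *)
Lemma pattern_prob_cvg L x : partial_tree L x ->
  pattern_prob n L x @[n --> F] -->
  ((\sum_(v <- L) xdeg (x v)).+1 - size L)%:R * \prod_(v <- L) str_prob (x v).
Proof.
move=> pL; set D := (\sum_(v <- L) _)%N; set l := size L; set K := (D.+1 - l)%N.
have [uL xL _] := pL; have Dl := size_partial_tree pL; rewrite -/D -/l in Dl.
set W := \prod_(v <- L) str_weight kappa (x v).
have prodE : \prod_(v <- L) str_prob (x v) = W * (u ^+ D / V ^+ l).
  rewrite /W /D /l; have : {in L, forall v, exists k (r : S k), x v = XStr r} by [].
  elim: (L) => [|v L' IH] H; first by rewrite !big_nil expr0 divr1 mulr1.
  rewrite !big_cons /= IH; last by move=> w wL; apply: H; rewrite inE wL orbT.
  have [k [r xv]] := H v (mem_head _ _).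
  by rewrite str_probE xv /= exprD exprS invfM; ring.
rewrite prodE.
(* A degree of weight 0 in the pattern would rule out the ratio limit, but then the pattern itself
   has weight 0. *)
have [W0|Wn0] := eqVneq W 0.
  have H0 : (fun=> 0) n @[n --> F] --> (0 : R) by exact: cvg_cst.
  rewrite W0 mul0r mulr0; apply: (cvg_trans _ H0).
  apply: near_eq_cvg; apply: (@near_tree_filter _ l) => n ln _.
  by rewrite pattern_prob_forest // -/W W0 mul0r mul0r.
have aL d : d \in [seq xdeg (x v) | v <- L] -> 0 < a d.
  move=> /mapP[v vL ->]; have [k [r xv]] := xL v vL; rewrite xv /=.
  apply: (@omega_gt0 k r); rewrite -xv lt_neqAle str_weight_ge0 // andbT eq_sym.
  apply: contraNneq Wn0 => w0; rewrite /W prodf_seq_eq0.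
  by apply/hasP; exists v => //=; rewrite w0 eqxx.
have DE : D = sumn [seq xdeg (x v) | v <- L] by rewrite sumnE big_map.
have lE : l = size [seq xdeg (x v) | v <- L] by rewrite size_map.
have H1 := shift_ratio_cvg aL DE lE.
have H2 := cvg_tree_filter (@ratio_shift_cvg R 0 l).
have H3 : (W * K%:R) * ((n - 0)%:R / (n - l)%:R * (h D l n / h 0 0 n)) @[n --> F] -->
   (W * K%:R) * (1 * (u ^+ D / V ^+ l)).
  by apply: cvgMr; apply: cvgM.
rewrite mul1r in H3; rewrite mulrCA mulrA; apply: (cvg_trans _ H3).
apply: near_eq_cvg; apply: (@near_tree_filter _ (l + D).+2) => n nN Z0.
have n0 : (0 < n)%N by lia.
have nl0 : (0 < n - l)%N by lia.
rewrite pattern_prob_forest //; last by rewrite -/l; lia.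
rewrite -/W -/D -/l -/K -Zn_cpow //.
have Hf := @forest_cpow _ a K (n - l) nl0.
have -> : h D l n = cpow a (n - l) (n - l - K).
  by rewrite /h /cpow_shift; congr (cpow _ _ _); rewrite /K; lia.
have nlR : (n - l)%:R != 0 :> R by rewrite pnatr_eq0 -lt0n.
have nR : n%:R != 0 :> R by rewrite pnatr_eq0 -lt0n.
have -> : W * K%:R * ((n - 0)%:R / (n - l)%:R * (cpow a (n - l) (n - l - K) / (n%:R * Zn kappa n))) =
  W * (K%:R * cpow a (n - l) (n - l - K)) / (n - l)%:R / Zn kappa n.
  by rewrite subn0; field; rewrite ?nR ?nlR ?(gt_eqF Z0).
rewrite -Hf; last by rewrite /K; lia.
by field; rewrite ?nlR ?(gt_eqF Z0).
Qed.

Definition set_str (x : seq nat -> Xval S) (v : seq nat) k (r : S k) : seq nat -> Xval S :=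
  fun u => if u == v then XStr r else x u.

Lemma pattern_prob_ge0 n L x : 0 <= pattern_prob n L x.
Proof.
apply: divr_ge0; first by apply: sumr_ge0 => e _; exact: tree_weight_ge0.
by rewrite Zn_sum //; apply: sumr_ge0 => e _; exact: tree_weight_ge0.
Qed.

(** The pi_K sum to 1, so c cancels; the K pi_K sum to mu. *)
Lemma size_biased_prob_cvg (c : R) :
  (1 + c) - \sum_(0 <= K < M) (K%:R + c) * (u ^+ K * a K / V) @[M --> \oo] --> 1 - mu kappa.
Proof.
have V0 := Phi_tau_gt0 kappa_ge0 omega0 omega2.
have h1 : V^-1 * series (fun K => K%:R * a K * u ^+ K) M @[M --> \oo] -->
    V^-1 * (mu kappa * V).
  by apply: cvgMr; exact: size_biased_tau_cvg.
have h2 : (c / V) * series (fun K => a K * u ^+ K) M @[M --> \oo] --> (c / V) * V.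
  by apply: cvgMr; exact: Phi_tau_cvg.
have h3 : (1 + c) - (V^-1 * series (fun K => K%:R * a K * u ^+ K) M +
     (c / V) * series (fun K => a K * u ^+ K) M) @[M --> \oo] -->
     (1 + c) - (V^-1 * (mu kappa * V) + (c / V) * V).
  by apply: cvgB; [exact: cvg_cst | exact: cvgD].
have -> : 1 - mu kappa = (1 + c) - (V^-1 * (mu kappa * V) + (c / V) * V).
  by field; rewrite gt_eqF.
apply: (cvg_trans _ h3); apply: near_eq_cvg; apply: nearW => M.
rewrite !seriesEnat /= !mulr_sumr -big_split /=; congr (_ - _).
by apply: eq_bigr => K _; ring.
Qed.

(** * Patterns with a vertex of large degree *)

Section InfiniteVertex.
Variables (L : seq (seq nat)) (v0 : seq nat) (x : seq nat -> Xval S) (M0 : nat).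
(** M0 is large enough for the labels of explored children of [v0], so any degree from M0 on can be
    placed there. *)
Hypothesis x_partial : forall K (r : S K), (M0 <= K)%N -> partial_tree (v0 :: L) (set_str x v0 r).
Hypothesis x_fin : forall v, v \in L -> exists k (r : S k), x v = XStr r.
Hypothesis v0L : v0 \notin L.

Let W := \prod_(v <- L) str_weight kappa (x v).
Let D := (\sum_(v <- L) xdeg (x v))%N.
Let l := size L.
(** With degree K at [v0] the number of pending vertices is K + c. *)
Let c : R := D%:R - l%:R.

Definition big_degree_prob M n : R :=
  \sum_(M <= K < n) \sum_(r : S K) pattern_prob n (v0 :: L) (set_str x v0 r).

(** The guard excludes the negative indices that truncated subtraction would send to 0. *)
Let G n K : R := if (K <= n.-1 - D)%N then cpow a (n - l.+1) (n.-1 - D - K) else 0.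

Lemma big_degree_term K n : (M0 <= K)%N -> (D + l + 1 < n)%N -> 0 < Zn kappa n ->
  \sum_(r : S K) pattern_prob n (v0 :: L) (set_str x v0 r) =
  W / ((n - l.+1)%:R * Zn kappa n) * (a K * ((K%:R + c) * G n K)).
Proof.
move=> MK nN Z0.
have nl0 : (0 < n - l.+1)%N by lia.
have nlR : (n - l.+1)%:R != 0 :> R by rewrite pnatr_eq0 -lt0n.
have xx' (r : S K) v : v \in L -> set_str x v0 r v = x v.
  by move=> vL; rewrite /set_str; case: eqP => // E; move: v0L; rewrite -E vL.
have term (r : S K) : pattern_prob n (v0 :: L) (set_str x v0 r) =
    str_weight kappa (XStr r) * (W / ((n - l.+1)%:R * Zn kappa n) * ((K%:R + c) * G n K)).
  have pL := x_partial r MK.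
  have DK : (\sum_(v <- v0 :: L) xdeg (set_str x v0 r v) = K + D)%N.
    rewrite big_cons {1}/set_str eqxx /=; congr (_ + _)%N.
    by apply: eq_big_seq => v vL; rewrite xx'.
  have := size_partial_tree pL; rewrite DK /= -/l => lK.
  rewrite pattern_prob_forest // /= -/l; last by lia.
  rewrite DK big_cons {1}/set_str eqxx.
  have -> : \prod_(v <- L) str_weight kappa (set_str x v0 r v) = W.
    by apply: eq_big_seq => v vL; rewrite xx'.
  have cE : K%:R + c = ((K + D).+1 - l.+1)%:R.
    by rewrite subSS natrB // natrD /c addrA.
  have -> : forest a ((K + D).+1 - l.+1) (n - l.+1) = (K%:R + c) * G n K / (n - l.+1)%:R.
    apply: (mulfI nlR); rewrite mulrCA divff // mulr1 cE /G.
    case: leqP => Km.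
      by rewrite forest_cpow //; [congr (_ * cpow _ _ _); lia | lia].
    by rewrite forest_gt ?mulr0 //; lia.
  rewrite -/(str_weight kappa (XStr r)); move: (str_weight _ (XStr r)) => w.
  by field; rewrite ?nlR ?(gt_eqF Z0).
under eq_bigr do rewrite term.
by rewrite -mulr_suml sum_str_weight; ring.
Qed.

Lemma big_degree_probE M n : (M0 <= M)%N -> (M + D + l + 1 < n)%N -> 0 < Zn kappa n ->
  big_degree_prob M n = W * (((n - 0)%:R / (n - l.+1)%:R) *
   (((n - D.+1)%:R / (n - l)%:R + c) * (h D l n / h 0 0 n) -
    \sum_(0 <= K < M) (K%:R + c) * (a K * (h (K + D) l.+1 n / h 0 0 n)))).
Proof.
move=> MM nN Z0; set m := (n.-1 - D)%N.
have nR : n%:R != 0 :> R by rewrite pnatr_eq0 -lt0n; lia.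
have nlR : (n - l.+1)%:R != 0 :> R by rewrite pnatr_eq0 -lt0n; lia.
have nlR' : (n - l)%:R != 0 :> R by rewrite pnatr_eq0 -lt0n; lia.
have nlE : (n - l = (n - l.+1).+1)%N by lia.
have Zh : h 0 0 n = n%:R * Zn kappa n by rewrite Zn_cpow //; lia.
have mE : (n - D.+1 = m)%N by rewrite /m; lia.
have mn : (m.+1 <= n)%N by rewrite /m; lia.
have Mm : (M <= m.+1)%N by rewrite /m; lia.
have nN' : (D + l + 1 < n)%N by lia.
have step1 : big_degree_prob M n = W / ((n - l.+1)%:R * Zn kappa n) *
    \sum_(M <= K < m.+1) a K * ((K%:R + c) * G n K).
  rewrite /big_degree_prob big_nat_cond.
  under eq_bigr => K /andP[/andP[MK _] _] do
    rewrite (big_degree_term (leq_trans MM MK) nN' Z0).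
  rewrite -big_nat_cond -mulr_sumr (big_cat_nat (n := m.+1)) //=.
  rewrite [X in _ + X]big_nat_cond [X in _ + X]big1 ?addr0 // => K /andP[/andP[mK _] _].
  by rewrite /G leqNgt -/m mK mulr0 mulr0.
have GE K : (K <= m)%N -> G n K = cpow a (n - l.+1) (m - K).
  by move=> Km; rewrite /G Km.
have total : \sum_(0 <= K < m.+1) a K * ((K%:R + c) * G n K) =
    (m%:R / (n - l)%:R + c) * h D l n.
  have -> : h D l n = cpow a (n - l.+1).+1 m by rewrite /h /cpow_shift nlE.
  have sb := cpow_size_bias a (n - l.+1) m; rewrite -nlE in sb *.
  transitivity (\sum_(0 <= K < m.+1) K%:R * a K * cpow a (n - l.+1) (m - K) +
      c * \sum_(0 <= K < m.+1) a K * cpow a (n - l.+1) (m - K)).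
    rewrite mulr_sumr -big_split /= big_nat_cond [RHS]big_nat_cond.
    by apply: eq_bigr => K /andP[/andP[_ Km] _]; rewrite GE //; ring.
  rewrite -cpowS -nlE [RHS]mulrDl; congr (_ + _); apply: (mulfI nlR').
  by rewrite sb; field.
have part : \sum_(0 <= K < M) a K * ((K%:R + c) * G n K) =
    \sum_(0 <= K < M) (K%:R + c) * (a K * h (K + D) l.+1 n).
  rewrite big_nat_cond [RHS]big_nat_cond; apply: eq_bigr => K /andP[/andP[_ KM] _].
  rewrite GE; last by (clear -KM Mm; lia).
  rewrite (_ : h _ _ _ = cpow a (n - l.+1) (m - K)); first by ring.
  by rewrite /h /cpow_shift /m addnC subnDA.
have split_sum : \sum_(M <= K < m.+1) a K * ((K%:R + c) * G n K) =
   (m%:R / (n - l)%:R + c) * h D l n - \sum_(0 <= K < M) (K%:R + c) * (a K * h (K + D) l.+1 n).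
  by rewrite -total -part [X in _ = X - _](big_cat_nat (n := M)) //= addrAC subrr add0r.
rewrite step1 split_sum subn0 mE.
have -> : \sum_(0 <= K < M) (K%:R + c) * (a K * (h (K + D) l.+1 n / h 0 0 n)) =
    (\sum_(0 <= K < M) (K%:R + c) * (a K * h (K + D) l.+1 n)) / h 0 0 n.
  by rewrite mulr_suml; apply: eq_bigr => K _; ring.
by rewrite Zh; field; rewrite ?nlR ?nlR' ?nR ?(gt_eqF Z0).
Qed.

Lemma big_degree_prob_cvg M : (M0 <= M)%N ->
  big_degree_prob M n @[n --> F] -->
  \prod_(v <- L) str_prob (x v) *
    ((1 + c) - \sum_(0 <= K < M) (K%:R + c) * (u ^+ K * a K / V)).
Proof.
move=> MM.
have prodE : \prod_(v <- L) str_prob (x v) = W * (u ^+ D / V ^+ l).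
  rewrite /W /D /l; elim: (L) x_fin => [|v L' IH] H; first by rewrite !big_nil expr0 divr1 mulr1.
  rewrite !big_cons /= IH; last by move=> w wL; apply: H; rewrite inE wL orbT.
  have [k [r xv]] := H v (mem_head _ _).
  by rewrite str_probE xv /= exprD exprS invfM; ring.
rewrite prodE.
have [W0|Wn0] := eqVneq W 0.
  have H0 : (fun=> 0) n @[n --> F] --> (0 : R) by exact: cvg_cst.
  rewrite W0 mul0r mul0r; apply: (cvg_trans _ H0).
  apply: near_eq_cvg; apply: (@near_tree_filter _ (M + D + l + 1).+1) => n ln Z0.
  by rewrite big_degree_probE // W0 mul0r.
have aL d : d \in [seq xdeg (x v) | v <- L] -> 0 < a d.
  move=> /mapP[v vL ->]; have [k [r xv]] := x_fin vL; rewrite xv /=.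
  apply: (@omega_gt0 k r); rewrite -xv lt_neqAle str_weight_ge0 // andbT eq_sym.
  apply: contraNneq Wn0 => w0; rewrite /W prodf_seq_eq0.
  by apply/hasP; exists v => //=; rewrite w0 eqxx.
have DE : D = sumn [seq xdeg (x v) | v <- L] by rewrite sumnE big_map.
have lE : l = size [seq xdeg (x v) | v <- L] by rewrite size_map.
have H1 := shift_ratio_cvg aL DE lE.
have HK K : a K * (h (K + D) l.+1 n / h 0 0 n) @[n --> F] -->
    a K * (u ^+ (K + D) / V ^+ l.+1).
  have [aK0|aKn0] := eqVneq (a K) 0.
    by rewrite aK0 mul0r; under eq_fun do rewrite mul0r; exact: cvg_cst.
  apply: cvgMr; apply: (@shift_ratio_cvg _ _ (K :: [seq xdeg (x v) | v <- L])).
  - move=> d; rewrite inE => /orP[/eqP ->|]; last exact: aL.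
    by rewrite lt_neqAle eq_sym aKn0 omega_ge0.
  - by rewrite /= -DE.
  - by rewrite /= -lE.
have Hsum : \sum_(0 <= K < M) (K%:R + c) * (a K * (h (K + D) l.+1 n / h 0 0 n)) @[n --> F] -->
   \sum_(0 <= K < M) (K%:R + c) * (a K * (u ^+ (K + D) / V ^+ l.+1)).
  elim: (M) => [|N IH].
    by rewrite big_nil; under eq_fun do rewrite big_nil; exact: cvg_cst.
  rewrite big_nat_recr //=; under eq_fun do rewrite big_nat_recr //=.
  by apply: cvgD => //; apply: cvgMr.
have H2 := cvg_tree_filter (@ratio_shift_cvg R 0 l.+1).
have H3 := cvg_tree_filter (@ratio_shift_cvg R D.+1 l).
have H4 : W * (((n - 0)%:R / (n - l.+1)%:R) *
   (((n - D.+1)%:R / (n - l)%:R + c) * (h D l n / h 0 0 n) -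
    \sum_(0 <= K < M) (K%:R + c) * (a K * (h (K + D) l.+1 n / h 0 0 n)))) @[n --> F] -->
  W * (1 * ((1 + c) * (u ^+ D / V ^+ l) -
     \sum_(0 <= K < M) (K%:R + c) * (a K * (u ^+ (K + D) / V ^+ l.+1)))).
  apply: cvgMr; apply: cvgM => //; apply: cvgB => //; apply: cvgM => //.
  by apply: cvgD => //; exact: cvg_cst.
have -> : W * (u ^+ D / V ^+ l) *
    ((1 + c) - \sum_(0 <= K < M) (K%:R + c) * (u ^+ K * a K / V)) =
  W * (1 * ((1 + c) * (u ^+ D / V ^+ l) -
     \sum_(0 <= K < M) (K%:R + c) * (a K * (u ^+ (K + D) / V ^+ l.+1)))).
  rewrite -mulrA; congr (W * _); rewrite mul1r mulrBr mulrC; congr (_ - _).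
  rewrite mulr_sumr; apply: eq_bigr => K _.
  by rewrite exprD exprS invfM; ring.
apply: (cvg_trans _ H4); apply: near_eq_cvg.
apply: (@near_tree_filter _ (M + D + l + 1).+1) => n ln Z0.
by rewrite big_degree_probE.
Qed.

(** The limit for the given M need not be close to this bound. Raising M to a large M' only
    decreases the probability, and the limit for M' is within delta / 2 of the bound. *)
Lemma big_degree_prob_liminf M (delta : R) : (M0 <= M)%N -> 0 < delta ->
  \forall n \near F,
    \prod_(v <- L) str_prob (x v) * (1 - mu kappa) - delta <= big_degree_prob M n.
Proof.
move=> MM delta0; set q := \prod_(v <- L) _.
have H1 : q * ((1 + c) - \sum_(0 <= K < M) (K%:R + c) * (u ^+ K * a K / V)) @[M --> \oo] -->
    q * (1 - mu kappa) by apply: cvgMr; exact: size_biased_prob_cvg.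
have d2 : 0 < delta / 2 by rewrite divr_gt0.
have [N _ HN] : \forall M \near \oo, `|q * (1 - mu kappa) -
   q * ((1 + c) - \sum_(0 <= K < M) (K%:R + c) * (u ^+ K * a K / V))| <= delta / 2.
  by move/cvgrPdist_le : H1 => /(_ _ d2).
pose M' := maxn M N.
have := HN M' (leq_maxr _ _); rewrite /= => /ler_normlP[_ hM'].
have MM' : (M0 <= M')%N by apply: leq_trans MM (leq_maxl _ _).
have := big_degree_prob_cvg MM'; rewrite -/q => /cvgrPdist_le /(_ _ d2) H2.
have H3 : \forall n \near F, big_degree_prob M' n <= big_degree_prob M n.
  apply: (@near_tree_filter _ M') => n nM _.
  rewrite /big_degree_prob [leRHS](big_cat_nat (n := M')) ?leq_maxl //=.
  rewrite lerDr; apply: sumr_ge0 => K _; apply: sumr_ge0 => r _; exact: pattern_prob_ge0.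
apply: filterS2 H2 H3 => n /ler_normlP[_ h2] h3.
by apply: le_trans h3; move: h2 hM'; lra.
Qed.

End InfiniteVertex.

End PatternLimits.

(** * The law of the limit tree *)

Section Spine.
Variables (S : nat -> finType) (z : seq nat * bool -> Xval S * nat).

Notation status := (status_aux z [::] true).

Lemma status_aux_rcons pre b v i :
  status_aux z pre b (rcons v i) =
  if status_aux z pre b v is Some b' then
    let p := z (pre ++ v, b') in
    if (0 < i)%N && allowsX p.1 i then Some (b' && (i == p.2)) else None
  else None.
Proof.
elim: v pre b => [|j v IH] pre b /=; first by rewrite cats0.
by case: ifP => // _; rewrite IH cat_rcons.
Qed.

Lemma status_rcons v i : status (rcons v i) =
  if status v is Some b' then
    let p := z (v, b') in
    if (0 < i)%N && allowsX p.1 i then Some (b' && (i == p.2)) else None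
  else None.
Proof. exact: status_aux_rcons. Qed.

Lemma hat_beta_status v b : status v = Some b -> hat_beta z v = (z (v, b)).1.
Proof. by rewrite /hat_beta => ->. Qed.

Lemma hat_beta_None v : status v = None -> hat_beta z v = XStar.
Proof. by rewrite /hat_beta => ->. Qed.

Lemma special_prefix v w : status (v ++ w) = Some true -> status v = Some true.
Proof.
elim/last_ind: w => [|w i IH]; first by rewrite cats0.
rewrite -rcons_cat status_rcons; case: (status (v ++ w)) IH => // b IH.
by rewrite /=; case: ifP => // _ [/andP[bT _]]; apply: IH; rewrite bT.
Qed.

Lemma special_unique v w : size v = size w ->
  status v = Some true -> status w = Some true -> v = w.
Proof.
elim/last_ind: v w => [|v i IH] w; first by move/esym/size0nil.
case/lastP: w => [|w j]; first by rewrite size_rcons.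
rewrite !size_rcons => -[vw]; rewrite !status_rcons.
case Ev : (status v) => [b|//]; case Ew : (status w) => [b'|//] /=.
case: ifP => // _ [/andP[bT /eqP ->]]; case: ifP => // _ [/andP[bT' /eqP ->]].
rewrite bT in Ev *; rewrite bT' in Ew *.
by rewrite (IH w vw Ev Ew).
Qed.

Lemma special_comparable v e : (size v <= size e)%N ->
  status v = Some true -> status e = Some true -> prefix v e.
Proof.
move=> ve sv se; have se' : status (take (size v) e) = Some true.
  by apply: (@special_prefix _ (drop (size v) e)); rewrite cat_take_drop.
rewrite (@special_unique v (take (size v) e)) //; first exact: prefix_take.
by rewrite size_take_min (minn_idPl ve).
Qed.

Lemma special_step v i : status (rcons v i) = Some true ->
  status v = Some true /\ i = (z (v, true)).2.
Proof.
rewrite status_rcons; case: (status v) => // b /=; case: ifP => // _ [/andP[bT /eqP ->]].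
by rewrite bT.
Qed.

(* The almost sure range of the vertex data. *)
Definition typical_at (v : seq nat) : Prop :=
  (exists k (r : S k), z (v, false) = (XStr r, 0%N)) /\
  ((exists k (r : S k) j, (1 <= j <= k)%N /\ z (v, true) = (XStr r, j)) \/
   z (v, true) = (XInfty, 0%N)).

(* The second component of the datum of v when the spine runs from the root to e. *)
Definition spine_label (e v : seq nat) : nat :=
  if prefix v e then nth 0%N e (size v) else 0%N.

Lemma typical_nstar v b : typical_at v -> (z (v, b)).1 <> XStar.
Proof.
move=> [[k [r E]] H]; case: b; last by rewrite E.
by case: H => [[k' [r' [j [_ ->]]]]|->].
Qed.

Variables (L : seq (seq nat)).
Hypothesis L_root : [::] \in L.
Hypothesis L_typical : forall v, v \in L -> typical_at v.
Hypothesis L_in : forall v, v \in L -> status v <> None.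

(* The spine followed from the root leaves L through its end e, or stops in L
   at a vertex of infinite degree. *)
Lemma spine_end : exists e, [/\ status e = Some true,
   (e \notin L /\ exists v k (r : S k) j,
        [/\ v \in L, hat_beta z v = XStr r, (1 <= j <= k)%N & e = rcons v j]) \/
   (e \in L /\ hat_beta z e = XInfty) &
   forall v, v \in L -> z (v, prefix v e) = (hat_beta z v, spine_label e v)].
Proof.
(* The spine is followed down to the deepest special vertex of L; the root is one, and L is
   finite. *)
pose sp v := (v \in L) && (status v == Some true).
have exm : exists m, has (fun v => sp v && (size v == m)) L.
  exists 0%N; apply/hasP; exists [::] => //.
  by rewrite /sp L_root /= eqxx.
have bnd m : has (fun v => sp v && (size v == m)) L -> (m <= \max_(v <- L) size v)%N.
  move=> /hasP[v vL /andP[_ /eqP <-]]; exact: leq_bigmax_seq.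
case: (ex_maxnP exm bnd) => m /hasP[v vL /andP[/andP[_ /eqP sv] /eqP vm]] mmax.
have spmax u : u \in L -> status u = Some true -> (size u <= size v)%N.
  move=> uL su; rewrite vm; apply: mmax; apply/hasP; exists u => //.
  by rewrite /sp uL su !eqxx.
have hv := hat_beta_status sv.
(* For any special e at least as deep as v, the special vertices of L are exactly its prefixes in L,
   which tells which datum each vertex of L uses and where the spine continues. *)
have gen e : status e = Some true -> (size v <= size e)%N ->
    (e \in L -> z (e, true) = (hat_beta z e, 0%N)) ->
    forall u, u \in L -> z (u, prefix u e) = (hat_beta z u, spine_label e u).
  move=> se ve eL u uL.
  have [b sb] : exists b, status u = Some b.
    by case E : (status u) => [b|]; [exists b | case: (L_in uL)].
  have -> : prefix u e = b.
    apply/idP/idP => [|bt].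
      case/prefixP => w ew; rewrite ew in se.
      by move: (special_prefix se); rewrite sb => -[].
    rewrite bt in sb; apply: special_comparable => //.
    exact: leq_trans (spmax u uL sb) ve.
  rewrite (hat_beta_status sb) /spine_label.
  case: b sb => sb; last first.
    rewrite ifF; last first.
      by apply/negP => /prefixP[w ew]; rewrite ew in se; move: (special_prefix se); rewrite sb.
    by have [[k [r ->]]] := L_typical uL.
  have pue : prefix u e by apply: special_comparable => //; exact: leq_trans (spmax u uL sb) ve.
  rewrite pue; case/prefixP: pue => w ew.
  case: w ew => [|i w] ew; rewrite ew.
    rewrite cats0 nth_default //; rewrite cats0 in ew; rewrite -ew eL //; last by rewrite ew.
  rewrite nth_cat ltnn subnn /=.
  have : status (rcons u i) = Some true.
    by apply: (@special_prefix _ w); rewrite cat_rcons -ew.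
  by move=> /special_step[_ ->]; case: (z (u, true)).
have [_ [[k [r [j [jk zv]]]]|zv]] := L_typical vL.
  have se : status (rcons v j) = Some true.
    rewrite status_rcons sv zv /=; move/andP: jk => [-> ->] /=.
    by rewrite eqxx.
  have eL : rcons v j \notin L.
    by apply/negP => eL; have := spmax _ eL se; rewrite size_rcons ltnn.
  exists (rcons v j); split => //.
    by left; split => //; exists v, k, r, j; split => //; rewrite hv zv.
  by apply: gen; rewrite ?size_rcons // (negbTE eL).
exists v; split => //; first by right; split => //; rewrite hv zv.
by apply: gen => // _; rewrite hv zv.
Qed.

End Spine.

(** * Measurability and almost sure values of the vertex data *)

Section DiscreteProbability.
Variables (R : realType) (d : measure_display) (Omega : measurableType d).
Variable (P : probability Omega R).

Definition pr (A : set Omega) : R := fine (P A).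

Lemma prE A : measurable A -> P A = (pr A)%:E.
Proof. by move=> mA; rewrite /pr fineK // fin_num_measure. Qed.

Lemma pr_ge0 A : 0 <= pr A.
Proof. by rewrite /pr fine_ge0. Qed.

Lemma pr_le A B : measurable A -> measurable B -> A `<=` B -> pr A <= pr B.
Proof.
by move=> mA mB AB; rewrite -lee_fin -!prE //; apply: le_measure => //; rewrite inE.
Qed.

Lemma prU A B : measurable A -> measurable B -> A `&` B = set0 ->
  pr (A `|` B) = pr A + pr B.
Proof.
move=> mA mB AB; apply: EFin_inj; rewrite -prE; last exact: measurableU.
by rewrite EFinD -!prE // -measureU.
Qed.

Lemma prU_le A B : measurable A -> measurable B -> pr (A `|` B) <= pr A + pr B.
Proof.
move=> mA mB; rewrite -lee_fin -prE; last exact: measurableU.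
by rewrite EFinD -!prE // measureU2.
Qed.

Lemma prC A : measurable A -> pr (~` A) = 1 - pr A.
Proof.
move=> mA; have := prU mA (measurableC mA) (setICr A).
by rewrite setUv {1}/pr probability_setT /= => ->; ring.
Qed.

Lemma pr_le1 A : measurable A -> pr A <= 1.
Proof. by move=> mA; have := pr_ge0 (~` A); rewrite prC // subr_ge0. Qed.

Lemma measurable_bigU (I : Type) (s : seq I) (F : I -> set Omega) :
  (forall i, measurable (F i)) -> measurable (\big[setU/set0]_(i <- s) F i).
Proof.
move=> mF; elim: s => [|i s IH]; first by rewrite big_nil.
by rewrite big_cons; exact: measurableU.
Qed.

Lemma bigUP (I : eqType) (s : seq I) (F : I -> set Omega) w :
  (\big[setU/set0]_(i <- s) F i) w <-> exists2 i, i \in s & F i w.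
Proof.
elim: s => [|i s IH]; first by rewrite big_nil; split => // -[].
rewrite big_cons; split => [[Fi|/IH[j js Fj]]|[j]].
- by exists i; rewrite ?mem_head.
- by exists j => //; rewrite inE js orbT.
by rewrite inE => /orP[/eqP ->|js] Fj; [left | right; apply/IH; exists j].
Qed.

Lemma pr_bigU (I : eqType) (s : seq I) (F : I -> set Omega) : uniq s ->
  (forall i, measurable (F i)) -> (forall i j w, F i w -> F j w -> i = j) ->
  pr (\big[setU/set0]_(i <- s) F i) = \sum_(i <- s) pr (F i).
Proof.
move=> us mF dF; elim: s us => [|i s IH] /=; first by rewrite !big_nil /pr measure0.
move=> /andP[is_ us]; rewrite !big_cons prU ?IH //; first exact: measurable_bigU.
rewrite -subset0 => w [Fi /bigUP[j js Fj]].
by move: is_; rewrite (dF _ _ _ Fi Fj) js.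
Qed.

Lemma pr_bigU_le (I : Type) (s : seq I) (F : I -> set Omega) :
  (forall i, measurable (F i)) ->
  pr (\big[setU/set0]_(i <- s) F i) <= \sum_(i <- s) pr (F i).
Proof.
move=> mF; elim: s => [|i s IH]; first by rewrite !big_nil /pr measure0.
rewrite !big_cons; apply: le_trans (prU_le _ (measurable_bigU s mF)) _ => //.
by rewrite lerD2l.
Qed.

(** The injective code makes T countable, so measurability of the fibres of points extends to all
    preimages. *)
Lemma measurable_discrete (T : Type) (code : T -> nat) (Y : Omega -> T) :
  injective code -> (forall x, measurable (Y @^-1` [set x])) ->
  forall A, measurable (Y @^-1` A).
Proof.
move=> code_inj mY A.
have -> : Y @^-1` A = \bigcup_n (Y @^-1` (A `&` code @^-1` [set n])).
  apply/seteqP; split => [w Aw|w [n _ [Aw _]]] //.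
  by exists (code (Y w)).
apply: bigcup_measurable => n _.
have [[x [Ax xn]]|no] := pselect (exists x, A x /\ code x = n).
  rewrite (_ : Y @^-1` _ = Y @^-1` [set x]) //.
  apply/seteqP; split => w /=; last by move=> ->.
  by move=> [_ Yn]; apply: code_inj; rewrite Yn.
rewrite (_ : Y @^-1` _ = set0) //; rewrite -subset0 => w [Aw Yn].
by apply: no; exists (Y w).
Qed.

End DiscreteProbability.

Section XvalCode.
Variable S : nat -> finType.

Let enc (x : Xval S) : option (option {k : nat & S k}) :=
  match x with
  | XStar => None
  | XInfty => Some None
  | XStr k r => Some (Some (Tagged (fun k => S k) r))
  end.

Let dec (o : option (option {k : nat & S k})) : Xval S :=
  match o with
  | None => XStar
  | Some None => XInfty
  | Some (Some p) => XStr (tagged p)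
  end.

Let encK : cancel enc dec. Proof. by case. Qed.

Definition xval_code (x : Xval S) : nat := pickle (enc x).

Lemma xval_code_inj : injective xval_code.
Proof. by move=> x y /(pcan_inj pickleK)/(can_inj encK). Qed.

Definition datum_code (p : Xval S * nat) : nat := pickle (xval_code p.1, p.2).

Lemma datum_code_inj : injective datum_code.
Proof.
move=> [x i] [y j] /(pcan_inj pickleK) /= [] /xval_code_inj -> ->.
by [].
Qed.

Lemma XStr_inj k : injective (@XStr S k).
Proof.
move=> r r' /(congr1 enc) E.
have {}E : Tagged (fun k => S k) r = Tagged (fun k => S k) r' by move: E => /= [].

by move/eqP: E; rewrite eq_Tagged => /eqP.
Qed.

End XvalCode.

Section LimitTreeLaw.
Variables (R : realType) (S : nat -> finType) (kappa : forall k, S k -> R).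
Hypothesis kappa_ge0 : forall n (r : S n), 0 <= kappa r.
Hypothesis omega0 : 0 < omega kappa 0.
Hypothesis omega2 : exists k, (2 <= k)%N /\ 0 < omega kappa k.
Variables (d : measure_display) (Omega : measurableType d) (P : probability Omega R).
Variable Z : seq nat * bool -> Omega -> Xval S * nat.
Hypothesis Z_meas : forall i x, measurable (Z i @^-1` [set x]).
Hypothesis Z_indep : mutually_independent P Z.
Hypothesis Z_normal : forall v k (r : S k),
  P (Z (v, false) @^-1` [set (XStr r, 0%N)]) = (pi_ kappa k * (kappa r / wsum kappa k))%:E.
Hypothesis Z_special : forall v k (r : S k) j, (1 <= j <= k)%N ->
  P (Z (v, true) @^-1` [set (XStr r, j)]) =
    ((k%:R * pi_ kappa k) * (kappa r / wsum kappa k) * (k%:R)^-1)%:E.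
Hypothesis Z_special_inf : forall v,
  P (Z (v, true) @^-1` [set (XInfty, 0%N)]) = (1 - mu kappa)%:E.

Notation p := (pr P).
Let zw w : seq nat * bool -> Xval S * nat := fun i => Z i w.

Lemma measurable_datum i (A : set (Xval S * nat)) : measurable (Z i @^-1` A).
Proof. exact: measurable_discrete (@datum_code_inj S) (Z_meas i) A. Qed.

Lemma measurable_status v pre b o : measurable [set w | status_aux (zw w) pre b v = o].
Proof.
elim: v pre b => [|i v IH] pre b /=.
  have [E|E] := pselect (Some b = o).
    by rewrite (_ : [set _ | _] = setT) //; apply/seteqP; split.
  by rewrite (_ : [set _ | _] = set0) //; apply/seteqP; split.
pose C (c c' : bool) : set Omega :=
  (Z (pre, b) @^-1` [set q | (0 < i)%N && allowsX q.1 i = c /\ (i == q.2) = c']) `&`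
  [set w | (if c then status_aux (zw w) (rcons pre i) (b && c') v else None) = o].
have mC c c' : measurable (C c c').
  apply: measurableI; first exact: measurable_datum.
  case: c; first exact: IH.
  have [E|E] := pselect (None = o).
    by rewrite (_ : [set _ | _] = setT) //; apply/seteqP; split.
  by rewrite (_ : [set _ | _] = set0) //; apply/seteqP; split.
rewrite (_ : [set _ | _] = C true true `|` C true false `|` (C false true `|` C false false)).
  by do !apply: measurableU.
apply/seteqP; split => w /=.
  rewrite -/(zw w (pre, b)).
  case E : ((0 < i)%N && allowsX (zw w (pre, b)).1 i); case E' : (i == (zw w (pre, b)).2) => H.
  - by left; left; split.
  - by left; right; split.
  - by right; left; split.
  - by right; right; split.
by move=> [[]|[]] [[/= E E'] H]; rewrite /zw E ?E'.
Qed.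

Lemma measurable_hat_beta v (A : set (Xval S)) : measurable [set w | A (hat_beta (zw w) v)].
Proof.
pose C b := [set w | status_aux (zw w) [::] true v = Some b] `&` Z (v, b) @^-1` [set q | A q.1].
have mC b : measurable (C b).
  by apply: measurableI; [exact: measurable_status | exact: measurable_datum].
pose C0 := [set w | status_aux (zw w) [::] true v = None] `&` [set _ | A XStar].
have mC0 : measurable C0.
  apply: measurableI; first exact: measurable_status.
  have [E|E] := pselect (A XStar).
    by rewrite (_ : [set _ | _] = setT) //; apply/seteqP; split.
  by rewrite (_ : [set _ | _] = set0) //; apply/seteqP; split.
rewrite (_ : [set _ | _] = C true `|` C false `|` C0).
  by apply: measurableU; [exact: measurableU | ].
apply/seteqP; split => w /=; rewrite /hat_beta.
  by case E : (status_aux _ _ _ _) => [[]|] Aw; [left; left|left; right|right]; split.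
by move=> [[]|] [/= ->].
Qed.

Let normal_typical := [set q : Xval S * nat | exists k (r : S k), q = (XStr r, 0%N)].
Let special_typical := [set q : Xval S * nat |
  (exists k (r : S k) j, (1 <= j <= k)%N /\ q = (XStr r, j)) \/ q = (XInfty, 0%N)].

Lemma typicalE v : [set w | typical_at (zw w) v] =
  Z (v, false) @^-1` normal_typical `&` Z (v, true) @^-1` special_typical.
Proof. by []. Qed.

Lemma measurable_typical v : measurable [set w | typical_at (zw w) v].
Proof. by rewrite typicalE; apply: measurableI; exact: measurable_datum. Qed.

Lemma sum_cond_prob k : pi_ kappa k * (\sum_(r : S k) kappa r / wsum kappa k) = pi_ kappa k.
Proof.
rewrite -mulr_suml -/(wsum kappa k).
have [w0|wn0] := eqVneq (wsum kappa k) 0; last by rewrite divff // mulr1.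
by rewrite /pi_ /omega w0 mul0r mulr0 !mul0r.
Qed.

Lemma pi_cvg : \sum_(0 <= k < N) pi_ kappa k @[N --> \oo] --> (1 : R).
Proof.
have V0 := Phi_tau_gt0 kappa_ge0 omega0 omega2.
have H : (phi kappa (tau kappa))^-1 * series (fun k => omega kappa k * tau kappa ^+ k) N
    @[N --> \oo] --> (phi kappa (tau kappa))^-1 * phi kappa (tau kappa).
  by apply: cvgMr; exact: Phi_tau_cvg.
rewrite mulVf ?gt_eqF // in H; apply: (cvg_trans _ H); apply: near_eq_cvg.
by apply: nearW => N; rewrite seriesEnat /= mulr_sumr; apply: eq_bigr => k _; rewrite /pi_; ring.
Qed.

Lemma size_biased_pi_cvg : \sum_(0 <= k < N) k%:R * pi_ kappa k @[N --> \oo] --> mu kappa.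
Proof.
have V0 := Phi_tau_gt0 kappa_ge0 omega0 omega2.
have H : (phi kappa (tau kappa))^-1 * series (fun k => k%:R * omega kappa k * tau kappa ^+ k) N
    @[N --> \oo] --> (phi kappa (tau kappa))^-1 * (mu kappa * phi kappa (tau kappa)).
  by apply: cvgMr; exact: size_biased_tau_cvg.
rewrite mulrCA mulVf ?gt_eqF // mulr1 in H; apply: (cvg_trans _ H); apply: near_eq_cvg.
by apply: nearW => N; rewrite seriesEnat /= mulr_sumr; apply: eq_bigr => k _; rewrite /pi_; ring.
Qed.

Lemma pr_typical_normal v :
  p (Z (v, false) @^-1` normal_typical) = 1.
Proof.
set T := Z _ @^-1` _; have mT : measurable T by exact: measurable_datum.
apply/eqP; rewrite eq_le pr_le1 //=.
rewrite -(cvg_lim _ pi_cvg) //; apply: limr_le; first exact: cvgP pi_cvg.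
apply: nearW => N.
pose F k := \big[setU/set0]_(r : S k) Z (v, false) @^-1` [set (XStr r, 0%N)].
have mF k : measurable (F k) by apply: measurable_bigU => r; exact: measurable_datum.
have FE k w : F k w -> exists r : S k, Z (v, false) w = (XStr r, 0%N).
  by move=> /bigUP[r _ H]; exists r.
have -> : \sum_(0 <= k < N) pi_ kappa k = p (\big[setU/set0]_(0 <= k < N) F k).
  rewrite pr_bigU ?iota_uniq //; last first.
    by move=> i j w /FE[r E1] /FE[r' E2]; move: E1; rewrite E2 => /(congr1 (fun q => xdeg q.1)) /= ->.
  apply: eq_bigr => k _; rewrite /F pr_bigU ?index_enum_uniq //.
  - by rewrite -[LHS]sum_cond_prob mulr_sumr; apply: eq_bigr => r _; rewrite /pr Z_normal.
  - by move=> r r' w /= -> /(congr1 fst) /= /XStr_inj.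
apply: pr_le => //; first exact: measurable_bigU.
by move=> w /bigUP[k _ /FE[r E]]; exists k, r.
Qed.

(** The k equally likely positions of the special child add up to k pi_k, these sum to mu, and the
    atom at infinity supplies the missing 1 - mu. *)
Lemma pr_typical_special v :
  p (Z (v, true) @^-1` special_typical) = 1.
Proof.
set T := Z _ @^-1` _; have mT : measurable T by exact: measurable_datum.
apply/eqP; rewrite eq_le pr_le1 //=.
have H : \sum_(0 <= k < N) k%:R * pi_ kappa k + (1 - mu kappa) @[N --> \oo] --> (1 : R).
  rewrite [X in _ --> X](_ : 1 = mu kappa + (1 - mu kappa)); last by ring.
  by apply: cvgD; [exact: size_biased_pi_cvg | exact: cvg_cst].
rewrite -(cvg_lim _ H) //; apply: limr_le; first exact: cvgP H.
apply: nearW => N.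
pose F k := \big[setU/set0]_(r : S k) \big[setU/set0]_(j <- iota 1 k)
  Z (v, true) @^-1` [set (XStr r, j)].
have mF k : measurable (F k).
  by apply: measurable_bigU => r; apply: measurable_bigU => j; exact: measurable_datum.
have FE k w : F k w -> exists (r : S k) j, (1 <= j <= k)%N /\ Z (v, true) w = (XStr r, j).
  by move=> /bigUP[r _ /bigUP[j]]; rewrite mem_iota add1n ltnS => jk Zj; exists r, j.
pose I := Z (v, true) @^-1` [set (XInfty, 0%N)].
have mI : measurable I by exact: measurable_datum.
have mU : measurable (\big[setU/set0]_(0 <= k < N) F k) by exact: measurable_bigU.
have -> : \sum_(0 <= k < N) k%:R * pi_ kappa k + (1 - mu kappa) =
    p (\big[setU/set0]_(0 <= k < N) F k `|` I).
  rewrite prU //; last first.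
    rewrite -subset0 => w [/bigUP[k _ /FE[r [j [_ E]]]]]; rewrite /I /= E.
    by [].
  congr (_ + _); last by rewrite /I /pr Z_special_inf.
  rewrite pr_bigU ?iota_uniq //; last first.
    move=> i j w /FE[r [j1 [_ E1]]] /FE[r' [j2 [_ E2]]]; move: E1.
    by rewrite E2 => /(congr1 (fun q => xdeg q.1)) /= ->.
  apply: eq_bigr => k _; rewrite /F pr_bigU ?index_enum_uniq //.
  - rewrite -[in LHS]sum_cond_prob mulrA mulr_sumr; apply: eq_bigr => r _.
    rewrite pr_bigU ?iota_uniq //.
    + rewrite (eq_big_seq (fun=> (k%:R * pi_ kappa k) * (kappa r / wsum kappa k) / k%:R)); last first.
        by move=> j; rewrite mem_iota add1n ltnS => jk; rewrite /pr Z_special.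
      rewrite big_const_seq count_predT size_iota iter_addr_0 -[RHS]mulr_natr.
      case: (posnP k) => [k0|k0].
        have -> : k%:R = 0 :> R by rewrite k0.
        by rewrite !mul0r.
      by rewrite divfK // pnatr_eq0 -lt0n.
    + by move=> i j w /= -> [].
  - by move=> r; apply: measurable_bigU => j; exact: measurable_datum.
  - move=> r r' w /bigUP[j _ E1] /bigUP[j' _ E2].
    by move: E1; rewrite /= E2 => /(congr1 fst) /= /XStr_inj.
apply: pr_le => //; first exact: measurableU.
move=> w [/bigUP[k _ /FE[r [j [jk E]]]]|E]; last by right.
by left; exists k, r, j.
Qed.

Lemma pr_typical v : p [set w | typical_at (zw w) v] = 1.
Proof.
rewrite typicalE; set A := Z (v, false) @^-1` _; set B := Z (v, true) @^-1` _.
have mA : measurable A by exact: measurable_datum.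
have mB : measurable B by exact: measurable_datum.
have mAB := measurableI _ _ mA mB.
apply/eqP; rewrite eq_le pr_le1 //=.
have : p (~` (A `&` B)) <= p (~` A) + p (~` B).
  by rewrite setCI; apply: prU_le; exact: measurableC.
by rewrite !prC // pr_typical_normal pr_typical_special; lra.
Qed.

Lemma pr_atypical (B : seq (seq nat)) :
  measurable [set w | exists2 v, v \in B & ~ typical_at (zw w) v] /\
  p [set w | exists2 v, v \in B & ~ typical_at (zw w) v] = 0.
Proof.
pose F v := ~` [set w | typical_at (zw w) v].
have mF v : measurable (F v) by apply: measurableC; exact: measurable_typical.
have -> : [set w | exists2 v, v \in B & ~ typical_at (zw w) v] = \big[setU/set0]_(v <- B) F v.
  by apply/seteqP; split => w; rewrite bigUP.
split; first exact: measurable_bigU.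
apply/eqP; rewrite eq_le pr_ge0 andbT; apply: le_trans (pr_bigU_le _ _ mF) _.
rewrite big1 // => v _; rewrite /F prC; last exact: measurable_typical.
by rewrite pr_typical subrr.
Qed.

End LimitTreeLaw.

(** Unlike [partial_tree], this admits vertices of infinite degree and requires the root, at which
    the spine starts. *)
Definition pattern (S : nat -> Type) (L : seq (seq nat)) (y : seq nat -> Xval S) : Prop :=
  [/\ uniq L, [::] \in L, (forall v, v \in L -> y v <> XStar) &
      forall v i, rcons v i \in L -> v \in L /\ (0 < i)%N && allowsX (y v) i].

(** * Upper bounds for pattern probabilities in the limit tree *)

Section PatternProbabilities.
Variables (R : realType) (S : nat -> finType) (kappa : forall k, S k -> R).
Variables (d : measure_display) (Omega : measurableType d) (P : probability Omega R).
Variable Z : seq nat * bool -> Omega -> Xval S * nat.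
Hypothesis Z_meas : forall i x, measurable (Z i @^-1` [set x]).
Hypothesis Z_indep : mutually_independent P Z.
Hypothesis Z_normal : forall v k (r : S k),
  P (Z (v, false) @^-1` [set (XStr r, 0%N)]) = (pi_ kappa k * (kappa r / wsum kappa k))%:E.
Hypothesis Z_special : forall v k (r : S k) j, (1 <= j <= k)%N ->
  P (Z (v, true) @^-1` [set (XStr r, j)]) =
    ((k%:R * pi_ kappa k) * (kappa r / wsum kappa k) * (k%:R)^-1)%:E.
Hypothesis Z_special_inf : forall v,
  P (Z (v, true) @^-1` [set (XInfty, 0%N)]) = (1 - mu kappa)%:E.

Notation p := (pr P).
Let zw w : seq nat * bool -> Xval S * nat := fun i => Z i w.

Variables (L : seq (seq nat)) (y : seq nat -> Xval S).
Hypothesis pLy : pattern L y.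

Definition pattern_event : set Omega :=
  [set w | forall v, v \in L -> typical_at (zw w) v /\ hat_beta (zw w) v = y v].

(** Once the end e of the spine is fixed, each vertex of L uses just one of its two data. The event
    becomes a cylinder over distinct indices, to which independence applies. *)
Definition spine_cylinder (e : seq nat) : set Omega :=
  \bigcap_(i in [set i | i \in [seq (v, prefix v e) | v <- L]])
     (Z i @^-1` [set (y i.1, spine_label e i.1)]).

Lemma measurable_spine_cylinder e : measurable (spine_cylinder e).
Proof.
rewrite /spine_cylinder bigcap_seq; elim: [seq _ | _ <- _] => [|i s IH].
  by rewrite big_nil.
by rewrite big_cons; apply: measurableI.
Qed.

Lemma pr_spine_cylinder e : p (spine_cylinder e) =
  \prod_(v <- L) p (Z (v, prefix v e) @^-1` [set (y v, spine_label e v)]).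
Proof.
have [uL _ _ _] := pLy.
rewrite /pr /spine_cylinder (Z_indep _ (fun i => (y i.1, spine_label e i.1))); last first.
  by rewrite map_inj_uniq // => u v [].
rewrite big_map /=.
elim: (L) => [|v s IH]; first by rewrite !big_nil.
rewrite !big_cons fineM ?IH //; first exact: fin_num_measure.
elim: (s) => [|v' s' IH']; first by rewrite big_nil.
by rewrite big_cons fin_numM //; exact: fin_num_measure.
Qed.

(** The size bias k cancels the uniform choice 1 / k of the special child, so a vertex on the spine
    has the same factor as a normal one. *)
Lemma spine_factor e v k (r : S k) : y v = XStr r ->
  (prefix v e -> (1 <= spine_label e v <= k)%N) ->
  p (Z (v, prefix v e) @^-1` [set (y v, spine_label e v)]) = str_prob kappa (y v).
Proof.
move=> yv; rewrite /spine_label; case: ifP => [pve /(_ isT) jk|_ _]; rewrite yv /pr.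
  rewrite Z_special //=; move: (pi_ _ _) (kappa r / _) => X Y; field.
  by rewrite pnatr_eq0 -lt0n; case/andP: jk; exact: leq_trans.
by rewrite Z_normal.
Qed.

Lemma pattern_event_end w : pattern_event w -> exists e,
  [/\ spine_cylinder e w,
     (forall v, v \in L -> y v = XInfty -> v = e) &
     (e \notin L /\ exists v k (r : S k) j,
        [/\ v \in L, y v = XStr r, (1 <= j <= k)%N & e = rcons v j]) \/
     (e \in L /\ y e = XInfty)].
Proof.
move=> Aw; have [uL rL nL cL] := pLy.
have typ v : v \in L -> typical_at (zw w) v by case/Aw.
have hat v : v \in L -> hat_beta (zw w) v = y v by case/Aw.
have stat v : v \in L -> status_aux (zw w) [::] true v <> None.
  by move=> vL /hat_beta_None; rewrite hat //; exact: nL.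
have [e [se He Hz]] := spine_end rL typ stat.
exists e; split.
- move=> i /mapP[v vL ->] /=.
  by rewrite -[Z _ w]/(zw w (v, prefix v e)) Hz // hat.
- move=> v vL yv; have := Hz v vL; rewrite hat // yv.
  case: (boolP (prefix v e)) => [/prefixP[[|i u] eu]|_] zv.
  + by rewrite eu cats0.
  + exfalso; have : status_aux (zw w) [::] true (rcons v i) = Some true.
      by apply: (@special_prefix _ _ _ u); rewrite cat_rcons -eu.
    move=> H; have [_ iE] := special_step H.
    have [_ [[k [r [j [_]]]]|zv0]] := typ v vL; first by rewrite zv.
    move: H; rewrite status_rcons iE zv0 /=.
    by case: (status_aux _ _ _ _).
  by have [[k [r]]] := typ v vL; rewrite zv.
case: He => [[eL [v [k [r [j [vL hv jk ev]]]]]]|[eL he]]; last by right; rewrite -hat.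
by left; split=> //; exists v, k, r, j; rewrite -hat.
Qed.

Lemma spine_label_rcons v j u : spine_label (v ++ j :: u) v = j.
Proof. by rewrite /spine_label prefix_prefix nth_cat ltnn subnn. Qed.

Lemma pattern_label e v k (r : S k) : v \in L -> y v = XStr r -> e <> v ->
  (e \in L \/ exists u i, [/\ u \in L, (0 < i)%N && allowsX (y u) i & e = rcons u i]) ->
  prefix v e -> (1 <= spine_label e v <= k)%N.
Proof.
move=> vL yv ev He; have [uL rL nL cL] := pLy.
case/prefixP => -[|j u] eE; first by rewrite cats0 in eE.
have H : (0 < j)%N && allowsX (y v) j.
  have pre s : v ++ j :: s \in L -> (0 < j)%N && allowsX (y v) j.
    elim/last_ind: s => [|s i IH].
      by rewrite cats1 => /cL[].
    by rewrite -rcons_cons -rcons_cat => /cL[/IH].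
  case: He => [eL|[u' [i [u'L Hi eE']]]]; first by apply: (pre u); rewrite -eE.
  move: eE; rewrite eE'; case/lastP: u => [|s i'].
    by rewrite cats1 => /rcons_inj[<- <-].
  by rewrite -rcons_cons -rcons_cat => /rcons_inj[E _]; apply: (pre s); rewrite -E.
by rewrite eE spine_label_rcons; move: H; rewrite yv.
Qed.

Lemma pattern_partial : (forall v, v \in L -> y v <> XInfty) -> partial_tree L y.
Proof.
have [uL rL nL cL] := pLy; move=> fL; split => // v vL.
by have := nL v vL; have := fL v vL; case: (y v) => // k r; exists k, r.
Qed.

(** A union bound over the pending vertices through which the spine may leave; all the cylinders
    have the same probability. *)
Lemma pr_pattern_finite (A : set Omega) : measurable A -> A `<=` pattern_event ->
  (forall v, v \in L -> y v <> XInfty) ->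
  p A <= ((\sum_(v <- L) xdeg (y v)).+1 - size L)%:R * \prod_(v <- L) str_prob kappa (y v).
Proof.
move=> mA AE fL; have pL := pattern_partial fL; have [uL xL _] := pL.
pose E := [seq e <- kids L y | e \notin L].
have sE : size E = ((\sum_(v <- L) xdeg (y v)).+1 - size L)%N.
  rewrite -(size_kids L y) -(count_predC (mem L) (kids L y)) size_filter.
  rewrite -[X in (X + _)%N]size_filter (_ : size _ = size L) ?addKn //.
  apply/perm_size/uniq_perm => //; first by rewrite filter_uniq // uniq_kids.
  move=> v; rewrite mem_filter; apply/andP/idP => [[]//|vL]; split => //.
  exact: partial_tree_sub_kids.
apply: (@le_trans _ _ (p (\big[setU/set0]_(e <- E) spine_cylinder e))).
  apply: pr_le => //.
    by apply: measurable_bigU => e; exact: measurable_spine_cylinder.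
  move=> w /AE /pattern_event_end[e [cw _ [[eL [v [k [r [j [vL yv jk ev]]]]]]|[eL ye]]]].
    apply/bigUP; exists e => //; rewrite mem_filter eL /= ev.
    by apply: rcons_kids => //; rewrite yv.
  by case: (fL e eL).
apply: le_trans (pr_bigU_le P E measurable_spine_cylinder) _.
rewrite (eq_big_seq (fun=> \prod_(v <- L) str_prob kappa (y v))).
  by rewrite big_const_seq count_predT iter_addr_0 sE mulr_natl.
move=> e; rewrite mem_filter => /andP[eL ek]; rewrite pr_spine_cylinder.
apply: eq_big_seq => v vL; have [k [r yv]] := xL v vL.
apply: (spine_factor yv); apply: (pattern_label vL yv); first by move=> ev; rewrite ev vL in eL.
right; case: (mem_kids ek) => [e0|[u [i [u_in /andP[i0 iu] ->]]]].
  by case: pLy => _ rL _ _; rewrite e0 rL in eL.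
by exists u, i; split => //; have [k' [r' yu]] := xL u u_in; rewrite i0 (allowsX_xdeg _ yu).
Qed.

(** The spine can only stop at [v0], so a single cylinder covers the event. *)
Lemma pr_pattern_infinite (A : set Omega) v0 L' : measurable A -> A `<=` pattern_event ->
  L = v0 :: L' -> y v0 = XInfty -> (forall v, v \in L' -> y v <> XInfty) ->
  p A <= \prod_(v <- L') str_prob kappa (y v) * (1 - mu kappa).
Proof.
move=> mA AE LE yv0 fL'; have [uL rL nL cL] := pLy.
have v0L : v0 \in L by rewrite LE mem_head.
apply: (@le_trans _ _ (p (spine_cylinder v0))).
  apply: pr_le => //; first exact: measurable_spine_cylinder.
  by move=> w /AE /pattern_event_end[e [cw /(_ v0 v0L yv0) -> _]].
rewrite pr_spine_cylinder LE big_cons mulrC prefix_refl /spine_label prefix_refl nth_default //.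
rewrite yv0 {2}/pr Z_special_inf /=.
rewrite [X in X * _](_ : _ = \prod_(v <- L') str_prob kappa (y v)) //.
apply: eq_big_seq => v vL'; have vL : v \in L by rewrite LE inE vL' orbT.
have [k [r yv]] : exists k (r : S k), y v = XStr r.
  by have := nL v vL; have := fL' v vL'; case: (y v) => // k r; exists k, r.
apply: (spine_factor yv); apply: (pattern_label vL yv); last by left.
by move=> E; move: yv0; rewrite E yv.
Qed.

Lemma pattern_event_infinite_unique w v0 v1 : pattern_event w ->
  v0 \in L -> v1 \in L -> y v0 = XInfty -> y v1 = XInfty -> v0 = v1.
Proof.
move=> /pattern_event_end[e [_ He _]] v0L v1L y0 y1.
by rewrite (He v0) // (He v1).
Qed.

End PatternProbabilities.

(** * Comparison on finite boxes and conclusion *)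

Lemma ler_sum_pred (R : numDomainType) (I : finType) (A B : pred I) (F : I -> R) :
  (forall i, 0 <= F i) -> (forall i, A i -> B i) ->
  \sum_(i | A i) F i <= \sum_(i | B i) F i.
Proof.
move=> F0 AB; rewrite big_mkcond [leRHS]big_mkcond; apply: ler_sum => i _.
by case: ifP => [/AB ->|_] //; case: ifP.
Qed.

Definition is_xstar (S : nat -> Type) (x : Xval S) : bool := if x is XStar then true else false.

Lemma is_xstarP (S : nat -> Type) (x : Xval S) : reflect (x = XStar) (is_xstar x).
Proof. by apply: (iffP idP); [case: x | move=> ->]. Qed.

Lemma box_rcons m (b : Box m) v i : boxval b = rcons v i -> exists b' : Box m, boxval b' = v.
Proof.
move=> bE; apply: boxval_onto.
  by apply: leq_trans (size_boxval b); rewrite bE size_rcons.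
by apply/allP => j jv; apply: (@boxval_letter _ b); rewrite bE mem_rcons inE jv orbT.
Qed.

Section BoxPatterns.
Variables (S : nat -> finType) (m : nat) (y : Box m -> Xval S).

Definition box_fun (v : seq nat) : Xval S :=
  if [pick b | boxval b == v] is Some b then y b else XStar.

Definition box_tree : seq (seq nat) := [seq boxval b | b <- enum [pred b | ~~ is_xstar (y b)]].

Lemma box_funE b : box_fun (boxval b) = y b.
Proof. by rewrite /box_fun pick_boxval. Qed.

Lemma mem_box_tree v : v \in box_tree <-> exists2 b : Box m, boxval b = v & y b <> XStar.
Proof.
split=> [/mapP[b]|[b <- yb]]; first by rewrite mem_enum => /is_xstarP yb ->; exists b.
by apply/mapP; exists b => //; rewrite mem_enum; apply/is_xstarP.
Qed.

Lemma uniq_box_tree : uniq box_tree.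
Proof. by rewrite (map_inj_uniq (@boxval_inj m)) enum_uniq. Qed.

(** The stars in the box are forced by the degrees in the box, so agreement on [box_tree] implies
    agreement on the whole box. *)
Definition box_closed : Prop := forall v i (b : Box m), boxval b = rcons v i ->
  v \in box_tree -> (0 < i)%N && allowsX (box_fun v) i -> rcons v i \in box_tree.

(** One typical outcome that realises y certifies all the combinatorial conditions on y. *)
Lemma box_pattern_of_outcome z : (0 < m)%N ->
  (forall b : Box m, typical_at z (boxval b)) ->
  (forall b : Box m, hat_beta z (boxval b) = y b) ->
  pattern box_tree box_fun /\ box_closed.
Proof.
move=> m0 typ hat.
have [b0 b0E] : exists b : Box m, boxval b = [::] by apply: boxval_onto.
have nstar (b : Box m) (c : bool) : (z (boxval b, c)).1 <> XStar by exact: typical_nstar.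
split; first split.
- exact: uniq_box_tree.
- apply/mem_box_tree; exists b0 => //; rewrite -hat b0E (@hat_beta_status _ _ _ true) //.
  by rewrite -b0E; exact: nstar.
- by move=> v /mem_box_tree[b <- yb]; rewrite box_funE.
- move=> v i /mem_box_tree[b bE yb]; have [b' b'E] := box_rcons bE.
  have : hat_beta z (rcons v i) <> XStar by rewrite -bE hat.
  case E : (status_aux z [::] true (rcons v i)) => [c|]; last by move/hat_beta_None : E => ->.
  move=> _; move: E; rewrite status_rcons.
  case Ev : (status_aux z [::] true v) => [c'|] //=.
  case: ifP => // iv _.
  have hv : box_fun v = (z (v, c')).1 by rewrite -b'E box_funE -hat b'E (hat_beta_status Ev).
  rewrite hv; split => //; apply/mem_box_tree; exists b' => //.
  by rewrite -box_funE b'E hv => E0; move: iv; rewrite E0 andbF.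
move=> v i b bE /mem_box_tree[b' b'E yb'] iv; apply/mem_box_tree; exists b => //.
have hv : box_fun v = hat_beta z v by rewrite -b'E box_funE hat.
case Ev : (status_aux z [::] true v) => [c|]; last first.
  by move: iv; rewrite hv (hat_beta_None Ev) andbF.
rewrite hv (hat_beta_status Ev) in iv.
rewrite -hat bE.
have E : status_aux z [::] true (rcons v i) = Some (c && (i == (z (v, c)).2)).
  by rewrite status_rcons Ev /= iv.
by rewrite (hat_beta_status E) -bE; exact: nstar.
Qed.

(** Only labels below m occur in the box, so there a degree at least m is indistinguishable from an
    infinite one. *)
Lemma box_outside (t : seq nat -> Xval S) : box_closed -> tree_like t -> [::] \in box_tree ->
  (forall v i, v \in box_tree -> (i < m)%N -> allowsX (t v) i -> allowsX (box_fun v) i) ->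
  forall b : Box m, t (boxval b) <> XStar -> boxval b \in box_tree.
Proof.
move=> clos [t0 t1] rL tL b.
move bE : (boxval b) => v; elim/last_ind: v b bE => [//|v i IH] b bE tv.
have [b' b'E] := box_rcons bE.
have := proj1 (t1 v i) tv => /andP[i0 iv].
have vL : v \in box_tree by apply: IH b'E _ => E; rewrite E in iv.
apply: (clos _ _ b) => //; rewrite i0 tL //.
by apply: (@boxval_letter _ b); rewrite bE mem_rcons mem_head.
Qed.

End BoxPatterns.

Section PatternLowerBound.
Variables (R : realType) (S : nat -> finType) (kappa : forall k, S k -> R).
Hypothesis kappa_ge0 : forall n (r : S n), 0 <= kappa r.
Hypothesis omega0 : 0 < omega kappa 0.
Hypothesis omega2 : exists k, (2 <= k)%N /\ 0 < omega kappa k.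
Variables (m M : nat) (y : Box m -> Xval S).
Hypotheses (m_gt0 : (0 < m)%N) (mM : (m <= M)%N).

Definition box_near n (e : EBox S n) : bool :=
  `[< forall b : Box m, xnear M (y b) (ext e (boxval b)) >].

Definition near_prob n : R :=
  (\sum_(e : EBox S n | plane_tree_n (eshape e) && box_near e) tree_weight kappa e) / Zn kappa n.

Lemma Zn_ge0 n : 0 <= Zn kappa n.
Proof. by rewrite Zn_sum //; apply: sumr_ge0 => e _; exact: tree_weight_ge0. Qed.

Lemma near_prob_ge0 n : 0 <= near_prob n.
Proof.
apply: divr_ge0; last exact: Zn_ge0.
by apply: sumr_ge0 => e _; exact: tree_weight_ge0.
Qed.

Hypotheses (pat : pattern (box_tree y) (box_fun y)) (clos : box_closed y).

Lemma near_prob_finite n : (forall v, v \in box_tree y -> box_fun y v <> XInfty) ->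
  pattern_prob kappa n (box_tree y) (box_fun y) <= near_prob n.
Proof.
move=> fin; have [_ rL nL _] := pat.
rewrite /near_prob ler_wpM2r ?invr_ge0 ?Zn_ge0 //; apply: ler_sum_pred.
  by move=> e; exact: tree_weight_ge0.
move=> e /andP[pe /asboolP eL]; rewrite pe; apply/asboolP => b.
have [te _] := plane_tree_nP pe.
have [yb|yb] := pselect (y b = XStar); last first.
  have bL : boxval b \in box_tree y by apply/mem_box_tree; exists b.
  rewrite eL // box_funE; have := fin _ bL; rewrite box_funE.
  by case: (y b) yb.
rewrite yb /=; apply: contrapT => H.
have : boxval b \in box_tree y.
  by apply: (box_outside clos te) => // v i vL _; rewrite eL.
by move/nL; rewrite box_funE.
Qed.

Section OneInfinite.
Variables (v0 : seq nat).
Hypotheses (v0L : v0 \in box_tree y) (v0_inf : box_fun y v0 = XInfty).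
Hypothesis v0_unique : forall v, v \in box_tree y -> box_fun y v = XInfty -> v = v0.

Let L' := rem v0 (box_tree y).

Lemma perm_box_tree : perm_eq (box_tree y) (v0 :: L').
Proof. exact: perm_to_rem. Qed.

Lemma rest_finite v : v \in L' -> exists k (r : S k), box_fun y v = XStr r.
Proof.
have [uL _ nL _] := pat; rewrite mem_rem_uniq // inE => /andP[vv0 vL].
have := nL v vL; case E : (box_fun y v) => [||k r] // _; last by exists k, r.
by move: vv0; rewrite (v0_unique vL E) eqxx.
Qed.

Lemma v0_notin_rest : v0 \notin L'.
Proof. by have [uL _ _ _] := pat; rewrite mem_rem_uniq // inE eqxx. Qed.

Lemma large_partial_tree K (r : S K) : (m <= K)%N ->
  partial_tree (v0 :: L') (set_str (box_fun y) v0 r).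
Proof.
move=> mK; have [uL rL nL cL] := pat; split.
- by rewrite -(perm_uniq perm_box_tree).
- move=> v; rewrite inE /set_str; case: eqP => [_ _|_ /= vL']; first by exists K, r.
  exact: rest_finite.
move=> v i; rewrite -(perm_mem perm_box_tree) => viL.
have [vL /andP[i0 iv]] := cL v i viL.
rewrite -(perm_mem perm_box_tree); split => //; rewrite i0 /set_str /=.
case: eqP => // _ /=; apply: leq_trans mK; apply: ltnW.
case/mem_box_tree : viL => b bE _.
by apply: (@boxval_letter _ b); rewrite bE mem_rcons mem_head.
Qed.

Lemma extends_large_near n (e : EBox S n) K (r : S K) : (M <= K)%N ->
  plane_tree_n (eshape e) -> extends e (v0 :: L') (set_str (box_fun y) v0 r) -> box_near e.
Proof.
move=> MK pe /asboolP eL; have [te _] := plane_tree_nP pe.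
have [_ rL nL _] := pat.
have eL' v : v \in box_tree y -> ext e v = set_str (box_fun y) v0 r v.
  by move=> vL; apply: eL; rewrite -(perm_mem perm_box_tree).
apply/asboolP => b.
have [yb|yb] := pselect (y b = XStar); last first.
  have bL : boxval b \in box_tree y by apply/mem_box_tree; exists b.
  rewrite eL' // /set_str; case: eqP => [bE|bv].
    by move: v0_inf; rewrite -bE box_funE => -> /=; right; exists K, r.
  rewrite box_funE; case E : (y b) yb => [||k s] // _.
  by exfalso; apply: bv; apply: v0_unique => //; rewrite box_funE.
rewrite yb /=; apply: contrapT => H.
have : boxval b \in box_tree y.
  apply: (box_outside clos te) => // v i vL im; rewrite eL' // /set_str.
  by case: eqP => // ->; rewrite v0_inf.
by move/nL; rewrite box_funE.
Qed.

(** Patterns with different structures at [v0] exclude one another, so each tree is counted at most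
    once in the sum over degrees and structures. *)
Lemma near_prob_infinite n :
  big_degree_prob kappa L' v0 (box_fun y) M n <= near_prob n.
Proof.
rewrite /big_degree_prob /pattern_prob /near_prob.
under eq_bigr do rewrite -mulr_suml.
rewrite -mulr_suml ler_wpM2r ?invr_ge0 ?Zn_ge0 //.
pose c (e : EBox S n) K (r : S K) : R :=
  (plane_tree_n (eshape e) && extends e (v0 :: L') (set_str (box_fun y) v0 r))%:R.
have cE K (r : S K) : \sum_(e : EBox S n | plane_tree_n (eshape e) &&
     extends e (v0 :: L') (set_str (box_fun y) v0 r)) tree_weight kappa e =
   \sum_(e : EBox S n) tree_weight kappa e * c e K r.
  by rewrite big_mkcond; apply: eq_bigr => e _; rewrite /c; case: ifP; rewrite ?mulr1 ?mulr0.
under eq_bigr => K _ do under eq_bigr => r _ do rewrite cE.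
under eq_bigr => K _ do rewrite exchange_big.
rewrite exchange_big /= [leRHS]big_mkcond /=; apply: ler_sum => e _.
under eq_bigr => K _ do rewrite -mulr_sumr.
rewrite -mulr_sumr.
have w0 := tree_weight_ge0 kappa_ge0 e.
have c01 K r : c e K r = 0 \/ ext e v0 = XStr r.
  rewrite /c; case: (boolP (_ && _)) => [/andP[_ /asboolP eL]|_]; last by left.
  by right; rewrite eL ?mem_head // /set_str eqxx.
have cnear K r : (M <= K)%N -> c e K r != 0 -> plane_tree_n (eshape e) && box_near e.
  move=> MK; rewrite /c pnatr_eq0 eqb0 negbK => /andP[pe eL].
  by rewrite pe (extends_large_near MK pe eL).
case: ifP => nr; last first.
  rewrite big_nat_cond big1 ?mulr0 // => K /andP[/andP[MK _] _].
  rewrite big1 // => r _; apply/eqP; apply: contraFT nr; exact: cnear.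
rewrite ler_piMr //.
case E : (ext e v0) => [||k0 r0].
- have c0 K r : c e K r = 0 by have [//|] := c01 K r; rewrite E.
  by under eq_bigr => K _ do rewrite big1 //; rewrite big1 ?ler01.
- have c0 K r : c e K r = 0 by have [//|] := c01 K r; rewrite E.
  by under eq_bigr => K _ do rewrite big1 //; rewrite big1 ?ler01.
have s0 K : K != k0 -> \sum_(r : S K) c e K r = 0.
  move=> Kk; rewrite big1 // => r _; have [//|] := c01 K r; rewrite E.
  by move/(congr1 (@xdeg S)) => /= kK; rewrite kK eqxx in Kk.
have s1 : \sum_(r : S k0) c e k0 r <= 1.
  rewrite (bigD1 r0) //= [X in _ + X]big1 ?addr0; first by rewrite /c lern1 leq_b1.
  move=> r rr0; have [//|] := c01 k0 r; rewrite E => /XStr_inj rE.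
  by rewrite rE eqxx in rr0.
case: (boolP (k0 \in index_iota M n)) => kin.
  have -> : \sum_(M <= K < n) \sum_(r : S K) c e K r = \sum_(r : S k0) c e k0 r.
    rewrite (bigD1_seq k0) ?iota_uniq //= [X in _ + X]big1 ?addr0 //.
  exact: s1.
have -> : \sum_(M <= K < n) \sum_(r : S K) c e K r = 0.
  rewrite big_seq big1 // => K Kin; apply: s0.
  by apply: contraNneq kin => <-.
exact: ler01.
Qed.

End OneInfinite.
End PatternLowerBound.

Section BoxEvents.
Variables (R : realType) (S : nat -> finType) (kappa : forall k, S k -> R).
Hypothesis kappa_ge0 : forall n (r : S n), 0 <= kappa r.
Hypothesis omega0 : 0 < omega kappa 0.
Hypothesis omega2 : exists k, (2 <= k)%N /\ 0 < omega kappa k.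
Variables (d : measure_display) (Omega : measurableType d) (P : probability Omega R).
Variable Z : seq nat * bool -> Omega -> Xval S * nat.
Hypothesis Z_meas : forall i x, measurable (Z i @^-1` [set x]).
Hypothesis Z_indep : mutually_independent P Z.
Hypothesis Z_normal : forall v k (r : S k),
  P (Z (v, false) @^-1` [set (XStr r, 0%N)]) = (pi_ kappa k * (kappa r / wsum kappa k))%:E.
Hypothesis Z_special : forall v k (r : S k) j, (1 <= j <= k)%N ->
  P (Z (v, true) @^-1` [set (XStr r, j)]) =
    ((k%:R * pi_ kappa k) * (kappa r / wsum kappa k) * (k%:R)^-1)%:E.
Hypothesis Z_special_inf : forall v,
  P (Z (v, true) @^-1` [set (XInfty, 0%N)]) = (1 - mu kappa)%:E.

Notation p := (pr P).
Let zw w : seq nat * bool -> Xval S * nat := fun i => Z i w.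

Definition hat_box m (w : Omega) : Box m -> Xval S := fun b => hat_beta (zw w) (boxval b).

Definition box_event m (y : Box m -> Xval S) : set Omega := [set w | hat_box w = y].

Lemma measurable_box_event m (y : Box m -> Xval S) : measurable (box_event y).
Proof.
pose F b := [set w | hat_beta (zw w) (boxval b) = y b].
have mF b : measurable (F b) by exact: (measurable_hat_beta Z_meas (boxval b) [set y b]).
have -> : box_event y = \bigcap_(b in [set b | b \in enum {: Box m}]) F b.
  apply/seteqP; split => w; first by move=> Aw b _; exact: (congr1 (fun g => g b) Aw).
  by move=> H; apply/funext => b; apply: H; rewrite /= mem_enum.
rewrite bigcap_seq; elim: (enum _) => [|b s IH]; first by rewrite big_nil.
by rewrite big_cons; exact: measurableI.
Qed.

Lemma box_event_liminf m M (y : Box m -> Xval S) (delta : R) : (0 < m)%N -> (m <= M)%N ->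
  0 < delta ->
  \forall n \near tree_filter kappa, p (box_event y) - delta <= near_prob kappa M y n.
Proof.
move=> m0 mM delta0.
have mA := measurable_box_event y.
pose B := [seq boxval b | b <- enum {: Box m}].
have [mN pN] := pr_atypical kappa_ge0 omega0 omega2 Z_meas Z_normal Z_special Z_special_inf B.
set N := [set w | _] in mN pN.
pose A := box_event y `&` ~` N.
have mA' : measurable A by apply: measurableI => //; exact: measurableC.
have pA : p (box_event y) <= p A.
  have sub : box_event y `<=` A `|` N.
    by move=> w Aw; have [Nw|Nw] := pselect (N w); [right | left].
  apply: le_trans (pr_le P mA (measurableU _ _ mA' mN) sub) _.
  by apply: le_trans (prU_le P mA' mN) _; rewrite pN addr0.
suff H : \forall n \near tree_filter kappa, p A - delta <= near_prob kappa M y n.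
  by apply: filterS H => n; apply: le_trans; rewrite lerB.
have typA w : A w -> forall b : Box m, typical_at (zw w) (boxval b).
  move=> [_ Nw] b; apply: contrapT => tb; apply: Nw; exists (boxval b) => //.
  by apply/mapP; exists b; rewrite ?mem_enum.
have hatA w : A w -> forall b : Box m, hat_beta (zw w) (boxval b) = y b.
  by move=> [Aw _] b; exact: (congr1 (fun g => g b) Aw).
(* Either no typical outcome realises y and the bound is trivial, or such an outcome [w0] shows that
   y is a pattern. *)
have [[w0 Aw0]|no] := pselect (exists w, A w); last first.
  apply: nearW => n; apply: le_trans (near_prob_ge0 kappa_ge0 M y n).
  rewrite (_ : A = set0) ?/pr ?measure0 /= ?sub0r ?oppr_le0 ?ltW //.
  by rewrite -subset0 => w Aw; apply: no; exists w.
have [pat clos] := box_pattern_of_outcome m0 (typA _ Aw0) (hatA _ Aw0).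
have subE L' : {subset L' <= box_tree y} -> A `<=` pattern_event Z L' (box_fun y).
  move=> sL w Aw v /sL /mem_box_tree[b <- _]; split; first exact: typA.
  by rewrite box_funE; exact: hatA.
have [[v0 [v0L v0i]]|noinf] := pselect (exists v0, v0 \in box_tree y /\ box_fun y v0 = XInfty).
  have uni v : v \in box_tree y -> box_fun y v = XInfty -> v = v0.
    move=> vL vi; apply: (pattern_event_infinite_unique pat (w := w0) (Z := Z)) => //.
    by apply: (subE _ _ _ Aw0).
  set L' := rem v0 (box_tree y).
  have perm := perm_box_tree v0L; rewrite -/L' in perm.
  have [uL rL nL cL] := pat.
  have pat' : pattern (v0 :: L') (box_fun y).
    split.
    - by rewrite -(perm_uniq perm).
    - by rewrite -(perm_mem perm).
    - by move=> v; rewrite -(perm_mem perm); exact: nL.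
    - by move=> v i; rewrite -!(perm_mem perm); exact: cL.
  have finL' v : v \in L' -> box_fun y v <> XInfty.
    by move=> /(rest_finite pat uni)[k [r ->]].
  have sub : A `<=` pattern_event Z (v0 :: L') (box_fun y).
    by apply: subE => v; rewrite -(perm_mem perm).
  have ub := pr_pattern_infinite Z_meas Z_indep Z_normal Z_special Z_special_inf pat' mA' sub
    erefl v0i finL'.
  have lb := big_degree_prob_liminf kappa_ge0 omega0 omega2
     (large_partial_tree pat v0L uni) (@rest_finite _ _ _ pat v0 uni) (v0_notin_rest pat v0)
     mM delta0.
  apply: filterS lb => n lb.
  apply: le_trans (near_prob_infinite kappa_ge0 M pat clos v0L v0i uni n).
  by apply: le_trans lb; rewrite lerB.
have fin v : v \in box_tree y -> box_fun y v <> XInfty.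
  by move=> vL vi; apply: noinf; exists v.
have pL := pattern_partial pat fin.
have sub : A `<=` pattern_event Z (box_tree y) (box_fun y) by exact: subE.
have ub := pr_pattern_finite Z_meas Z_indep Z_normal Z_special pat mA' sub fin.
have := pattern_prob_cvg kappa_ge0 omega0 omega2 pL.
move/cvgrPdist_le => /(_ _ delta0); apply: filterS => n /ler_normlP[_ h].
apply: le_trans (near_prob_finite kappa_ge0 M pat clos n fin).
by move: ub h; lra.
Qed.

End BoxEvents.

(** * Lower envelopes of the test function on finite boxes *)

Section LowerEnvelope.
Variables (R : realType) (S : nat -> finType) (f : (seq nat -> Xval S) -> R) (C : R).
Hypotheses (f_ge0 : forall t, 0 <= f t) (f_le : forall t, f t <= C).

Lemma xnear_refl N (x : Xval S) : xnear N x x.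
Proof. by case: x => //=; left. Qed.

Lemma xnear_mono N N' (x y : Xval S) : (N <= N')%N -> xnear N' x y -> xnear N x y.
Proof.
move=> NN'; case: x => //= -[->|[k [r [Nk ->]]]]; first by left.
by right; exists k, r; split => //; exact: leq_trans NN' Nk.
Qed.

(** One parameter governs both the box and the threshold for large degrees, so these neighbourhoods
    of the restrictions of a point shrink to that point. *)
Definition box_nbhd m (y : Box m -> Xval S) : set (seq nat -> Xval S) :=
  [set t | forall b : Box m, xnear m (y b) (t (boxval b))].

Definition low m (y : Box m -> Xval S) : R := inf [set f t | t in box_nbhd y].

Lemma low_le m (y : Box m -> Xval S) t : box_nbhd y t -> low y <= f t.
Proof.
move=> yt; apply: ge_inf; last by exists t.
by exists 0 => _ [t' _ <-].
Qed.

Lemma low_ge m (y : Box m -> Xval S) (l : R) :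
  (forall t, box_nbhd y t -> l <= f t) -> l <= low y.
Proof.
move=> H; apply: lb_le_inf; last by move=> _ [t yt <-]; exact: H.
by exists (f (box_fun y)), (box_fun y) => // b; rewrite box_funE; exact: xnear_refl.
Qed.

Lemma low_ge0 m (y : Box m -> Xval S) : 0 <= low y.
Proof. by apply: low_ge. Qed.

Lemma low_le_bound m (y : Box m -> Xval S) : low y <= C.
Proof.
by apply: le_trans (low_le (t := box_fun y) _) (f_le _) => b; rewrite box_funE; exact: xnear_refl.
Qed.

Lemma box_covers (L : seq (seq nat)) : exists m0, forall m, (m0 <= m)%N ->
  forall v, v \in L -> exists b : Box m, boxval b = v.
Proof.
elim: L => [|v L [m0 IH]]; first by exists 0%N.
exists (m0 + (size v + \max_(i <- v) i).+1)%N => m mm u; rewrite inE => /orP[/eqP ->|uL].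
  apply: boxval_onto; first by lia.
  apply/allP => i iv; have := @leq_bigmax_seq _ v xpredT id i iv isT; rewrite /= in mm *; lia.
by apply: IH => //; lia.
Qed.

Hypothesis f_cont : prod_continuous f.

Lemma low_cvg (x : seq nat -> Xval S) :
  low (fun b : Box m => x (boxval b)) @[m --> \oo] --> f x.
Proof.
apply/cvgrPdist_le => e e0; have [L [N HL]] := f_cont x e0.
have [m0 Hm0] := box_covers L.
exists (maxn m0 N) => // m /=; rewrite geq_max => /andP[m0m Nm].
have h1 : low (fun b : Box m => x (boxval b)) <= f x.
  by apply: low_le => b; exact: xnear_refl.
rewrite ger0_norm ?subr_ge0 // lerBlDr -lerBlDl; apply: low_ge => t xt.
have : `|f t - f x| < e.
  apply: HL => v vL; have [b <-] := Hm0 m m0m v vL.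
  exact: xnear_mono Nm (xt b).
by move=> /ltr_normlP[h2 _]; lra.
Qed.

End LowerEnvelope.

Section FinitePatterns.
Variables (S : nat -> finType) (m M : nat).

(** A finite type, so that finitely many limits in n can be handled at once; degrees are below M or
    infinite. *)
Definition fpat := {ffun Box m -> option (option {k : 'I_M & S k})}.

Definition fval (o : option (option {k : 'I_M & S k})) : Xval S :=
  match o with
  | None => XStar
  | Some None => XInfty
  | Some (Some q) => XStr (tagged q)
  end.

Definition fpat_fun (y : fpat) (b : Box m) : Xval S := fval (y b).

Lemma fval_inj : injective fval.
Proof.
move=> [[q|]|] [[q'|]|] //= E.
have /xval_of_opt_inj[-> //] : xval_of_opt (Some q) = xval_of_opt (Some q') by [].
Qed.

Lemma fval_onto (x : Xval S) : (xdeg x < M)%N -> exists o, fval o = x.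
Proof.
case: x => [||k r] /= kM; [by exists None | by exists (Some None) |].
by exists (Some (Some (existT (fun k : 'I_M => S k) (Ordinal kM) r))).
Qed.

(** The neighbourhood of infinity with threshold M contains none of the finite degrees below M, so
    distinct patterns have disjoint neighbourhoods. *)
Lemma fval_near o o' (x : Xval S) : xnear M (fval o) x -> xnear M (fval o') x -> o = o'.
Proof.
case: o => [[q|]|]; case: o' => [[q'|]|] //=; move=> H1 H2.
- by have /fval_inj : fval (Some (Some q)) = fval (Some (Some q')) by rewrite /= -H1 -H2.
- case: H2 => [E|[k [r [Mk E]]]]; rewrite H1 in E => //.
  by move/(congr1 (@xdeg S)) : E => /= E; move: Mk; rewrite -E leqNgt ltn_ord.
- by rewrite H1 in H2.
- case: H1 => [E|[k [r [Mk E]]]]; rewrite H2 in E => //.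
  by move/(congr1 (@xdeg S)) : E => /= E; move: Mk; rewrite -E leqNgt ltn_ord.
- by case: H1 => [E|[k [r [Mk E]]]]; rewrite H2 in E.
- by rewrite H1 in H2.
- by case: H2 => [E|[k [r [Mk E]]]]; rewrite H1 in E.
Qed.

End FinitePatterns.

Section Expectation.
Variables (R : realType) (d : measure_display) (Omega : measurableType d).
Variable (P : probability Omega R).

Lemma bounded_integrable_prob (X : Omega -> R) (C : R) : measurable_fun setT X ->
  (forall w, `|X w| <= C) -> P.-integrable setT (EFin \o X).
Proof.
move=> mX XC; apply: measurable_bounded_integrable => //.
  by rewrite ltey_eq fin_num_measure.
exists C; split; first exact: num_real.
by move=> M CM w _ /=; apply: le_trans (XC w) (ltW CM).
Qed.

Lemma Rintegral_sum_indic (I : eqType) (s : seq I) (A : I -> set Omega) (c : I -> R) :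
  (forall i, measurable (A i)) ->
  measurable_fun setT (fun w => \sum_(i <- s) c i * \1_(A i) w) /\
  \int[P]_w (\sum_(i <- s) c i * \1_(A i) w) = \sum_(i <- s) c i * pr P (A i).
Proof.
move=> mA.
have mI i : measurable_fun setT (fun w => c i * \1_(A i) w).
  by apply: measurable_funM => //; exact: measurable_indic.
have bI i w : `|c i * \1_(A i) w| <= `|c i|.
  by rewrite normrM ler_piMr // indicE; case: (_ \in _); rewrite ?normr1 ?normr0.
have iI i := bounded_integrable_prob (mI i) (bI i).
have IE i : \int[P]_w (c i * \1_(A i) w) = c i * pr P (A i).
  rewrite RintegralZl //; last first.
    apply: (bounded_integrable_prob (C := 1)); first exact: measurable_indic.
    by move=> w; rewrite indicE; case: (_ \in _); rewrite ?normr1 ?normr0.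
  by rewrite /Rintegral integral_indic // setIT.
elim: s => [|i s [IHm IHi]].
  split; first by under eq_fun do rewrite big_nil; exact: measurable_cst.
  under eq_Rintegral do rewrite big_nil.
  by rewrite Rintegral_cst // mul0r big_nil.
split; first by under eq_fun do rewrite big_cons; exact: measurable_funD.
under eq_Rintegral do rewrite big_cons.
rewrite RintegralD ?IHi ?IE ?big_cons //.
apply: (bounded_integrable_prob (C := \sum_(i <- s) `|c i|)) => // w.
by apply: le_trans (ler_norm_sum _ _ _) _; apply: ler_sum => j _; exact: bI.
Qed.

End Expectation.

(** * From pattern probabilities to expectations *)

Section LocalLimit.
Variables (R : realType) (S : nat -> finType) (kappa : forall k, S k -> R).
Hypothesis kappa_ge0 : forall n (r : S n), 0 <= kappa r.
Hypothesis omega0 : 0 < omega kappa 0.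
Hypothesis omega2 : exists k, (2 <= k)%N /\ 0 < omega kappa k.
Variables (d : measure_display) (Omega : measurableType d) (P : probability Omega R).
Variable Z : seq nat * bool -> Omega -> Xval S * nat.
Hypothesis Z_meas : forall i x, measurable (Z i @^-1` [set x]).
Hypothesis Z_indep : mutually_independent P Z.
Hypothesis Z_normal : forall v k (r : S k),
  P (Z (v, false) @^-1` [set (XStr r, 0%N)]) = (pi_ kappa k * (kappa r / wsum kappa k))%:E.
Hypothesis Z_special : forall v k (r : S k) j, (1 <= j <= k)%N ->
  P (Z (v, true) @^-1` [set (XStr r, j)]) =
    ((k%:R * pi_ kappa k) * (kappa r / wsum kappa k) * (k%:R)^-1)%:E.
Hypothesis Z_special_inf : forall v,
  P (Z (v, true) @^-1` [set (XInfty, 0%N)]) = (1 - mu kappa)%:E.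

Notation p := (pr P).
Let hat w : seq nat -> Xval S := hat_beta (fun i => Z i w).
Let hbox m (w : Omega) : Box m -> Xval S := hat_box Z w.

Lemma measurable_hat_box m (A : set (Box m -> Xval S)) : measurable (hbox (m := m) @^-1` A).
Proof.
pose code (y : Box m -> Xval S) := pickle [ffun b => xval_code (y b)].
apply: (measurable_discrete (code := code)) => [y y'|y].
  move=> /(pcan_inj pickleK)/ffunP E; apply/funext => b.
  by have := E b; rewrite !ffunE => /xval_code_inj.
exact: (measurable_box_event Z_meas y).
Qed.

Section NonnegativeTestFunction.
Variables (f : (seq nat -> Xval S) -> R) (C : R).
Hypotheses (f_ge0 : forall t, 0 <= f t) (f_le : forall t, f t <= C).
Hypothesis f_cont : prod_continuous f.

Let G m w : R := low f (hbox (m := m) w).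
Let X w : R := f (hat w).

Lemma test_bound_ge0 : 0 <= C.
Proof. exact: le_trans (f_ge0 (fun=> XStar)) (f_le _). Qed.

Lemma measurable_low m : measurable_fun setT (G m).
Proof.
by move=> _ A mA; rewrite setTI; exact: (measurable_hat_box (fun y => A (low f y))).
Qed.

Lemma low_hat_cvg w : G m w @[m --> \oo] --> X w.
Proof. exact: (low_cvg f_ge0 f_cont). Qed.

Lemma measurable_test : measurable_fun setT X.
Proof. by apply: (measurable_fun_cvg measurable_low) => w _; exact: low_hat_cvg. Qed.

Lemma low_expectation_cvg : \int[P]_w G m w @[m --> \oo] --> \int[P]_w X w.
Proof.
have GC m w : `|G m w| <= C.
  by rewrite ger0_norm; [exact: (low_le_bound f_ge0 f_le) | exact: (low_ge0 f_ge0)].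
have XC w : `|X w| <= C by rewrite ger0_norm; [exact: f_le | exact: f_ge0].
have H : (\int[P]_w (G m w)%:E)%E @[m --> \oo] --> (\int[P]_w (X w)%:E)%E.
  apply: (@dominated_cvg _ _ _ P setT measurableT _ _ (cst C%:E)).
  - by move=> m; apply/measurable_EFinP; exact: measurable_low.
  - by move=> w _; apply/cvg_EFin; [exact: nearW | exact: low_hat_cvg].
  - by [].
  - by apply: (bounded_integrable_prob P (C := C)) => // w; rewrite ger0_norm ?test_bound_ge0.
  - by move=> m w _ /=; rewrite lee_fin.
have XE : (\int[P]_w (X w)%:E)%E = (\int[P]_w X w)%:E.
  rewrite /Rintegral fineK //; apply: integrable_fin_num => //.
  exact: (bounded_integrable_prob P measurable_test XC).
by rewrite XE in H; exact: fine_cvg H.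
Qed.

(** Large but finite degrees only, as [xdeg] is 0 at infinity. In a given outcome the finite box has
    a largest finite degree, hence the probability tends to 0 as M grows. *)
Let rest m M : set Omega := [set w | exists b : Box m, (M <= xdeg (hbox w b))%N].

Lemma rest_cvg m : p (rest m M) @[M --> \oo] --> (0 : R).
Proof.
have mr M : measurable (rest m M).
  exact: (measurable_hat_box [set y | exists b : Box m, (M <= xdeg (y b))%N]).
have r0 : \bigcap_M rest m M = set0.
  rewrite -subset0 => w /= H.
  have [b] := H (\max_(b : Box m) xdeg (hbox w b)).+1 I.
  by rewrite ltnNge leq_bigmax.
have := @nonincreasing_cvg_mu _ _ _ P (rest m).
rewrite r0 measure0 => H.
have {}H : P (rest m M) @[M --> \oo] --> 0%E.
  apply: H => //.
    by rewrite ltey_eq fin_num_measure.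
  move=> M M' MM'; apply/subsetPset => w [b Mb]; exists b.
  exact: leq_trans MM' Mb.
exact: fine_cvg H.
Qed.

Lemma low_expectation_le m M :
  \int[P]_w G m w <=
  \sum_(y : fpat S m M) low f (fpat_fun y) * p (box_event Z (fpat_fun y)) + C * p (rest m M).
Proof.
have mr : measurable (rest m M).
  exact: (measurable_hat_box [set y | exists b : Box m, (M <= xdeg (y b))%N]).
(* [None] stands for the outcomes with a large finite degree in the box, on which [low] is replaced
   by its bound C. *)
pose A (o : option (fpat S m M)) := if o is Some y then box_event Z (fpat_fun y) else rest m M.
pose c (o : option (fpat S m M)) := if o is Some y then low f (fpat_fun y) else C.
pose s := None :: [seq Some y | y <- enum {: fpat S m M}].
have mA o : measurable (A o).
  by case: o => [y|] //=; exact: measurable_box_event.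
have c0 o : 0 <= c o by case: o => [y|] /=; [exact: (low_ge0 f_ge0) | exact: test_bound_ge0].
have [mS iS] := Rintegral_sum_indic P s c mA.
have -> : \sum_(y : fpat S m M) low f (fpat_fun y) * p (box_event Z (fpat_fun y)) +
    C * p (rest m M) = \sum_(o <- s) c o * p (A o).
  by rewrite /s big_cons big_map big_enum /= addrC.
have i0 o w : 0 <= c o * \1_(A o) w by rewrite mulr_ge0.
rewrite -iS; apply: le_Rintegral => //.
- by apply: (bounded_integrable_prob P (@measurable_low m) (C := C)) => w;
    rewrite ger0_norm; [exact: (low_le_bound f_ge0 f_le) | exact: (low_ge0 f_ge0)].
- apply: (bounded_integrable_prob P mS (C := \sum_(o <- s) c o)) => w.
  rewrite ger0_norm ?sumr_ge0 //; apply: ler_sum => o _.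
  by rewrite ler_piMr // indicE; case: (_ \in _).
move=> w _; have [rw|nr] := pselect (rest m M w).
  rewrite /s big_cons /= indicE mem_set // mulr1; apply: ler_wpDr; first exact: sumr_ge0.
  exact: (low_le_bound f_ge0 f_le).
have [y yw] : exists y : fpat S m M, hbox w = fpat_fun y.
  have H (b : Box m) : exists o : option (option {k : 'I_M & S k}), fval o = hbox w b.
    by apply: fval_onto; rewrite ltnNge; apply/negP => Mb; apply: nr; exists b.
  exists [ffun b => projT1 (cid (H b))]; apply/funext => b; rewrite /fpat_fun ffunE.
  by case: cid.
have yin : Some y \in s by rewrite inE /= map_f // mem_enum.
rewrite (perm_big _ (perm_to_rem yin)) big_cons /= indicE mem_set //= mulr1.
by rewrite /G yw lerDl sumr_ge0.
Qed.

(** Neighbourhoods with threshold M are disjoint, so each tree is charged at most once; they lie in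
    those with threshold m <= M, on which [low] bounds f. *)
Lemma En_ge_near m M n : (m <= M)%N ->
  \sum_(y : fpat S m M) low f (fpat_fun y) * near_prob kappa M (fpat_fun y) n <= En kappa f n.
Proof.
move=> mM; rewrite En_sum // /near_prob.
pose W (e : EBox S n) := tree_weight kappa e / Zn kappa n.
have W0 e : 0 <= W e by rewrite divr_ge0 ?tree_weight_ge0 ?Zn_ge0.
pose c (y : fpat S m M) (e : EBox S n) : R := (box_near M (fpat_fun y) e)%:R.
have -> : \sum_(y : fpat S m M) low f (fpat_fun y) *
     ((\sum_(e : EBox S n | plane_tree_n (eshape e) && box_near M (fpat_fun y) e)
         tree_weight kappa e) / Zn kappa n) =
   \sum_(e : EBox S n | plane_tree_n (eshape e))
      W e * \sum_(y : fpat S m M) c y e * low f (fpat_fun y).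
  under [RHS]eq_bigr do rewrite mulr_sumr.
  rewrite exchange_big /=; apply: eq_bigr => y _.
  rewrite mulr_suml mulr_sumr big_mkcondr /=; apply: eq_bigr => e _.
  by rewrite /c; case: ifP => _; rewrite /W /=; ring.
apply: ler_sum => e _; apply: (ler_wpM2l (W0 e)).
have [[y0 hy0]|no] := pselect (exists y : fpat S m M, box_near M (fpat_fun y) e); last first.
  rewrite big1 // => y _; rewrite /c; case h : (box_near _ _ _); last by rewrite mul0r.
  by case: no; exists y.
rewrite (bigD1 y0) //= [X in _ + X]big1 ?addr0 => [|y yy0].
  rewrite /c hy0 mul1r; apply: (low_le f_ge0) => b; move/asboolP: hy0 => /(_ b).
  exact: xnear_mono.
rewrite /c; case E : (box_near _ _ _); rewrite ?mul0r //.
exfalso; move/eqP: yy0; apply; apply/ffunP => b.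
move/asboolP: E => /(_ b) h1; move/asboolP: hy0 => /(_ b) h2.
exact: fval_near h1 h2.
Qed.

Lemma near_forall (I : eqType) (s : seq I) (Q : I -> nat -> Prop) :
  (forall i, \forall n \near tree_filter kappa, Q i n) ->
  \forall n \near tree_filter kappa, forall i, i \in s -> Q i n.
Proof.
move=> HQ; elim: s => [|i s IH]; first by apply: nearW.
apply: filterS2 (HQ i) IH => n h1 h2 j; rewrite inE => /orP[/eqP ->//|]; exact: h2.
Qed.

(** The order of choices matters: m for the quality of the lower envelope, then M for the neglected
    finite degrees, and only then n for the finitely many remaining patterns. *)
Lemma expectation_liminf (eps : R) : 0 < eps ->
  \forall n \near tree_filter kappa, \int[P]_w X w - eps <= En kappa f n.
Proof.
move=> eps0; have e3 : 0 < eps / 3 by rewrite divr_gt0.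
have [m m0 Hm] : exists2 m, (0 < m)%N & \int[P]_w X w - eps / 3 <= \int[P]_w G m w.
  have /cvgrPdist_le/(_ _ e3)[m _ Hm] := low_expectation_cvg.
  exists m.+1 => //; have := Hm m.+1 (leqnSn m); rewrite /= => /ler_normlP[_ h]; lra.
have C1 : 0 < C + 1 by have := test_bound_ge0; lra.
have [M mM HM] : exists2 M, (m <= M)%N & C * p (rest m M) <= eps / 3.
  have d0 : 0 < eps / 3 / (C + 1) by rewrite divr_gt0.
  have /cvgrPdist_le/(_ _ d0)[M _ HM] := rest_cvg m.
  exists (maxn m M); first exact: leq_maxl.
  have := HM (maxn m M) (leq_maxr _ _); rewrite /= sub0r normrN ger0_norm ?pr_ge0 //.
  rewrite ler_pdivlMr // => h; have := test_bound_ge0; have := pr_ge0 P (rest m (maxn m M)).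
  nra.
(* Pattern errors enter weighted by [low], so together they stay below eps / 3; adding 1 covers the
   case that all these weights vanish. *)
pose K : R := \sum_(y : fpat S m M) low f (fpat_fun y).
have K0 : 0 <= K by apply: sumr_ge0 => y _; exact: (low_ge0 f_ge0).
have d0 : 0 < eps / 3 / (K + 1) by rewrite divr_gt0 // ltr_wpDl.
have Hy (y : fpat S m M) : \forall n \near tree_filter kappa,
    p (box_event Z (fpat_fun y)) - eps / 3 / (K + 1) <= near_prob kappa M (fpat_fun y) n.
  exact: (box_event_liminf kappa_ge0 omega0 omega2 Z_meas Z_indep Z_normal Z_special
    Z_special_inf (fpat_fun y) m0 mM d0).
apply: filterS (near_forall (enum {: fpat S m M}) Hy) => n Hn.
apply: le_trans (En_ge_near n mM).
have low_bound := low_expectation_le m M.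
have : \sum_(y : fpat S m M) low f (fpat_fun y) *
     (p (box_event Z (fpat_fun y)) - eps / 3 / (K + 1)) <=
   \sum_(y : fpat S m M) low f (fpat_fun y) * near_prob kappa M (fpat_fun y) n.
  apply: ler_sum => y _; rewrite ler_wpM2l ?(low_ge0 f_ge0) // Hn // mem_enum.
  by [].
apply: le_trans.
under eq_bigr do rewrite mulrBr.
rewrite sumrB -mulr_suml -/K.
have : K * (eps / 3 / (K + 1)) <= eps / 3.
  by rewrite mulrCA ler_piMr ?(ltW e3) // ler_pdivrMr ?mul1r ?lerDl // ltr_wpDl.
move: Hm HM low_bound; lra.
Qed.

End NonnegativeTestFunction.

Lemma En_affine (f : (seq nat -> Xval S) -> R) (b c : R) n : 0 < Zn kappa n ->
  En kappa (fun t => b + c * f t) n = b + c * En kappa f n.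
Proof.
move=> Z0; rewrite !En_sum //.
have total : \sum_(e : EBox S n | plane_tree_n (eshape e)) tree_weight kappa e / Zn kappa n = 1.
  by rewrite -mulr_suml -Zn_sum // divff // gt_eqF.
rewrite -[RHS]/(b + _) -[X in _ = X + _](mulr1 b) -total !mulr_sumr -big_split /=.
by apply: eq_bigr => e _; ring.
Qed.

End LocalLimit.

Lemma prod_continuous_affine (R : realType) (S : nat -> Type) (f : (seq nat -> Xval S) -> R)
  (b c : R) : `|c| <= 1 -> prod_continuous f -> prod_continuous (fun t => b + c * f t).
Proof.
move=> c1 fc x eps eps0; have [L [N H]] := fc x eps eps0; exists L, N => y xy.
apply: le_lt_trans (H y xy).
rewrite (_ : _ - _ = c * (f y - f x)); last by ring.
by rewrite normrM ler_piMl.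
Qed.

Theorem mainTheorem2 (R : realType) (S : nat -> finType)
  (act : forall n, {perm 'I_n} -> S n -> S n)
  (kappa : forall n, S n -> R)
  (act1 : forall n (r : S n), act n 1%g r = r)
  (actM : forall n (s t : {perm 'I_n}) (r : S n),
            act n (s * t)%g r = act n t (act n s r))
  (kappa_ge0 : forall n (r : S n), 0 <= kappa n r)
  (kappa_inv : forall n (s : {perm 'I_n}) (r : S n), kappa n (act n s r) = kappa n r)
  (omega0 : 0 < omega kappa 0)
  (omega2 : exists k, (2 <= k)%N /\ 0 < omega kappa k)
  (d : measure_display) (Omega : measurableType d) (P : probability Omega R)
  (Z : seq nat * bool -> Omega -> Xval S * nat)
  (Z_meas : forall i x, measurable (Z i @^-1` [set x]))
  (Z_indep : mutually_independent P Z)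
  (Z_normal : forall v k (r : S k),
     P (Z (v, false) @^-1` [set (XStr r, 0%N)])
       = (pi_ kappa k * (kappa k r / wsum kappa k))%:E)
  (Z_special : forall v k (r : S k) j, (1 <= j <= k)%N ->
     P (Z (v, true) @^-1` [set (XStr r, j)])
       = ((k%:R * pi_ kappa k) * (kappa k r / wsum kappa k) * (k%:R)^-1)%:E)
  (Z_special_inf : forall v,
     P (Z (v, true) @^-1` [set (XInfty, 0%N)]) = (1 - mu kappa)%:E)
  (f : (seq nat -> Xval S) -> R)
  (f_bounded : bounded_fun f)
  (f_cont : prod_continuous f) :
  forall eps : R, 0 < eps ->
    exists N : nat, forall n : nat, (N <= n)%N -> 0 < Zn kappa n ->
      `| En kappa f n
         - fine (\int[P]_w (f (hat_beta (fun i => Z i w)))%:E)%E | < eps.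
Proof.
move=> eps eps0.
have [C HC] : exists C : R, forall t, `|f t| <= C.
  (* Boundedness provides the bound only for numbers strictly above M. *)
  by have [M [_ HM]] := f_bounded; exists (M + 1) => t; apply: HM; rewrite ?ltrDl.
have e2 : 0 < eps / 2 by rewrite divr_gt0.
have bnd t : - C <= f t <= C by rewrite -ler_norml.
pose X w := f (hat_beta (fun i => Z i w)).
pose g c t := C + c * f t.
have g0 c t : `|c| = 1 -> 0 <= g c t.
  move=> c1; have : `|c * f t| <= C by rewrite normrM c1 mul1r.
  by move=> /ler_normlP[h _]; rewrite /g; lra.
have gC c t : `|c| = 1 -> g c t <= 2 * C.
  move=> c1; have : `|c * f t| <= C by rewrite normrM c1 mul1r.
  by move=> /ler_normlP[_ h]; rewrite /g; lra.
have gcont c : `|c| = 1 -> prod_continuous (g c).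
  by move=> c1; apply: prod_continuous_affine => //; rewrite c1.
have mg c : `|c| = 1 -> measurable_fun setT (fun w => g c (hat_beta (fun i => Z i w))).
  move=> c1; exact: (measurable_test Z_meas (fun t => g0 c t c1) (gcont c c1)).
have n1 : `|1 : R| = 1 by rewrite normr1.
have nN1 : `|- 1 : R| = 1 by rewrite normrN1.
have mX : measurable_fun setT X.
  rewrite (_ : X = fun w => g 1 (hat_beta (fun i => Z i w)) - C).
    by apply: measurable_funB => //; exact: mg.
  by apply/funext => w; rewrite /g /X; ring.
have iX := bounded_integrable_prob P mX (fun w => HC _).
have Ig c : \int[P]_w g c (hat_beta (fun i => Z i w)) = C + c * \int[P]_w X w.
  have ic : P.-integrable setT (EFin \o (fun=> C) : Omega -> \bar R).
    by apply: (bounded_integrable_prob P (C := `|C|)).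
  have icX : P.-integrable setT (EFin \o (fun w => c * X w)).
    apply: (bounded_integrable_prob P (C := `|c| * C)); first exact: measurable_funM.
    by move=> w; rewrite normrM; apply: ler_wpM2l => //; exact: HC.
  rewrite /g RintegralD // Rintegral_cst // RintegralZl //.
  by rewrite (_ : fine _ = 1) ?mulr1 //; rewrite (congr1 fine (probability_setT P)).
have lim c (c1 : `|c| = 1) := expectation_liminf kappa_ge0 omega0 omega2 Z_meas Z_indep
  Z_normal Z_special Z_special_inf (fun t => g0 c t c1) (fun t => gC c t c1) (gcont c c1) e2.
have H : \forall n \near tree_filter kappa,
   `|En kappa f n - fine (\int[P]_w (f (hat_beta (fun i => Z i w)))%:E)%E| < eps.
  have h1 := lim 1 n1; have h2 := lim (- 1) nN1.
  have Z0 : \forall n \near tree_filter kappa, 0 < Zn kappa n by apply: (@near_tree_filter _ _ _ _ 0%N).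
  near=> n.
  have Zn0 : 0 < Zn kappa n by near: n.
  have : \int[P]_w g 1 (hat_beta (fun i => Z i w)) - eps / 2 <= En kappa (g 1) n by near: n.
  have : \int[P]_w g (- 1) (hat_beta (fun i => Z i w)) - eps / 2 <= En kappa (g (- 1)) n
    by near: n.
  rewrite !Ig !En_affine // -/(\int[P]_w X w) => h3 h4.
  rewrite ltr_norml; apply/andP; split; lra.
by have [N _ HN] := H; exists N => n Nn Z0; exact: HN.
Unshelve. all: by end_near.
Qed.
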